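(* Let $(S, \llbracket\_\rrbracket, \unlhd, \tau, \wedge)$ be an S-representation of a Noetherian space $X$, and let $(S', \llbracket\_\rrbracket', \unlhd', \tau', \wedge')$ be the associated S-representation of $X^*$ by syntactic word products described in the context, with the optimization consisting in removing subsumed word products in the definition of $\wedge'$. Then the following tuple $(S'', \llbracket\_\rrbracket'', \unlhd'', \tau'', \wedge'')$ is an S-representation of $X^{\leq\omega}$ (resp., $X^\omega$), with the asymptotic subword topology: (1) $S''$ is the collection of pairs $(P,u)$ where $P \in S'$ and $u$ is a finite (resp., finite and non-empty) subset of $S$. (2) $\llbracket (P,u)\rrbracket'' = \llbracket P\rrbracket' \left(\bigcup_{a\in u}\llbracket a\rrbracket\right)^{\leq\omega}$ (resp., $\llbracket P\rrbracket' \left(\bigcup_{a\in u}\llbracket a\rrbracket\right)^{\omega}$). (3) $(P,u) \unlhd'' (Q,v)$ if and only if $P u^* \unlhd' Q v^*$ and for every $a \in u$, there is a $b \in v$ such that $a \unlhd b$. (4) $\tau''$ is $\{(\varepsilon, \tau)\}$. (5) $(P,u) \wedge'' (Q,v)$ is defined as follows: writing $u \wedge v$ for $\bigcup_{a\in u, b\in v}(a \wedge b)$, $P u^* \wedge' Q v^*$ is a finite set of syntactic word products of the form $R_i (u\wedge v)^*$, $1 \leq i \leq n$, and $(P,u)\wedge''(Q,v)$ is then the set of pairs $(R_i, u\wedge v)$, $1\leq i\leq n$ (resp., the same formula if $u\wedge v \neq \emptyset$, otherwise $\emptyset$).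
   Context: Spaces. A topological space is Noetherian if every open subset is compact (every open cover has a finite subcover; no separation axiom is assumed). A subset $C$ is irreducible if it is non-empty and, for all closed $C_1,C_2$, $C \subseteq C_1\cup C_2$ implies $C\subseteq C_1$ or $C\subseteq C_2$. $\mathcal{S}X$ is the set of irreducible closed subsets of $X$, ordered by inclusion. $X^*$ and $X^\omega$ are the sets of finite, resp. infinite, words over $X$, and $X^{\leq\omega} = X^*\cup X^\omega$. For open subsets $U_1,\ldots,U_n,U$ of $X$ ($n\in\mathbb{N}$), $\langle U_1;\cdots;U_n\rangle$ is the set of finite or infinite words containing a letter in $U_1$, then at a later position a letter in $U_2$, and so on until a letter in $U_n$ (all words if $n=0$); $\langle U_1;\cdots;U_n;(\infty)U\rangle$ is the set of words $uw$ with $u$ a finite word in $\langle U_1;\cdots;U_n\rangle$ and $w$ containing infinitely many letters from $U$. The asymptotic subword topology on $X^{\leq\omega}$ is generated by all these sets; $X^\omega$ has the subspace topology, also called the asymptotic subword topology. The word topology on $X^*$ is the one with base the sets of finite words in $\langle U_1;\cdots;U_n\rangle$. For $C,F\subseteq X$: $C^?$ is the set of words of length at most one whose letter, if any, is in $C$; $F^*$, $F^\omega$, $F^{\leq\omega}$ are the sets of finite, infinite, finite-or-infinite words with all letters in $F$; juxtaposition is concatenation of languages. S-representation. An S-representation of a Noetherian space $X$ is a tuple $(S,\llbracket\_\rrbracket,\unlhd,\tau,\wedge)$ where: (1) $S$ is a recursively enumerable set (of codes); (2) $\llbracket\_\rrbracket$ is a surjective map from $S$ to $\mathcal{S}X$;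 (3) $\unlhd$ is a decidable relation such that, for all $a,b\in S$, $a\unlhd b$ iff $\llbracket a\rrbracket\subseteq\llbracket b\rrbracket$; (4) $\tau$ is a finite subset of $S$ with $X=\bigcup_{a\in\tau}\llbracket a\rrbracket$; (5) $\wedge$ is a computable map from $S\times S$ to the finite subsets of $S$ such that $\llbracket a\rrbracket\cap\llbracket b\rrbracket=\bigcup_{c\in a\wedge b}\llbracket c\rrbracket$. The S-representation of $X^*$ (with the word topology). $S'$ is the collection of all syntactic word products over $S$, namely all regular expressions $A_1\cdots A_N$ (written $\varepsilon$ when $N=0$) where each $A_i$ is either $a^?$ with $a\in S$, or $u^*$ with $u$ a finite subset of $S$. $\llbracket A_1\cdots A_N\rrbracket'=\llbracket A_1\rrbracket'\cdots\llbracket A_N\rrbracket'$ (the language containing only the empty word if $N=0$), with $\llbracket a^?\rrbracket'=\llbracket a\rrbracket^?$ and $\llbracket u^*\rrbracket'=(\bigcup_{a\in u}\llbracket a\rrbracket)^*$. $\tau'$ is $\{\tau^*\}$. The relation $\unlhd'$ is defined inductively by: $\varepsilon\unlhd' Q$ is always true; $P\unlhd'\varepsilon$ is false if $P\neq\varepsilon$; $a^?P\unlhd' b^?Q$ iff ($P\unlhd' Q$ if $a\unlhd b$; $a^?P\unlhd' Q$ otherwise); $a^?P\unlhd' v^*Q$ iff ($P\unlhd' v^*Q$ if $\exists b\in v,\ a\unlhd b$; $a^?P\unlhd' Q$ otherwise); $u^*P\unlhd' b^?Q$ iff ($P\unlhd' b^?Q$ if $u=\emptyset$; $u^*P\unlhd'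 Q$ otherwise); $u^*P\unlhd' v^*Q$ iff ($P\unlhd' v^*Q$ if $\forall a\in u,\exists b\in v,\ a\unlhd b$; $u^*P\unlhd' Q$ otherwise). The map $\wedge'$ from $S'\times S'$ to finite subsets of $S'$ is implemented by the following clauses and the obvious symmetric clauses: $\varepsilon\wedge' Q=\{\varepsilon\}$; $a^?P\wedge' b^?Q=(a^?P\wedge' Q)\cup(P\wedge' b^?Q)\cup\{c^?R\mid c\in a\wedge b,\ R\in P\wedge' Q\}$; $a^?P\wedge' v^*Q=\{c^?R\mid c\in\bigcup_{b\in v}(a\wedge b),\ R\in P\wedge' v^*Q\}\cup(a^?P\wedge' Q)$ if $a\wedge b\neq\emptyset$ for some $b\in v$, and $(P\wedge' v^*Q)\cup(a^?P\wedge' Q)$ otherwise; $u^*P\wedge' v^*Q=\{(\bigcup_{a\in u,b\in v}a\wedge b)^*R\mid R\in(P\wedge' v^*Q)\cup(u^*P\wedge' Q)\}$. Optimization of $\wedge'$. In the definition of $\wedge'$, one removes any subsumed word product in the result; a word product $P$ is subsumed by another one, $Q$, in a given set if and only if $P\unlhd' Q$, or equivalently $\llbracket P\rrbracket'\subseteq\llbracket Q\rrbracket'$. As a special case, in the clause for $a^?P\wedge' v^*Q$, if $Q=\varepsilon$, then one can remove $a^?P\wedge' Q$ ($=\{\varepsilon\}$), which is subsumed by some other word product.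
   Formalization: When word products subsume each other, exactly one is kept, the one with the largest code (removing all, or an arbitrary one, can falsify the claim); for X^ω with τ empty (X empty), where (ε,τ) is not in S'', τ'' is taken to be empty. *)

(* Defs.v *)
From HB Require Import structures.
From mathcomp Require Import all_boot finmap.
From mathcomp Require Import boolp classical_sets topology.

Set Implicit Arguments.
Unset Strict Implicit.
Unset Printing Implicit Defensive.

Local Open Scope nat_scope.
Local Open Scope classical_set_scope.

(* Partial recursive functions, presented as unary functions with a Cantor
   pairing: [Find f] is unbounded minimization of [f (a, _)], and [Prec f g]
   is primitive recursion with parameter.  Programs are syntax; [computes f]
   is the graph of the partial function denoted by [f]. *)

Definition cpair (m n : nat) : nat := ((m + n) * (m + n).+1)./2 + n.

Inductive prog : Type :=
| Zero
| Succ
| Left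
| Right
| Pair of prog & prog
| Comp of prog & prog
| Prec of prog & prog
| Find of prog.

Fixpoint prec_graph (F G : nat -> nat -> Prop) (a n r : nat) : Prop :=
  if n is m.+1 then
    exists2 s, prec_graph F G a m s & G (cpair a (cpair m s)) r
  else F a r.

Fixpoint computes (f : prog) (x r : nat) {struct f} : Prop :=
  match f with
  | Zero => r = 0
  | Succ => r = x.+1
  | Left => exists n, x = cpair r n
  | Right => exists m, x = cpair m r
  | Pair g h => exists a b, [/\ computes g x a, computes h x b & r = cpair a b]
  | Comp g h => exists2 y, computes h x y & computes g y r
  | Prec g h => exists a n,
      x = cpair a n /\ prec_graph (computes g) (computes h) a n r
  | Find g => computes g (cpair x r) 0 /\
      forall k, k < r -> exists s, computes g (cpair x k) s.+1
  end.

Definition recursively_enumerable (A : set nat) : Prop :=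
  exists f : prog, forall n, A n <-> exists r, computes f n r.

(* In the next two notions a program is only constrained on codes of elements;
   a type [S] of codes is given with an (injective) map [code : S -> nat]. *)
Definition decidable_rel (S : Type) (code : S -> nat) (R : rel S) : Prop :=
  exists f : prog, forall a b, computes f (cpair (code a) (code b)) (R a b).

Definition computable_map2 (S T : Type) (codeS : S -> nat) (codeT : T -> nat)
    (h : S -> S -> T) : Prop :=
  exists f : prog,
    forall a b, computes f (cpair (codeS a) (codeS b)) (codeT (h a b)).

(* Canonical index of a finite set: bit [n] is set iff [n] codes an element. *)
Definition code_fset (S : choiceType) (code : S -> nat) (A : {fset S}) : nat :=
  \sum_(a <- A) 2 ^ code a.

Fixpoint code_seq (T : Type) (code : T -> nat) (s : seq T) : nat :=
  if s is x :: s' then (cpair (code x) (code_seq code s')).+1 else 0.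

Definition noetherian (X : topologicalType) : Prop :=
  forall U : set X, open U -> cover_compact U.

Definition irreducible (X : topologicalType) (C : set X) : Prop :=
  C !=set0 /\
  forall C1 C2 : set X, closed C1 -> closed C2 ->
    C `<=` C1 `|` C2 -> C `<=` C1 \/ C `<=` C2.

Definition irreducible_closed (X : topologicalType) (C : set X) : Prop :=
  closed C /\ irreducible C.

Record S_representation (X : topologicalType) (S : choiceType)
    (code : S -> nat) (sem : S -> set X) (le : rel S) (tau : {fset S})
    (meet : S -> S -> {fset S}) : Prop := {
  srep_noetherian : noetherian X;
  srep_code_inj : injective code;
  srep_re : recursively_enumerable (range code);
  srep_irreducible : forall a, irreducible_closed (sem a);
  srep_surjective : forall C, irreducible_closed C -> exists a, sem a = C;
  srep_le_decidable : decidable_rel code le;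
  srep_leP : forall a b, le a b <-> sem a `<=` sem b;
  srep_tauP : [set: X] = \bigcup_(a in [set` tau]) sem a;
  srep_meet_computable : computable_map2 code (code_fset code) meet;
  srep_meetP : forall a b,
    sem a `&` sem b = \bigcup_(c in [set` meet a b]) sem c }.

Inductive word (X : Type) : Type :=
| Fin of seq X
| Inf of (nat -> X).

HB.instance Definition _ (X : Type) := gen_eqMixin (word X).
HB.instance Definition _ (X : Type) := gen_choiceMixin (word X).

Definition letter (X : Type) (w : word X) (i : nat) : option X :=
  match w with Fin s => onth s i | Inf f => Some (f i) end.

Definition letter_in (X : Type) (U : set X) (w : word X) (i : nat) : Prop :=
  exists2 x, letter w i = Some x & U x.

Definition prepend_inf (X : Type) (s : seq X) (f : nat -> X) : nat -> X :=
  fun i => nth (f (i - size s)) s i.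

Definition prepend (X : Type) (s : seq X) (w : word X) : word X :=
  match w with Fin t => Fin (s ++ t) | Inf f => Inf (prepend_inf s f) end.

Fixpoint subword_from (X : Type) (Us : seq (set X)) (w : word X) (k : nat) :
    Prop :=
  if Us is U :: Us' then
    exists i, [/\ k <= i, letter_in U w i & subword_from Us' w i.+1]
  else True.

(* < U_1; ...; U_n > *)
Definition subword_set (X : Type) (Us : seq (set X)) : set (word X) :=
  [set w | subword_from Us w 0].

(* < U_1; ...; U_n; (oo) U > *)
Definition subword_inf_set (X : Type) (Us : seq (set X)) (U : set X) :
    set (word X) :=
  [set w | exists u w', [/\ subword_set Us (Fin u), w = prepend u w' &
     forall n, exists2 i, n <= i & letter_in U w' i]].

Definition asymptotic_subbase (X : topologicalType) : set (set (word X)) :=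
  [set W | exists2 Us : seq (set X), ({in Us, forall U, open U}) &
     W = subword_set Us \/
     exists2 U : set X, open U & W = subword_inf_set Us U].

(* X^{<= omega} *)
Definition fin_inf_words (X : topologicalType) : Type := word X.

HB.instance Definition _ (X : topologicalType) := Choice.on (fin_inf_words X).
HB.instance Definition _ (X : topologicalType) :=
  isSubBaseTopological.Build (fin_inf_words X) (@asymptotic_subbase X) id.

(* X^omega with the subspace topology, which is the initial topology of the
   inclusion; [nat -> X] itself carries the product topology. *)
Definition inf_words (X : topologicalType) : Type :=
  initial_topology (@Inf X : (nat -> X) -> fin_inf_words X).

HB.instance Definition _ (X : topologicalType) :=
  Topological.on (inf_words X).

Inductive atom (S : choiceType) : Type :=
| Opt of S
| Star of {fset S}.

Definition sum_of_atom (S : choiceType) (A : atom S) : S + {fset S} :=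
  match A with Opt a => inl a | Star u => inr u end.

Definition atom_of_sum (S : choiceType) (A : S + {fset S}) : atom S :=
  match A with inl a => Opt a | inr u => Star u end.

Lemma sum_of_atomK (S : choiceType) :
  cancel (@sum_of_atom S) (@atom_of_sum S).
Proof. by case. Qed.

HB.instance Definition _ (S : choiceType) :=
  Choice.copy (atom S) (can_type (@sum_of_atomK S)).

Definition product (S : choiceType) : Type := seq (atom S).

HB.instance Definition _ (S : choiceType) := Choice.on (product S).

Definition code_atom (S : choiceType) (code : S -> nat) (A : atom S) : nat :=
  match A with
  | Opt a => cpair 0 (code a)
  | Star u => cpair 1 (code_fset code u)
  end.

Definition code_product (S : choiceType) (code : S -> nat) (P : product S) :
    nat :=
  code_seq (code_atom code) P.

Section WordProducts.

Variables (X S : choiceType) (code : S -> nat).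
Variables (sem : S -> set X) (le : rel S) (meet : S -> S -> {fset S}).

Definition sem_fset (u : {fset S}) : set X := \bigcup_(a in [set` u]) sem a.

Definition sem_atom (A : atom S) : set (seq X) :=
  match A with
  | Opt a => [set s | s = [::] \/ exists2 x, sem a x & s = [:: x]]
  | Star u => [set s | {in s, forall x, sem_fset u x}]
  end.

Fixpoint sem_product (P : product S) : set (seq X) :=
  if P is A :: P' then
    [set s | exists s1 s2, [/\ sem_atom A s1, sem_product P' s2 & s = s1 ++ s2]]
  else [set [::]].

Definition dominated (u v : {fset S}) : bool :=
  all (fun a => has (fun b => le a b) v) u.

(* Both [le_product] and [meet_product] recurse on one of their two arguments
   at each step, hence the nested fixpoints. *)
Fixpoint le_product (P : product S) : product S -> bool :=
  fix le_P (Q : product S) : bool :=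
    match P, Q with
    | [::], _ => true
    | _ :: _, [::] => false
    | Opt a :: P', Opt b :: Q' => if le a b then le_product P' Q' else le_P Q'
    | Opt a :: P', Star v :: Q' =>
        if has (fun b => le a b) v then le_product P' Q else le_P Q'
    | Star u :: P', Opt b :: Q' =>
        if u == fset0 then le_product P' Q else le_P Q'
    | Star u :: P', Star v :: Q' =>
        if dominated u v then le_product P' Q else le_P Q'
    end.

Local Open Scope fset_scope.

Definition meet_fset (u v : {fset S}) : {fset S} :=
  \bigcup_(a <- u) \bigcup_(b <- v) meet a b.

(* Removal of the subsumed products of a finite set.  Among products that
   subsume each other exactly one has to be kept: it is the one with the
   largest code.  The choice matters: in [u^* P /\ v^*] both [w^*] and [w^* R]
   may occur and subsume each other, and it is the longer one that ends with
   the expected star; prefixing or lengthening a product increases its code. *)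
Definition subsumed (P Q : product S) : bool :=
  [&& Q != P, le_product P Q &
      ~~ le_product Q P || (code_product code P < code_product code Q)%N].

Definition remove_subsumed (A : {fset product S}) : {fset product S} :=
  [fset P in A | ~~ has (fun Q => subsumed P Q) A].

Definition opt_products (A : {fset S}) (B : {fset product S}) :
    {fset product S} :=
  [fset (Opt c :: R : product S) | c in A, R in B].

Definition star_products (u : {fset S}) (B : {fset product S}) :
    {fset product S} :=
  [fset (Star u :: R : product S) | R in B].

(* The clauses for [Star, Opt] mirror those for [Opt, Star] but keep the operands
   of [meet] in order, so that the final star of the meet of two products ending
   in [u^*] and [v^*] is exactly [(meet_fset u v)^*]. *)
Fixpoint meet_product (P : product S) : product S -> {fset product S} :=
  fix meet_P (Q : product S) : {fset product S} :=
    match P, Q with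
    | [::], _ | _, [::] => [fset ([::] : product S)]
    | Opt a :: P', Opt b :: Q' => remove_subsumed
        (meet_P Q' `|` meet_product P' Q
         `|` opt_products (meet a b) (meet_product P' Q'))
    | Opt a :: P', Star v :: Q' => remove_subsumed
        (if has (fun b => meet a b != fset0) v then
           opt_products (\bigcup_(b <- v) meet a b) (meet_product P' Q)
           `|` meet_P Q'
         else meet_product P' Q `|` meet_P Q')
    | Star u :: P', Opt b :: Q' => remove_subsumed
        (if has (fun a => meet a b != fset0) u then
           opt_products (\bigcup_(a <- u) meet a b) (meet_P Q')
           `|` meet_product P' Q
         else meet_P Q' `|` meet_product P' Q)
    | Star u :: P', Star v :: Q' => remove_subsumed
        (star_products (meet_fset u v) (meet_product P' Q `|` meet_P Q'))
    end.

Local Close Scope fset_scope.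

Definition with_star (P : product S) (u : {fset S}) : product S :=
  rcons P (Star u).

Definition without_last (P : product S) : product S := take (size P).-1 P.

Definition code_pair (c : product S * {fset S}) : nat :=
  cpair (code_product code c.1) (code_fset code c.2).

Definition le_pair (c d : product S * {fset S}) : bool :=
  le_product (with_star c.1 c.2) (with_star d.1 d.2) && dominated c.2 d.2.

Definition sem_fin_inf (c : product S * {fset S}) : set (word X) :=
  [set w | exists s w', [/\ sem_product c.1 s, w = prepend s w' &
     forall i x, letter w' i = Some x -> sem_fset c.2 x]].

Definition tau_fin_inf (tau : {fset S}) : {fset product S * {fset S}} :=
  [fset ([::], tau)]%fset.

(* On products of the form [R_i (u /\ v)^*], [without_last] returns [R_i]. *)
Definition meet_fin_inf (c d : product S * {fset S}) :
    {fset product S * {fset S}} :=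
  [fset (without_last T, meet_fset c.2 d.2)
     | T in meet_product (with_star c.1 c.2) (with_star d.1 d.2)]%fset.

Definition nonempty_fset : Type := {u : {fset S} | u != fset0%fset}.
HB.instance Definition _ := Choice.on nonempty_fset.

Definition forget_nonempty (c : product S * nonempty_fset) :
    product S * {fset S} :=
  (c.1, val c.2).

Definition code_pair_inf (c : product S * nonempty_fset) : nat :=
  code_pair (forget_nonempty c).

Definition le_pair_inf (c d : product S * nonempty_fset) : bool :=
  le_pair (forget_nonempty c) (forget_nonempty d).

Definition sem_inf (c : product S * nonempty_fset) : set (nat -> X) :=
  [set f | exists s g, [/\ sem_product c.1 s, f = prepend_inf s g &
     forall i, sem_fset (val c.2) (g i)]].

(* [tau] is empty only if the represented space is. *)
Definition tau_inf (tau : {fset S}) : {fset product S * nonempty_fset} :=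
  if insub tau is Some t then [fset ([::], t)]%fset else fset0%fset.

Definition meet_inf (c d : product S * nonempty_fset) :
    {fset product S * nonempty_fset} :=
  if insub (meet_fset (val c.2) (val d.2)) is Some uv then
    [fset (without_last T, uv)
       | T in meet_product (with_star c.1 (val c.2))
                           (with_star d.1 (val d.2))]%fset
  else fset0%fset.

End WordProducts.

(* Main.v *)
(* The languages of the pairs (P, u) are closed and irreducible.  They form a
   well-founded family for inclusion: if a product R is included in P Q, it
   splits as R = R1 R2 with R1 included in P and R2 in Q, so accessibility passes
   from the factors to their product, and the atoms inherit it from the closed
   sets of X.  Finite intersections of these languages and complements of
   subbasic open sets are finite unions of them; by the descending chain
   condition so is every closed set, whence the space is Noetherian and has no
   other irreducible closed sets.

   An infinite word lies outside P F^{<= omega} either because infinitely many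
   of its letters avoid F, or because a finite prefix is not in P F^*; each case
   gives an open set of the corresponding kind.

   For effectivity, a function between coded types is computable when one program
   acts correctly on all codes of elements.  Such functions are closed under list
   and finite-set recursion, and [le_product] and [meet_product] are instances of
   a double recursion computed row by row. *)
Require Import Defs.
From HB Require Import structures.
From mathcomp Require Import all_boot finmap.
From mathcomp Require Import boolp classical_sets topology.
From mathcomp Require Import zify.

Set Implicit Arguments.
Unset Strict Implicit.
Unset Printing Implicit Defensive.

Local Open Scope nat_scope.
Local Open Scope classical_set_scope.

(** The order on pairs has two conditions because two kinds of words test an inclusion: finite words
    see exactly [P u^*], and constant infinite words see exactly [u]. Among infinite words alone, a
    finite word [s] of [P u^*] is tested by prolonging it with one letter of [u] repeated forever,
    which is where non-emptiness of [u] enters. The delicate point of the meet is its form rather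
    than its language. The recursion may exhaust one operand and return the empty product; the
    expected final star survives because the removal of subsumed products deletes the candidates
    that are too short, ties being decided by the code. This removal is shown to preserve the
    language for products that are empty or end in a star, so form and language are proved in one
    induction. Irreducibility rests on open sets being stable under insertion of letters: finite
    words can be concatenated, and infinite words interleaved, without leaving either of two open
    sets. The results on infinite words are mostly drawn from those on all words along the inclusion
    [Inf]. *)

(** * Cantor pairing *)

Definition triangle n := (n * n.+1)./2.

Lemma triangleS n : triangle n.+1 = triangle n + n.+1.
Proof.
rewrite /triangle; have -> : n.+1 * n.+2 = n * n.+1 + n.+1 * 2 by lia.
by rewrite muln2 halfD odd_double andbF add0n doubleK.
Qed.

(** Diagonal [m] occupies the codes from [triangle m] to [triangle m + m], so distinct diagonals do
    not overlap; injectivity of [cpair] follows. *)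
Lemma leq_triangle m n : m < n -> triangle m + m < triangle n.
Proof.
elim: n => // n IH; rewrite ltnS leq_eqVlt => /predU1P[->|/IH]; rewrite triangleS; lia.
Qed.

Lemma cpairE m n : cpair m n = triangle (m + n) + n.
Proof. by []. Qed.

Lemma cpair_inj m n m' n' : cpair m n = cpair m' n' -> m = m' /\ n = n'.
Proof.
rewrite !cpairE => E.
have [lt|lt|eq] := ltngtP (m + n) (m' + n').
- by have := leq_triangle lt; lia.
- by have := leq_triangle lt; lia.
- by move: E; rewrite eq => /addnI E; lia.
Qed.

(** Pairs are enumerated diagonal by diagonal: the successor of [(m.+1, n)] is [(m, n.+1)], and that
    of [(0, n)] opens the next diagonal with [(n.+1, 0)]. *)
Lemma cpair_surj x : exists m n, x = cpair m n.
Proof.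
elim: x => [|x [[|m] [n ->]]]; first by exists 0, 0.
  by exists n.+1, 0; rewrite !cpairE !add0n !addn0 triangleS; lia.
by exists m, n.+1; rewrite !cpairE addSnnS !addnS.
Qed.

Lemma leq_cpairr m n : n <= cpair m n.
Proof. by rewrite cpairE leq_addl. Qed.

Lemma ltn_cpair2 m n n' : n < n' -> cpair m n < cpair m n'.
Proof.
move=> lt; rewrite !cpairE.
by have := @leq_triangle (m + n) (m + n') ltac:(lia); lia.
Qed.

(** * Partial recursive functions *)

(** In the case of [Find], the smaller of two distinct results would make the body return both 0 and
    a successor. *)
Lemma computes_fun f x r r' : computes f x r -> computes f x r' -> r = r'.
Proof.
elim: f x r r' => //=.
- by move=> x r r' -> ->.
- by move=> x r r' -> ->.
- by move=> x r r' [n ->] [n' /cpair_inj[]].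
- by move=> x r r' [n ->] [n' /cpair_inj[]].
- move=> f IHf g IHg x r r' [a [b [fa gb ->]]] [a' [b' [fa' gb' ->]]].
  by rewrite (IHf _ _ _ fa fa') (IHg _ _ _ gb gb').
- move=> f IHf g IHg x r r' [y gy fy] [y' gy' fy'].
  by move: fy'; rewrite -(IHg _ _ _ gy gy'); apply: IHf.
- move=> f IHf g IHg x r r' [a [n [-> H]]] [a' [n' [/cpair_inj[<- <-] H']]].
  elim: n r r' H H' => [|n IH] r r' /=; first exact: IHf.
  move=> [s /IH Hs gs] [s' /Hs ss' gs'].
  by move: gs'; rewrite -ss'; apply: IHg.
- move=> f IHf x r r' [f0 fS] [f0' fS'].
  have [lt|lt|//] := ltngtP r r'.
    by have [s fs] := fS' _ lt; have := IHf _ _ _ f0 fs.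
  by have [s fs] := fS _ lt; have := IHf _ _ _ f0' fs.
Qed.

(** Every number is a pair, so taking it apart and pairing again is the identity. *)
Definition prog_id := Pair Left Right.

Lemma prog_idP x : computes prog_id x x.
Proof.
have [m [n ->]] := cpair_surj x.
by exists m, n; split=> //=; [exists n|exists m].
Qed.

Definition prog_const n := iter n (Comp Succ) Zero.

Lemma prog_constP n x : computes (prog_const n) x n.
Proof. by elim: n => //= n IH; exists n. Qed.

Definition prog_not := Comp (Prec (prog_const 1) Zero) (Pair Zero prog_id).

Lemma prog_notP n : n <= 1 -> computes prog_not n (1 - n).
Proof.
move=> n1; exists (cpair 0 n).
  by exists 0, n; split=> //; exact: prog_idP.
case: n n1 => [|[]] //= _; first by exists 0, 0; split=> //=; exists 0.
by exists 0, 1; split=> //=; exists 1 => //; exists 0.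
Qed.

(* A primitive recursion of length 0 never evaluates its step: the branch that
   is not selected may diverge. *)
Definition prog_if (c f g : prog) : prog :=
  Comp (Prec Right (Comp g (Comp Left Left)))
    (Pair (Pair prog_id (Comp (Prec Zero (Comp f Left))
                              (Pair prog_id (Comp prog_not c)))) c).

Lemma prog_if0 c f g x r :
  computes c x 0 -> computes f x r -> computes (prog_if c f g) x r.
Proof.
move=> cx fx; exists (cpair (cpair x r) 0).
  exists (cpair x r), 0; split=> //; exists x, r; split=> //; first exact: prog_idP.
  exists (cpair x 1).
    exists x, 1; split=> //; first exact: prog_idP.
    by exists 0 => //; exact: (@prog_notP 0).
  exists x, 1; split=> //=; exists 0 => //; exists x => //.
  by exists (cpair 0 0).
by exists (cpair x r), 0; split=> //=; exists x.
Qed.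

Lemma prog_if1 c f g x r :
  computes c x 1 -> computes g x r -> computes (prog_if c f g) x r.
Proof.
move=> cx gx; exists (cpair (cpair x 0) 1).
  exists (cpair x 0), 1; split=> //; exists x, 0; split=> //; first exact: prog_idP.
  exists (cpair x 0).
    exists x, 0; split=> //; first exact: prog_idP.
    by exists 1 => //; exact: (@prog_notP 1).
  by exists x, 0; split.
exists (cpair x 0), 1; split=> //=; exists 0; first by exists x.
exists x => //; exists (cpair x 0); last by exists 0.
by exists (cpair 0 0).
Qed.

(** * Computable functions between coded types *)

Definition computable (T U : Type) (cT : T -> nat) (cU : U -> nat) (h : T -> U) :=
  exists f : prog, forall t, computes f (cT t) (cU (h t)).

Definition code_prod (T U : Type) (cT : T -> nat) (cU : U -> nat) (x : T * U) :=
  cpair (cT x.1) (cU x.2).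

Local Notation "c '*c' d" := (code_prod c d) (at level 40, left associativity).

Section Combinators.
Variables (E A B C : Type).
Variables (cE : E -> nat) (cA : A -> nat) (cB : B -> nat) (cC : C -> nat).

Lemma computable_id : computable cE cE id.
Proof. by exists prog_id => t; exact: prog_idP. Qed.

Lemma computable_const (v : A) : computable cE cA (fun=> v).
Proof. by exists (prog_const (cA v)) => t; exact: prog_constP. Qed.

Lemma computable_comp (g : A -> B) (f : E -> A) :
  computable cA cB g -> computable cE cA f -> computable cE cB (fun e => g (f e)).
Proof. by move=> [p gP] [q fP]; exists (Comp p q) => t; exists (cA (f t)). Qed.

Lemma computable_pair (f : E -> A) (g : E -> B) :
  computable cE cA f -> computable cE cB g ->
  computable cE (cA *c cB) (fun e => (f e, g e)).
Proof.
move=> [p fP] [q gP]; exists (Pair p q) => t.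
by exists (cA (f t)), (cB (g t)); split.
Qed.

Lemma computable_fst (f : E -> A * B) :
  computable cE (cA *c cB) f -> computable cE cA (fun e => (f e).1).
Proof.
move=> [p fP]; exists (Comp Left p) => t; exists ((cA *c cB) (f t)) => //=.
by exists (cB (f t).2).
Qed.

Lemma computable_snd (f : E -> A * B) :
  computable cE (cA *c cB) f -> computable cE cB (fun e => (f e).2).
Proof.
move=> [p fP]; exists (Comp Right p) => t; exists ((cA *c cB) (f t)) => //=.
by exists (cA (f t).1).
Qed.

Lemma computable_code (f : E -> A) :
  computable cE cA f -> computable cE id (fun e => cA (f e)).
Proof. by []. Qed.

Lemma computable_if (b : E -> bool) (f g : E -> A) :
  computable cE nat_of_bool b -> computable cE cA f -> computable cE cA g ->
  computable cE cA (fun e => if b e then f e else g e).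
Proof.
move=> [p bP] [q fP] [r gP]; exists (prog_if p r q) => t.
by have := bP t; case: (b t) => /= bt; [apply: prog_if1|apply: prog_if0].
Qed.

(** Environment, index and accumulator reach the step as one tuple. Functions below are therefore
    rewritten with bodies that project from such tuples, so that unification finds the step. *)
Lemma computable_natrec (z : E -> C) (f : E * (nat * C) -> C) (n : E -> nat) :
  computable cE cC z -> computable (cE *c (id *c cC)) cC f ->
  computable cE id n ->
  computable cE cC
    (fun e => nat_rect (fun=> C) (z e) (fun i c => f (e, (i, c))) (n e)).
Proof.
move=> [p zP] [q fP] [r nP]; exists (Comp (Prec p q) (Pair prog_id r)) => t.
exists (cpair (cE t) (n t)).
  by exists (cE t), (n t); split=> //; exact: prog_idP.
exists (cE t), (n t); split=> //.
elim: (n t) => [|m IH] /=; first exact: zP.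
eexists; first exact: IH.
exact: (fP (t, (m, _))).
Qed.

Lemma computable_succ (f : E -> nat) :
  computable cE id f -> computable cE id (fun e => (f e).+1).
Proof. by move=> [p fP]; exists (Comp Succ p) => t; exists (f t). Qed.

Lemma computable_sgn (f : E -> nat) :
  computable cE id f -> computable cE nat_of_bool (fun e => f e != 0).
Proof.
move=> [p fP]; exists (Comp (Prec Zero (prog_const 1)) (Pair Zero p)) => t.
exists (cpair 0 (f t)); first by exists 0, (f t); split.
exists 0, (f t); split=> //; case: (f t) => //= n; rewrite -/computes.
have: exists s, prec_graph (fun=> eq^~ 0) (computes (prog_const 1)) 0 n s.
  elim: n => [|n [s H]] /=; first by exists 0.
  by exists 1, s => //; exists 0.
by move=> [s ?]; exists s => //; exists 0.
Qed.

End Combinators.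

Lemma computable_ext (T U : Type) (cT : T -> nat) (cU : U -> nat) (f g : T -> U) :
  f =1 g -> computable cT cU g -> computable cT cU f.
Proof. by move=> /funext ->. Qed.

Lemma computable_comp2 (E A B C : Type) (cE : E -> nat) (cA : A -> nat)
    (cB : B -> nat) (cC : C -> nat) (h : A * B -> C) (f : E -> A) (g : E -> B) :
  computable (cA *c cB) cC h -> computable cE cA f -> computable cE cB g ->
  computable cE cC (fun e => h (f e, g e)).
Proof. by move=> ch cf cg; apply: computable_comp ch _; exact: computable_pair. Qed.

(** Settles the functions built from projections, pairing and constants over one environment;
    functions of several variables are treated as functions of a nested pair. *)
Ltac comp_proj := repeat
  match goal with
  | |- computable _ _ (fun e => fst _) => eapply computable_fst
  | |- computable _ _ (fun e => snd _) => eapply computable_snd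
  | |- computable _ _ (@fst _ _) => eapply (computable_fst (f := id))
  | |- computable _ _ (@snd _ _) => eapply (computable_snd (f := id))
  | |- computable _ _ (fun e => e) => apply computable_id
  | |- computable _ _ id => apply computable_id
  | |- computable _ _ (fun e => pair _ _) => apply computable_pair
  | |- computable _ _ (fun=> _) => apply computable_const
  end.

Lemma computable_predn : computable id id predn.
Proof.
apply: (@computable_ext _ _ _ _ _
  (fun n => nat_rect (fun=> nat) 0 (fun i _ => (n, (i, 0)).2.1) n)).
  by case.
by apply: (computable_natrec (f := fun x => x.2.1)); comp_proj.
Qed.

Lemma computable_addn : computable (id *c id) id (fun x => x.1 + x.2).
Proof.
apply: (@computable_ext _ _ _ _ _
  (fun x => nat_rect (fun=> nat) x.1 (fun i c => (x, (i, c)).2.2.+1) x.2)).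
  by case=> m; elim=> [|n /= <-]; rewrite ?addn0 ?addnS.
apply: (computable_natrec (f := fun x => x.2.2.+1)); comp_proj.
by apply: computable_succ; comp_proj.
Qed.

Lemma computable_subn : computable (id *c id) id (fun x => x.1 - x.2).
Proof.
apply: (@computable_ext _ _ _ _ _
  (fun x => nat_rect (fun=> nat) x.1 (fun i c => (x, (i, c)).2.2.-1) x.2)).
  by case=> m; elim=> [|n /= <-]; rewrite ?subn0 ?subnS.
apply: (computable_natrec (f := fun x => x.2.2.-1)); comp_proj.
by apply: (computable_comp computable_predn); comp_proj.
Qed.

Lemma computable_exp2 : computable id id (expn 2).
Proof.
apply: (@computable_ext _ _ _ _ _
  (fun x => nat_rect (fun=> nat) 1 (fun i c => (x, (i, c)).2.2 + (x, (i, c)).2.2) x)).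
  by elim=> //= n <-; rewrite expnS mul2n addnn.
apply: (computable_natrec (f := fun x => x.2.2 + x.2.2)); comp_proj.
by apply: (computable_comp2 computable_addn); comp_proj.
Qed.

Section Bool.
Variables (E : Type) (cE : E -> nat).

Lemma computable_leq (f g : E -> nat) :
  computable cE id f -> computable cE id g ->
  computable cE nat_of_bool (fun e => f e <= g e).
Proof.
move=> cf cg; apply: (@computable_ext _ _ _ _ _
  (fun e => if f e - g e != 0 then false else true)).
  by move=> e; rewrite -subn_eq0; case: eqP.
apply: computable_if; comp_proj; apply: computable_sgn.
exact: (computable_comp2 computable_subn).
Qed.

Lemma computable_negb (b : E -> bool) :
  computable cE nat_of_bool b -> computable cE nat_of_bool (fun e => ~~ b e).
Proof.
move=> cb; apply: (@computable_ext _ _ _ _ _ (fun e => if b e then false else true)).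
  by move=> e; case: (b e).
by apply: computable_if; comp_proj.
Qed.

Lemma computable_andb (b c : E -> bool) :
  computable cE nat_of_bool b -> computable cE nat_of_bool c ->
  computable cE nat_of_bool (fun e => b e && c e).
Proof.
move=> cb cc; apply: (@computable_ext _ _ _ _ _ (fun e => if b e then c e else false)).
  by move=> e; case: (b e).
by apply: computable_if; comp_proj.
Qed.

Lemma computable_orb (b c : E -> bool) :
  computable cE nat_of_bool b -> computable cE nat_of_bool c ->
  computable cE nat_of_bool (fun e => b e || c e).
Proof.
move=> cb cc; apply: (@computable_ext _ _ _ _ _ (fun e => if b e then true else c e)).
  by move=> e; case: (b e).
by apply: computable_if; comp_proj.
Qed.

Lemma computable_eq (T : eqType) (cT : T -> nat) (f g : E -> T) : injective cT ->
  computable cE cT f -> computable cE cT g ->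
  computable cE nat_of_bool (fun e => f e == g e).
Proof.
move=> injT cf cg; apply: (@computable_ext _ _ _ _ _
  (fun e => (cT (f e) <= cT (g e)) && (cT (g e) <= cT (f e)))).
  by move=> e; rewrite -eqn_leq (inj_eq injT).
by apply: computable_andb; apply: computable_leq.
Qed.

End Bool.

Lemma computable_odd : computable id nat_of_bool odd.
Proof.
apply: (@computable_ext _ _ _ _ _
  (fun x => nat_rect (fun=> bool) false (fun i c => ~~ (x, (i, c)).2.2) x)).
  by elim=> //= n <-.
apply: (computable_natrec (cC := nat_of_bool) (f := fun x => ~~ x.2.2)); comp_proj.
by apply: computable_negb; comp_proj.
Qed.

Lemma computable_half : computable id id half.
Proof.
apply: (@computable_ext _ _ _ _ _
  (fun x => nat_rect (fun=> nat) 0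
     (fun i c => if odd (x, (i, c)).2.1 then (x, (i, c)).2.2.+1
                 else (x, (i, c)).2.2) x)).
  elim=> // n /= <-; rewrite uphalf_half; by case: (odd n).
apply: (computable_natrec
  (f := fun x => if odd x.2.1 then x.2.2.+1 else x.2.2)); comp_proj.
apply: computable_if; comp_proj.
  by apply: (computable_comp computable_odd); comp_proj.
by apply: computable_succ; comp_proj.
Qed.

Definition bit (N i : nat) : bool := odd (iter i half N).

Lemma computable_bit : computable (id *c id) nat_of_bool (fun x => bit x.1 x.2).
Proof.
apply: (computable_comp computable_odd (f := fun x => iter x.2 half x.1)).
apply: (@computable_ext _ _ _ _ _
  (fun x => nat_rect (fun=> nat) x.1 (fun i c => (x, (i, c)).2.2./2) x.2)).
  by case=> m; elim=> //= n ->.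
apply: (computable_natrec (f := fun x => x.2.2./2)); comp_proj.
by apply: (computable_comp computable_half); comp_proj.
Qed.

(** * Lists *)

(** The code of a list bounds its length and so serves as a number of iterations sufficient for a
    fold. *)
Lemma leq_size_code (T : Type) (c : T -> nat) s : size s <= code_seq c s.
Proof. by elim: s => //= x s IH; rewrite ltnS (leq_trans IH) ?leq_cpairr. Qed.

Lemma code_seq_map (T U : Type) (c : U -> nat) (f : T -> U) s :
  code_seq c (map f s) = code_seq (c \o f) s.
Proof. by elim: s => //= x s ->. Qed.

Lemma code_seq_inj (T : Type) (c : T -> nat) : injective c -> injective (code_seq c).
Proof.
move=> injc; elim=> [|x s IH] [|y t] //= [] /cpair_inj[/injc -> /IH ->] //.
Qed.

Section Lists.
Variables (E A B C : Type).
Variables (cE : E -> nat) (cA : A -> nat) (cB : B -> nat) (cC : C -> nat).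

Lemma computable_cons (f : E -> A) (s : E -> seq A) :
  computable cE cA f -> computable cE (code_seq cA) s ->
  computable cE (code_seq cA) (fun e => f e :: s e).
Proof.
move=> [p fP] [q sP]; exists (Comp Succ (Pair p q)) => t.
by eexists; last reflexivity; exists (cA (f t)), (code_seq cA (s t)).
Qed.

(** The conditional must not evaluate the branch it rejects: on the empty list, the program of [k]
    would be run on a number that need not be a code. *)
Lemma computable_seqcase (s : E -> seq A) (z : E -> C) (k : E * (A * seq A) -> C) :
  computable cE (code_seq cA) s -> computable cE cC z ->
  computable (cE *c (cA *c code_seq cA)) cC k ->
  computable cE cC (fun e => if s e is x :: s' then k (e, (x, s')) else z e).
Proof.
move=> [p sP] [q zP] [r kP].
have [u uP] : computable cE nat_of_bool (fun e => code_seq cA (s e) != 0).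
  by apply: computable_sgn; exists p.
have [v vP] := computable_predn.
exists (prog_if u q (Comp r (Pair prog_id (Comp v p)))) => t.
have := uP t; have := sP t; case: (s t) => [|x s'] pt ut.
  by apply: prog_if0 => //; exact: zP.
apply: prog_if1 => //; eexists; last exact: (kP (t, (x, s'))).
exists (cE t), (cpair (cA x) (code_seq cA s')); split=> //; first exact: prog_idP.
by eexists; first exact: pt; exact: (vP (cpair _ _).+1).
Qed.
End Lists.

Section Folds.
Variables (E A B C : Type).
Variables (cE : E -> nat) (cA : A -> nat) (cB : B -> nat) (cC : C -> nat).

(** Primitive recursion needs its length in advance. The code of the list is used, and the state,
    made of the unread list and the accumulator, no longer changes once the list is exhausted. *)
Lemma computable_foldl (f : E * (C * A) -> C) (z : E -> C) (s : E -> seq A) :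
  computable (cE *c (cC *c cA)) cC f -> computable cE cC z ->
  computable cE (code_seq cA) s ->
  computable cE cC (fun e => foldl (fun c x => f (e, (c, x))) (z e) (s e)).
Proof.
move=> cf cz cs.
pose step (y : E * (nat * (seq A * C))) : seq A * C :=
  if y.2.2.1 is x :: s' then (s', f (y.1, (y.2.2.2, x))) else ([::], y.2.2.2).
apply: (@computable_ext _ _ _ _ _ (fun e =>
  (nat_rect (fun=> (seq A * C)%type) (s e, z e) (fun i c => step (e, (i, c)))
    (code_seq cA (s e))).2)).
  move=> e; have := leq_size_code cA (s e); move: (code_seq _ _) => n.
  (* The step ignores its index, so the first iteration can be split off just as well as the
     last. *)
  have shift m t c : nat_rect (fun=> (seq A * C)%type) (t, c)
      (fun i c => step (e, (i, c))) m.+1 =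
      nat_rect (fun=> (seq A * C)%type) (step (e, (0, (t, c))))
      (fun i c => step (e, (i, c))) m.
    by elim: m => //= m ->.
  elim: n (s e) (z e) => [|n IH] [|x t] c //.
    by rewrite shift; exact: (IH [::]).
  by move=> st; rewrite shift [LHS]/= IH.
apply: (@computable_snd _ _ _ _ (code_seq cA)).
apply: (computable_natrec (cC := code_seq cA *c cC) (f := step)) => //; comp_proj => //.
apply: (computable_seqcase (cA := cA) (s := fun y => y.2.2.1) (z := fun y => ([::], y.2.2.2))
  (k := fun y => (y.2.2, f (y.1.1, (y.1.2.2.2, y.2.1))))); comp_proj.
by apply: (computable_comp cf); comp_proj.
Qed.

End Folds.

Section ListFunctions.
Variables (E A B C : Type).
Variables (cE : E -> nat) (cA : A -> nat) (cB : B -> nat) (cC : C -> nat).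

Lemma computable_rev (s : E -> seq A) :
  computable cE (code_seq cA) s -> computable cE (code_seq cA) (fun e => rev (s e)).
Proof.
move=> cs; apply: (@computable_ext _ _ _ _ _
  (fun e => foldl (fun c x => (e, (c, x)).2.2 :: (e, (c, x)).2.1) [::] (s e))).
  move=> e; rewrite /rev; move: [::]; by elim: (s e) => //= x t IH c; rewrite IH.
apply: (computable_foldl (f := fun y => y.2.2 :: y.2.1) _ _ cs); comp_proj.
by apply: computable_cons; comp_proj.
Qed.

Lemma computable_foldr (f : E * (A * C) -> C) (z : E -> C) (s : E -> seq A) :
  computable (cE *c (cA *c cC)) cC f -> computable cE cC z ->
  computable cE (code_seq cA) s ->
  computable cE cC (fun e => foldr (fun x c => f (e, (x, c))) (z e) (s e)).
Proof.
move=> cf cz cs; apply: (@computable_ext _ _ _ _ _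
  (fun e => foldl (fun c x => f (e, ((e, (c, x)).2.2, (e, (c, x)).2.1))) (z e) (rev (s e)))).
  by move=> e; rewrite foldl_rev.
apply: (computable_foldl (f := fun y => f (y.1, (y.2.2, y.2.1))) _ cz).
  by apply: (computable_comp cf); comp_proj.
exact: computable_rev.
Qed.

End ListFunctions.

Section ListOperations.
Variables (E A B : Type) (cE : E -> nat) (cA : A -> nat) (cB : B -> nat).

Lemma computable_behead (s : E -> seq A) :
  computable cE (code_seq cA) s -> computable cE (code_seq cA) (fun e => behead (s e)).
Proof.
move=> cs; apply: (@computable_ext _ _ _ _ _
  (fun e => if s e is x :: s' then (e, (x, s')).2.2 else [::])).
  by move=> e; case: (s e).
by apply: (computable_seqcase (k := fun y => y.2.2) cs); comp_proj.
Qed.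

Lemma computable_head (x0 : A) (s : E -> seq A) :
  computable cE (code_seq cA) s -> computable cE cA (fun e => head x0 (s e)).
Proof.
move=> cs; apply: (@computable_ext _ _ _ _ _
  (fun e => if s e is x :: s' then (e, (x, s')).2.1 else x0)).
  by move=> e; case: (s e).
by apply: (computable_seqcase (k := fun y => y.2.1) cs); comp_proj.
Qed.

Lemma computable_rcons (s : E -> seq A) (f : E -> A) :
  computable cE (code_seq cA) s -> computable cE cA f ->
  computable cE (code_seq cA) (fun e => rcons (s e) (f e)).
Proof.
move=> cs cf; apply: (@computable_ext _ _ _ _ _ (fun e => rev (f e :: rev (s e)))).
  by move=> e; rewrite rev_cons revK.
by apply: computable_rev; apply: computable_cons => //; apply: computable_rev.
Qed.

Lemma computable_map (f : E * A -> B) (s : E -> seq A) :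
  computable (cE *c cA) cB f -> computable cE (code_seq cA) s ->
  computable cE (code_seq cB) (fun e => [seq f (e, x) | x <- s e]).
Proof.
move=> cf cs; apply: (@computable_ext _ _ _ _ _
  (fun e => foldr (fun x c => f (e, (e, (x, c)).2.1) :: (e, (x, c)).2.2) [::] (s e))).
  by move=> e; elim: (s e) => //= x t ->.
apply: (computable_foldr (f := fun y => f (y.1, y.2.1) :: y.2.2) _ _ cs); comp_proj.
apply: computable_cons; comp_proj.
by apply: (computable_comp cf); comp_proj.
Qed.

Lemma computable_filter (f : E * A -> bool) (s : E -> seq A) :
  computable (cE *c cA) nat_of_bool f -> computable cE (code_seq cA) s ->
  computable cE (code_seq cA) (fun e => [seq x <- s e | f (e, x)]).
Proof.
move=> cf cs; apply: (@computable_ext _ _ _ _ _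
  (fun e => foldr (fun x c => if f (e, (e, (x, c)).2.1) then
      (e, (x, c)).2.1 :: (e, (x, c)).2.2 else (e, (x, c)).2.2) [::] (s e))).
  by move=> e; elim: (s e) => //= x t ->.
apply: (computable_foldr (f := fun y =>
  if f (y.1, y.2.1) then y.2.1 :: y.2.2 else y.2.2) _ _ cs); comp_proj.
apply: computable_if; last 2 first.
- by apply: computable_cons; comp_proj.
- by comp_proj.
by apply: (computable_comp cf); comp_proj.
Qed.

Lemma computable_has (f : E * A -> bool) (s : E -> seq A) :
  computable (cE *c cA) nat_of_bool f -> computable cE (code_seq cA) s ->
  computable cE nat_of_bool (fun e => has (fun x => f (e, x)) (s e)).
Proof.
move=> cf cs; apply: (@computable_ext _ _ _ _ _
  (fun e => foldr (fun x c => f (e, (e, (x, c)).2.1) || (e, (x, c)).2.2) false (s e))).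
  by move=> e; elim: (s e) => //= x t ->.
apply: (computable_foldr (cC := nat_of_bool)
  (f := fun y => f (y.1, y.2.1) || y.2.2) _ _ cs); comp_proj.
apply: computable_orb; comp_proj.
by apply: (computable_comp cf); comp_proj.
Qed.

Lemma computable_all (f : E * A -> bool) (s : E -> seq A) :
  computable (cE *c cA) nat_of_bool f -> computable cE (code_seq cA) s ->
  computable cE nat_of_bool (fun e => all (fun x => f (e, x)) (s e)).
Proof.
move=> cf cs; apply: (@computable_ext _ _ _ _ _
  (fun e => ~~ has (fun x => ~~ f (e, x)) (s e))).
  by move=> e; rewrite has_predC negbK.
apply/computable_negb/(computable_has (f := fun y => ~~ f y)) => //.
exact: computable_negb.
Qed.

Lemma computable_size (s : E -> seq A) :
  computable cE (code_seq cA) s -> computable cE id (fun e => size (s e)).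
Proof.
move=> cs; apply: (@computable_ext _ _ _ _ _
  (fun e => foldr (fun x c => (e, (x, c)).2.2.+1) 0 (s e))).
  by move=> e; elim: (s e) => //= x t ->.
apply: (computable_foldr (f := fun y => y.2.2.+1) _ _ cs); comp_proj.
by apply: computable_succ; comp_proj.
Qed.

End ListOperations.

Lemma computable_nth (E A : Type) (cE : E -> nat) (cA : A -> nat) (x0 : A)
    (s : E -> seq A) (n : E -> nat) :
  computable cE (code_seq cA) s -> computable cE id n ->
  computable cE cA (fun e => nth x0 (s e) (n e)).
Proof.
move=> cs cn; apply: (@computable_ext _ _ _ _ _
  (fun e => head x0 (nat_rect (fun=> seq A) (s e)
      (fun i c => behead (e, (i, c)).2.2) (n e)))).
  move=> e; rewrite -nth0; suff -> : forall m, nat_rect (fun=> seq A) (s e)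
      (fun i c => behead (e, (i, c)).2.2) m = drop m (s e).
    by rewrite nth_drop addn0.
  by elim=> [|m /= ->]; rewrite ?drop0 // -drop1 drop_drop add1n.
apply/computable_head/(computable_natrec (f := fun y => behead y.2.2)) => //.
by apply: computable_behead; comp_proj.
Qed.

Lemma computable_iota : computable id (code_seq id) (iota 0).
Proof.
apply: (@computable_ext _ _ _ _ _
  (fun m => nat_rect (fun=> seq nat) [::]
      (fun i c => rcons (m, (i, c)).2.2 (m, (i, c)).2.1) m)).
  by elim=> // n IH; rewrite [RHS]/= -IH -addn1 iotaD cats1.
apply: (computable_natrec (f := fun y => rcons y.2.2 y.2.1)); comp_proj.
by apply: (computable_rcons (cA := id)); comp_proj.
Qed.

(** * Recursion on two lists *)

Section DoubleRecursion.
Variables (A B C : Type) (cA : A -> nat) (cB : B -> nat) (cC : C -> nat).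
Variables (h : seq A -> seq B -> C) (c0 c1 : C) (F : (A * B) * (C * (C * C)) -> C).
Hypothesis h0 : forall t, h [::] t = c0.
Hypothesis h1 : forall x s, h (x :: s) [::] = c1.
Hypothesis hS : forall x s y t, h (x :: s) (y :: t) =
  F ((x, y), (h s (y :: t), (h (x :: s) t, h s t))).

Fixpoint tails (t : seq B) : seq (seq B) :=
  t :: if t is _ :: t' then tails t' else [::].

(* The state is the row under construction paired with the part of the previous
   row that has not been read, latest entries first. *)
Let step (e : A) (yc : B * (seq C * seq C)) : seq C * seq C :=
  (F ((e, yc.1), (head c0 (behead yc.2.2), (head c0 yc.2.1, head c0 yc.2.2)))
     :: yc.2.1, behead yc.2.2).

Lemma tails_head t : tails t = t :: behead (tails t).
Proof. by case: t. Qed.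

(** The row of [s] lists the values [h s t'] for all tails [t'] of the second list, longest first.
    An outer fold over the first list turns each row into the next one. *)
Lemma computable_rec2 : computable ((cA *c cB) *c (cC *c (cC *c cC))) cC F ->
  computable (code_seq cA *c code_seq cB) cC (fun x => h x.1 x.2).
Proof.
move=> cF.
pose row (y : (seq A * seq B) * (A * seq C)) : seq C :=
  (foldr (fun b c => step y.2.1 (b, c)) ([:: c1], rev y.2.2) y.1.2).1.
have rowE t x s : row ((s, t), (x, [seq h s t' | t' <- tails t])) =
    [seq h (x :: s) t' | t' <- tails t].
  (* The remainder [r] is kept arbitrary: when [t] grows by one letter, the entry of the previous
     row for the longer tail joins [r]. *)
  have gen r : foldr (fun b c => step x (b, c))
        ([:: c1], rev [seq h s t' | t' <- tails t] ++ r) t =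
      ([seq h (x :: s) t' | t' <- tails t], h s t :: r).
    elim: t r => [|y t IH] r /=; first by rewrite h1.
    by rewrite rev_cons -cats1 -catA IH /step /= hS [tails t]tails_head.
  by rewrite /row -[rev _]cats0 gen.
have rowsE s t : foldr (fun x r => row ((s, t), (x, r))) [seq c0 | _ <- tails t] s =
    [seq h s t' | t' <- tails t].
  elim: s => [|x s IH] /=; first by apply: eq_map => t'; rewrite h0.
  by rewrite -rowE -IH.
(* The initial row has one entry per tail of [x.2]; the additional [c0] in front accounts for there
   being one more tail than letters. *)
apply: (@computable_ext _ _ _ _ _ (fun x =>
  head c0 (foldr (fun a r => row (x, (a, r))) (c0 :: [seq c0 | _ <- x.2]) x.1))).
  case=> s t /=; rewrite -[h s t]/(head c0 (h s t :: [seq h s t' | t' <- behead (tails t)])).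
  rewrite -map_cons -tails_head -rowsE; congr (head _ (foldr _ _ _)).
  by elim: t {rowE rowsE} => //= y t ->.
apply: computable_head; apply: (computable_foldr (f := row)).
- apply: (@computable_fst _ _ _ _ _ (code_seq cC)).
  apply: (computable_foldr (cC := code_seq cC *c code_seq cC)
    (f := fun y => step y.1.2.1 y.2)); rewrite ?/step; comp_proj.
  + apply: computable_cons.
      apply: (computable_comp cF); comp_proj; apply: computable_head; comp_proj.
      by apply: computable_behead; comp_proj.
    by comp_proj.
  + by apply: computable_behead; comp_proj.
  + by apply: computable_rev; comp_proj.
- apply: computable_cons; comp_proj.
  by apply: (computable_map (f := fun=> c0) (cA := cB)); comp_proj.
- by comp_proj.
Qed.

End DoubleRecursion.

(** * Binary codes of finite sets *)

Lemma bitS N i : bit N i.+1 = bit N./2 i.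
Proof. by rewrite /bit iterSr. Qed.

(** Exponent 0 gives the parity of the sum, and the other exponents, lowered by one, give its half.
    Distinctness of the exponents excludes carries. *)
Lemma bit_sum (s : seq nat) j : uniq s -> bit (\sum_(i <- s) 2 ^ i) j = (j \in s).
Proof.
have split0 (t : seq nat) : uniq t ->
    \sum_(i <- t) 2 ^ i = (0 \in t) + (\sum_(i <- [seq k.-1 | k <- t & 0 < k]) 2 ^ i).*2.
  elim: t => [|[|k] t IH] /=; first by rewrite !big_nil.
    by case/andP=> t0 /IH; rewrite big_cons => ->; rewrite (negPf t0).
  by case/andP=> _ /IH; rewrite !big_cons => ->; rewrite expnS mul2n doubleD addnCA.
elim: j s => [|j IH] s us.
  by rewrite /bit /= split0 // oddD odd_double addbF; case: (0 \in s).
rewrite bitS split0 // halfD odd_double andbF add0n doubleK.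
have -> : (0 \in s)./2 = 0 by case: (0 \in s).
rewrite add0n IH.
  apply/mapP/idP => [[k]|js]; last by exists j.+1; rewrite // mem_filter.
  by rewrite mem_filter => /andP[k0 ks ->]; rewrite prednK.
rewrite map_inj_in_uniq ?filter_uniq // => x y.
by rewrite !mem_filter => /andP[x0 _] /andP[y0 _] xy; rewrite -(prednK x0) xy prednK.
Qed.

(** All set bits of [N] are thus found by a search below [N], which makes the quantifiers over bits
    bounded. *)
Lemma bit_ltn N i : bit N i -> i < N.
Proof.
elim: i N => [|i IH] N; first by case: N.
rewrite bitS => /IH lt; apply: (leq_ltn_trans lt).
by case: N lt => [|N] // _; rewrite -{2}[N.+1]odd_double_half; lia.
Qed.

Definition bits (N : nat) : seq nat := [seq i <- iota 0 N | bit N i].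

Lemma mem_bits N i : (i \in bits N) = bit N i.
Proof.
rewrite mem_filter mem_iota add0n /=; case: (boolP (bit N i)) => // /bit_ltn ->.
by [].
Qed.

Lemma computable_bits : computable id (code_seq id) bits.
Proof.
apply: (computable_filter (cA := id) (f := fun y => bit y.1 y.2)).
  exact: computable_bit.
exact: computable_iota.
Qed.

Section FsetCodes.
Variables (T : choiceType) (c : T -> nat) (injc : injective c).
Implicit Types A : {fset T}.

Lemma bit_code_fset A i : bit (code_fset c A) i = (i \in map c A).
Proof. by rewrite /code_fset -(big_map c xpredT) bit_sum // map_inj_uniq. Qed.

Lemma bit_code_fset_mem A x : bit (code_fset c A) (c x) = (x \in A).
Proof. by rewrite bit_code_fset mem_map. Qed.

Lemma code_fset_inj : injective (code_fset c).
Proof. by move=> A B E; apply/fsetP => x; rewrite -!bit_code_fset_mem E. Qed.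

(** The order in which a finite set stores its elements bears no relation to the codes. Sorted by
    code, the elements follow the set bits, which a program can list. *)
Definition elems A : seq T := sort (relpre c leq) A.

Lemma perm_elems A : perm_eq (elems A) A.
Proof. by rewrite perm_sort. Qed.

Lemma mem_elems A : elems A =i A.
Proof. exact/perm_mem/perm_elems. Qed.

Lemma map_elems A : map c (elems A) = bits (code_fset c A).
Proof.
apply: (irr_sorted_eq (leT := ltn)); [exact: ltn_trans|exact: ltnn| | |].
- rewrite ltn_sorted_uniq_leq map_inj_uniq // sort_uniq fset_uniq /= sorted_map.
  by apply: sort_sorted => x y /=; exact: leq_total.
- by apply: sorted_filter; [exact: ltn_trans|exact: iota_ltn_sorted].
- move=> i; rewrite mem_bits bit_code_fset.
  by apply/perm_mem/perm_map; exact: perm_elems.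
Qed.

Variables (E : Type) (cE : E -> nat).

(** A list of elements has the same code as the list of their codes, so the program that lists the
    set bits serves without any decoding. *)
Lemma computable_elems (A : E -> {fset T}) :
  computable cE (code_fset c) A -> computable cE (code_seq c) (fun e => elems (A e)).
Proof.
move=> cA; have [p pP] : computable cE (code_seq id) (fun e => bits (code_fset c (A e))).
  exact: (computable_comp computable_bits (computable_code cA)).
by exists p => e; have := pP e; rewrite -map_elems code_seq_map.
Qed.

Lemma computable_fset1U (f : E -> T) (A : E -> {fset T}) :
  computable cE c f -> computable cE (code_fset c) A ->
  computable cE (code_fset c) (fun e => f e |` A e)%fset.
Proof.
move=> cf cA; have [p pP] : computable cE id (fun e =>
    if bit (code_fset c (A e)) (c (f e)) then code_fset c (A e)
    else 2 ^ c (f e) + code_fset c (A e)).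
  apply: computable_if => //.
    exact: (computable_comp2 (h := fun x => bit x.1 x.2) computable_bit).
  apply: (computable_comp2 computable_addn) => //.
  exact: (computable_comp computable_exp2).
exists p => e; have := pP e; rewrite bit_code_fset_mem.
case: ifPn => fA; first by rewrite (fsetUidPr _ _ _) // fsub1set.
by rewrite {2}/code_fset big_fsetU1.
Qed.

End FsetCodes.

Lemma computable_fset (E : Type) (T : choiceType) (cE : E -> nat) (c : T -> nat)
    (injc : injective c) (s : E -> seq T) :
  computable cE (code_seq c) s ->
  computable cE (code_fset c) (fun e => [fset x in s e]%fset).
Proof.
move=> cs; apply: (@computable_ext _ _ _ _ _
  (fun e => foldr (fun x A => (e, (x, A)).2.1 |` (e, (x, A)).2.2) fset0 (s e))%fset).
  move=> e; apply/fsetP => x; rewrite inE /=.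
  by elim: (s e) => [|y t]; rewrite /= ?inE ?in_cons // => ->.
apply: (computable_foldr (cC := code_fset c) 
  (f := fun y => (y.2.1 |` y.2.2)%fset) _ _ cs); comp_proj.
by apply: computable_fset1U => //; comp_proj.
Qed.

Section FsetFunctions.
Variables (E : Type) (T U : choiceType).
Variables (cE : E -> nat) (c : T -> nat) (d : U -> nat).
Hypotheses (injc : injective c) (injd : injective d).

Lemma computable_imfset (f : E * T -> U) (A : E -> {fset T}) :
  computable (cE *c c) d f -> computable cE (code_fset c) A ->
  computable cE (code_fset d) (fun e => [fset f (e, x) | x in A e]%fset).
Proof.
move=> cf cA; apply: (@computable_ext _ _ _ _ _
  (fun e => [fset y in [seq f (e, x) | x <- elems c (A e)]]%fset)).
  move=> e; apply/fsetP => y; rewrite inE; apply/imfsetP/mapP => -[x /= xA ->];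
  by exists x; rewrite ?mem_elems // -(mem_elems c).
apply: (computable_fset injd); apply: (computable_map (cA := c)) => //.
exact: (computable_elems injc).
Qed.

Lemma computable_fset_has (f : E * T -> bool) (A : E -> {fset T}) :
  computable (cE *c c) nat_of_bool f -> computable cE (code_fset c) A ->
  computable cE nat_of_bool (fun e => has (fun x => f (e, x)) (A e)).
Proof.
move=> cf cA; apply: (@computable_ext _ _ _ _ _
  (fun e => has (fun x => f (e, x)) (elems c (A e)))).
  by move=> e; apply: eq_has_r => x; rewrite mem_elems.
by apply: (computable_has (cA := c)) => //; exact: (computable_elems injc).
Qed.

Lemma computable_fset_all (f : E * T -> bool) (A : E -> {fset T}) :
  computable (cE *c c) nat_of_bool f -> computable cE (code_fset c) A ->
  computable cE nat_of_bool (fun e => all (fun x => f (e, x)) (A e)).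
Proof.
move=> cf cA; apply: (@computable_ext _ _ _ _ _
  (fun e => all (fun x => f (e, x)) (elems c (A e)))).
  by move=> e; apply: eq_all_r => x; rewrite mem_elems.
by apply: (computable_all (cA := c)) => //; exact: (computable_elems injc).
Qed.

Lemma computable_fset_filter (f : E * T -> bool) (A : E -> {fset T}) :
  computable (cE *c c) nat_of_bool f -> computable cE (code_fset c) A ->
  computable cE (code_fset c) (fun e => [fset x in A e | f (e, x)]%fset).
Proof.
move=> cf cA; apply: (@computable_ext _ _ _ _ _
  (fun e => [fset x in [seq x <- elems c (A e) | f (e, x)]]%fset)).
  by move=> e; apply/fsetP => x; rewrite !inE mem_filter mem_elems andbC.
by apply/(computable_fset injc)/(computable_filter (cA := c)) => //; exact: (computable_elems injc).
Qed.

Lemma computable_fsetU (A B : E -> {fset T}) :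
  computable cE (code_fset c) A -> computable cE (code_fset c) B ->
  computable cE (code_fset c) (fun e => A e `|` B e)%fset.
Proof.
move=> cA cB; apply: (@computable_ext _ _ _ _ _
  (fun e => foldr (fun x C => (e, (x, C)).2.1 |` (e, (x, C)).2.2) (B e) (elems c (A e)))%fset).
  move=> e; apply/fsetP => x; rewrite inE /= -(mem_elems c).
  elim: (elems c (A e)) => [|y t IH] /=; rewrite ?inE //.
  by rewrite -orbA -IH.
apply: (computable_foldr (cC := code_fset c) (f := fun y => (y.2.1 |` y.2.2)%fset) _ cB).
  by apply: computable_fset1U => //; comp_proj.
exact: (computable_elems injc).
Qed.

Lemma computable_eq0 (A : E -> {fset T}) :
  computable cE (code_fset c) A ->
  computable cE nat_of_bool (fun e => A e == fset0).
Proof.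
by move=> cA; apply: (computable_eq (code_fset_inj injc)) => //; comp_proj.
Qed.

End FsetFunctions.

Section Bigcup.
Variables (E : Type) (T U : choiceType).
Variables (cE : E -> nat) (c : T -> nat) (d : U -> nat).
Hypotheses (injc : injective c) (injd : injective d).

Lemma computable_bigfcup (f : E * T -> {fset U}) (A : E -> {fset T}) :
  computable (cE *c c) (code_fset d) f -> computable cE (code_fset c) A ->
  computable cE (code_fset d) (fun e => \bigcup_(x <- A e) f (e, x))%fset.
Proof.
move=> cf cA; apply: (@computable_ext _ _ _ _ _
  (fun e => foldr (fun x C => f (e, (e, (x, C)).2.1) `|` (e, (x, C)).2.2)
     fset0 (elems c (A e)))%fset).
  move=> e; rewrite -(perm_big _ (perm_elems c (A e))).
  by elim: (elems c (A e)) => [|y t IH] /=; rewrite ?big_nil // big_cons IH.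
apply: (computable_foldr (cC := code_fset d)
  (f := fun y => (f (y.1, y.2.1) `|` y.2.2)%fset)); last exact: (computable_elems injc).
  apply: computable_fsetU => //; comp_proj.
  by apply: (computable_comp cf); comp_proj.
by comp_proj.
Qed.

End Bigcup.

(** * Effectivity of the operations on atoms, products and pairs *)

Section Atoms.
Variables (S : choiceType) (code : S -> nat) (injc : injective code).

Lemma code_atom_inj : injective (code_atom code).
Proof.
move=> [a|u] [b|v] /= /cpair_inj [] // _; first by move/injc->.
by move/(code_fset_inj injc) ->.
Qed.

Lemma code_product_inj : injective (code_product code).
Proof. exact: code_seq_inj code_atom_inj. Qed.

Lemma code_pair_inj : injective (code_pair code).
Proof.
by move=> [P u] [Q v] /cpair_inj[/code_product_inj /= -> /(code_fset_inj injc) /= ->].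
Qed.

Variables (E A : Type) (cE : E -> nat) (cA : A -> nat).

Lemma computable_Opt (f : E -> S) :
  computable cE code f -> computable cE (code_atom code) (fun e => Opt (f e)).
Proof.
move=> [p fP]; exists (Pair Zero p) => t.
by exists 0, (code (f t)); split.
Qed.

Lemma computable_Star (f : E -> {fset S}) :
  computable cE (code_fset code) f ->
  computable cE (code_atom code) (fun e => Star (f e)).
Proof.
move=> [p fP]; exists (Pair (prog_const 1) p) => t.
by exists 1, (code_fset code (f t)); split=> //; exact: prog_constP.
Qed.

Lemma computable_atomcase (g : E -> atom S) (f1 : E * S -> A) (f2 : E * {fset S} -> A) :
  computable cE (code_atom code) g -> computable (cE *c code) cA f1 ->
  computable (cE *c code_fset code) cA f2 ->
  computable cE cA (fun e => match g e with Opt a => f1 (e, a) | Star u => f2 (e, u) end).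
Proof.
move=> [p gP] [q1 f1P] [q2 f2P].
pose br q := Comp q (Pair prog_id (Comp Right p)).
have brP q t n m : computes p (cE t) (cpair n m) ->
    forall r, computes q (cpair (cE t) m) r -> computes (br q) (cE t) r.
  move=> pt r qr; exists (cpair (cE t) m) => //; exists (cE t), m; split=> //.
    exact: prog_idP.
  by exists (cpair n m) => //; exists n.
exists (prog_if (Comp Left p) (br q1) (br q2)) => t.
have := gP t; case: (g t) => [a|u] pt.
  apply: prog_if0; first by exists (cpair 0 (code a)) => //; exists (code a).
  by apply: brP pt _ _; exact: (f1P (t, a)).
apply: prog_if1; first by exists (cpair 1 (code_fset code u)) => //; exists (code_fset code u).
by apply: brP pt _ _; exact: (f2P (t, u)).
Qed.

End Atoms.

Section ProductFunctions.
Variables (S : choiceType) (code : S -> nat) (le : rel S) (meet : S -> S -> {fset S}).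
Hypothesis injc : injective code.
Hypothesis computable_le : decidable_rel code le.
Hypothesis computable_meet : computable_map2 code (code_fset code) meet.

Let cle : computable (code *c code) nat_of_bool (fun x => le x.1 x.2).
Proof. by have [f fP] := computable_le; exists f => -[a b]; exact: fP. Qed.

Let cmeet : computable (code *c code) (code_fset code) (fun x => meet x.1 x.2).
Proof. by have [f fP] := computable_meet; exists f => -[a b]; exact: fP. Qed.

Lemma computable_dominated :
  computable (code_fset code *c code_fset code) nat_of_bool
    (fun x => dominated le x.1 x.2).
Proof.
rewrite /dominated; apply: (computable_fset_all injc
  (E := ({fset S} * {fset S})%type)
  (f := fun y => has (fun b => le y.2 b) y.1.2)); last by comp_proj.
apply: (computable_fset_has injc (f := fun z => le z.1.2 z.2)); last by comp_proj.
by apply: (computable_comp2 (h := fun x => le x.1 x.2) cle); comp_proj.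
Qed.

Lemma computable_meet_fset :
  computable (code_fset code *c code_fset code) (code_fset code)
    (fun x => meet_fset meet x.1 x.2).
Proof.
rewrite /meet_fset; apply: (computable_bigfcup injc injc
  (E := ({fset S} * {fset S})%type)
  (f := fun y => (\bigcup_(b <- y.1.2) meet y.2 b)%fset)); last by comp_proj.
apply: (computable_bigfcup injc injc (f := fun z => meet z.1.2 z.2)); last by comp_proj.
by apply: (computable_comp2 (h := fun x => meet x.1 x.2) cmeet); comp_proj.
Qed.

Local Notation catom := (code_atom code).

Lemma computable_le_product :
  computable (code_product code *c code_product code) nat_of_bool
    (fun x => le_product le x.1 x.2).
Proof.
(* The components of [x.2] are the recursive values with the first argument shortened, with the
   second shortened, and with both shortened, in this order. *)
pose F (x : (atom S * atom S) * (bool * (bool * bool))) : bool :=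
  match x.1.1 with
  | Opt a => match x.1.2 with
    | Opt b => if le a b then x.2.2.2 else x.2.2.1
    | Star v => if has (fun b => le a b) v then x.2.1 else x.2.2.1
    end
  | Star u => match x.1.2 with
    | Opt b => if u == fset0 then x.2.1 else x.2.2.1
    | Star v => if dominated le u v then x.2.1 else x.2.2.1
    end
  end.
apply: (@computable_rec2 _ _ _ catom catom nat_of_bool (le_product le) true false F).
- by case.
- by case.
- by move=> [a|u] s [b|v] t.
apply: (computable_atomcase (code := code) (g := fun x => x.1.1)
  (f1 := fun y => match y.1.1.2 with
    | Opt b => if le y.2 b then y.1.2.2.2 else y.1.2.2.1
    | Star v => if has (fun b => le y.2 b) v then y.1.2.1 else y.1.2.2.1 end)
  (f2 := fun y => match y.1.1.2 with
    | Opt b => if y.2 == fset0 then y.1.2.1 else y.1.2.2.1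
    | Star v => if dominated le y.2 v then y.1.2.1 else y.1.2.2.1 end)).
- by comp_proj.
- apply: (computable_atomcase (code := code) (g := fun y => y.1.1.2)
    (f1 := fun z => if le z.1.2 z.2 then z.1.1.2.2.2 else z.1.1.2.2.1)
    (f2 := fun z => if has (fun b => le z.1.2 b) z.2 then z.1.1.2.1 else z.1.1.2.2.1));
    first by comp_proj.
    apply: computable_if; comp_proj.
    by apply: (computable_comp2 (h := fun x => le x.1 x.2) cle); comp_proj.
  apply: computable_if; comp_proj.
  apply: (computable_fset_has injc (f := fun w => le w.1.1.2 w.2)); last by comp_proj.
  by apply: (computable_comp2 (h := fun x => le x.1 x.2) cle); comp_proj.
- apply: (computable_atomcase (code := code) (g := fun y => y.1.1.2)
    (f1 := fun z => if z.1.2 == fset0 then z.1.1.2.1 else z.1.1.2.2.1)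
    (f2 := fun z => if dominated le z.1.2 z.2 then z.1.1.2.1 else z.1.1.2.2.1));
    first by comp_proj.
    apply: computable_if; comp_proj.
    by apply: (computable_eq0 injc); comp_proj.
  apply: computable_if; comp_proj.
  by apply: (computable_comp2 (h := fun x => dominated le x.1 x.2) computable_dominated);
    comp_proj.
Qed.

Local Notation cprods := (code_fset (code_product code)).
Let injP : injective (code_product code) := @code_product_inj _ _ injc.

Lemma computable_subsumed :
  computable (code_product code *c code_product code) nat_of_bool
    (fun x => subsumed code le x.1 x.2).
Proof.
have cleP := computable_le_product.
apply: computable_andb.
  by apply/computable_negb/(computable_eq injP); comp_proj.
apply: computable_andb => //; apply: computable_orb.
  apply: computable_negb.
  by apply: (computable_comp2 (h := fun x => le_product le x.1 x.2) cleP); comp_proj.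
apply: computable_leq; last by apply: (computable_code (cA := code_product code)); comp_proj.
by apply/computable_succ/(computable_code (cA := code_product code)); comp_proj.
Qed.

Section Env.
Variables (E : Type) (cE : E -> nat).

Lemma computable_remove_subsumed (A : E -> {fset product S}) :
  computable cE cprods A -> computable cE cprods (fun e => remove_subsumed code le (A e)).
Proof.
move=> cA; apply: (computable_fset_filter injP
  (f := fun y => ~~ has (fun Q => subsumed code le y.2 Q) (A y.1))) => //.
apply: computable_negb.
apply: (computable_fset_has injP (f := fun z => subsumed code le z.1.2 z.2)).
  by apply: (computable_comp2 (h := fun x => subsumed code le x.1 x.2)
    computable_subsumed); comp_proj.
by apply: (computable_comp cA); comp_proj.
Qed.

Lemma computable_star_products (u : E -> {fset S}) (B : E -> {fset product S}) :
  computable cE (code_fset code) u -> computable cE cprods B ->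
  computable cE cprods (fun e => star_products (u e) (B e)).
Proof.
move=> cu cB; apply: (computable_imfset injP injP
  (f := fun y => Star (u y.1) :: y.2 : product S)) => //.
apply: (computable_cons (cA := catom)); comp_proj.
by apply/computable_Star/(computable_comp cu); comp_proj.
Qed.

Lemma computable_opt_products (A : E -> {fset S}) (B : E -> {fset product S}) :
  computable cE (code_fset code) A -> computable cE cprods B ->
  computable cE cprods (fun e => opt_products (A e) (B e)).
Proof.
move=> cA cB; apply: (@computable_ext _ _ _ _ _ (fun e =>
  \bigcup_(c <- A e) [fset (Opt (e, c).2 :: R : product S) | R in B (e, c).1])%fset).
  move=> e; apply/fsetP => P; apply/imfset2P/bigfcupP => /=.
    move=> [c cAe [R RB ->]]; exists c; first by rewrite cAe.
    by apply/imfsetP; exists R.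
  by move=> [c /andP[cAe _] /imfsetP[R /= RB ->]]; exists c => //; exists R.
apply: (computable_bigfcup injc injP (f := fun y =>
  [fset (Opt y.2 :: R : product S) | R in B y.1]%fset)) => //.
apply: (computable_imfset injP injP (f := fun z => Opt z.1.2 :: z.2 : product S)).
  apply: (computable_cons (cA := catom)); comp_proj.
  by apply: computable_Opt; comp_proj.
by apply: (computable_comp cB); comp_proj.
Qed.

End Env.

Lemma computable_meet_product :
  computable (code_product code *c code_product code) cprods
    (fun x => meet_product code le meet x.1 x.2).
Proof.
pose FPS := {fset product S}.
pose rs := remove_subsumed code le.
pose F (x : (atom S * atom S) * (FPS * (FPS * FPS))) : FPS :=
  match x.1.1 with
  | Opt a => match x.1.2 with
    | Opt b => rs (x.2.2.1 `|` x.2.1 `|` opt_products (meet a b) x.2.2.2)%fset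
    | Star v => rs (if has (fun b => meet a b != fset0) v then
         opt_products (\bigcup_(b <- v) meet a b)%fset x.2.1 `|` x.2.2.1
         else x.2.1 `|` x.2.2.1)%fset
    end
  | Star u => match x.1.2 with
    | Opt b => rs (if has (fun a => meet a b != fset0) u then
         opt_products (\bigcup_(a <- u) meet a b)%fset x.2.2.1 `|` x.2.1
         else x.2.2.1 `|` x.2.1)%fset
    | Star v => rs (star_products (meet_fset meet u v) (x.2.1 `|` x.2.2.1))%fset
    end
  end.
apply: (@computable_rec2 _ _ _ catom catom cprods (meet_product code le meet)
  [fset ([::] : product S)]%fset [fset ([::] : product S)]%fset F).
- by case.
- by case.
- by move=> [a|u] s [b|v] t.
apply: (computable_atomcase (code := code) (g := fun x => x.1.1)
  (f1 := fun y => match y.1.1.2 with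
    | Opt b => rs (y.1.2.2.1 `|` y.1.2.1 `|` opt_products (meet y.2 b) y.1.2.2.2)%fset
    | Star v => rs (if has (fun b => meet y.2 b != fset0) v then
         opt_products (\bigcup_(b <- v) meet y.2 b)%fset y.1.2.1 `|` y.1.2.2.1
         else y.1.2.1 `|` y.1.2.2.1)%fset end)
  (f2 := fun y => match y.1.1.2 with
    | Opt b => rs (if has (fun a => meet a b != fset0) y.2 then
         opt_products (\bigcup_(a <- y.2) meet a b)%fset y.1.2.2.1 `|` y.1.2.1
         else y.1.2.2.1 `|` y.1.2.1)%fset
    | Star v => rs (star_products (meet_fset meet y.2 v) (y.1.2.1 `|` y.1.2.2.1))%fset
    end)); first by comp_proj.
- apply: (computable_atomcase (code := code) (g := fun y => y.1.1.2)
    (f1 := fun z => rs (z.1.1.2.2.1 `|` z.1.1.2.1 `|`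
         opt_products (meet z.1.2 z.2) z.1.1.2.2.2)%fset)
    (f2 := fun z => rs (if has (fun b => meet z.1.2 b != fset0) z.2 then
         opt_products (\bigcup_(b <- z.2) meet z.1.2 b)%fset z.1.1.2.1 `|` z.1.1.2.2.1
         else z.1.1.2.1 `|` z.1.1.2.2.1)%fset)); first by comp_proj.
    apply: computable_remove_subsumed; do 2?[apply: (computable_fsetU injP)]; comp_proj.
    apply: computable_opt_products; comp_proj.
    by apply: (computable_comp2 (h := fun x => meet x.1 x.2) cmeet); comp_proj.
  apply: computable_remove_subsumed; apply: computable_if.
  + apply: (computable_fset_has injc (f := fun w => meet w.1.1.2 w.2 != fset0));
      last by comp_proj.
    apply/computable_negb/(computable_eq0 injc).
    by apply: (computable_comp2 (h := fun x => meet x.1 x.2) cmeet); comp_proj.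
  + apply: (computable_fsetU injP); last by comp_proj.
    apply: computable_opt_products; last by comp_proj.
    apply: (computable_bigfcup injc injc (f := fun w => meet w.1.1.2 w.2));
      last by comp_proj.
    by apply: (computable_comp2 (h := fun x => meet x.1 x.2) cmeet); comp_proj.
  + by apply: (computable_fsetU injP); comp_proj.
- apply: (computable_atomcase (code := code)
    (E := (((atom S * atom S) * (FPS * (FPS * FPS))) * {fset S})%type) (g := fun y => y.1.1.2)
    (f1 := fun z => rs (if has (fun a => meet a z.2 != fset0) z.1.2 then
         opt_products (\bigcup_(a <- z.1.2) meet a z.2)%fset z.1.1.2.2.1 `|` z.1.1.2.1
         else z.1.1.2.2.1 `|` z.1.1.2.1)%fset)
    (f2 := fun z => rs (star_products (meet_fset meet z.1.2 z.2)
         (z.1.1.2.1 `|` z.1.1.2.2.1))%fset)); first by comp_proj.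
    apply: computable_remove_subsumed; apply: computable_if.
    + apply: (computable_fset_has injc (f := fun w => meet w.2 w.1.2 != fset0));
        last by comp_proj.
      apply/computable_negb/(computable_eq0 injc).
      by apply: (computable_comp2 (h := fun x => meet x.1 x.2) cmeet); comp_proj.
    + apply: (computable_fsetU injP); last by comp_proj.
      apply: computable_opt_products; last by comp_proj.
      apply: (computable_bigfcup injc injc (f := fun w => meet w.2 w.1.2));
        last by comp_proj.
      by apply: (computable_comp2 (h := fun x => meet x.1 x.2) cmeet); comp_proj.
    + by apply: (computable_fsetU injP); comp_proj.
  apply: computable_remove_subsumed; apply: computable_star_products.
    by apply: (computable_comp2 (h := fun x => meet_fset meet x.1 x.2)
      computable_meet_fset); comp_proj.
  by apply: (computable_fsetU injP); comp_proj.
Qed.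

Lemma code_pairE : code_pair code = code_product code *c code_fset code.
Proof. by []. Qed.

Lemma computable_with_star (E : Type) (cE : E -> nat) (P : E -> product S)
    (u : E -> {fset S}) :
  computable cE (code_product code) P -> computable cE (code_fset code) u ->
  computable cE (code_product code) (fun e => with_star (P e) (u e)).
Proof.
move=> cP cu; apply: (computable_rcons (cA := catom)) => //.
exact: computable_Star.
Qed.

Lemma computable_without_last (E : Type) (cE : E -> nat) (P : E -> product S) :
  computable cE (code_product code) P ->
  computable cE (code_product code) (fun e => without_last (P e)).
Proof.
move=> cP; apply: (@computable_ext _ _ _ _ _ (fun e => rev (behead (rev (P e))))).
  move=> e; rewrite /without_last; case/lastP: (P e) => // s x.
  by rewrite rev_rcons /= revK size_rcons -cats1 take_size_cat.
by do 2?[apply: (computable_rev (cA := catom)) || apply: (computable_behead (cA := catom))];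
  apply: (computable_rev (cA := catom)).
Qed.

Lemma computable_le_pair :
  computable (code_pair code *c code_pair code) nat_of_bool (fun x => le_pair le x.1 x.2).
Proof.
rewrite code_pairE; apply: computable_andb.
  apply: (computable_comp2 (h := fun x => le_product le x.1 x.2) computable_le_product);
    by apply: computable_with_star; comp_proj.
by apply: (computable_comp2 (h := fun x => dominated le x.1 x.2) computable_dominated);
  comp_proj.
Qed.

Lemma computable_meet_fin_inf :
  computable (code_pair code *c code_pair code) (code_fset (code_pair code))
    (fun x => meet_fin_inf code le meet x.1 x.2).
Proof.
apply: (computable_imfset injP (code_pair_inj injc)
  (f := fun y => (without_last y.2, meet_fset meet y.1.1.2 y.1.2.2))).
  rewrite code_pairE; apply: computable_pair.
    by apply: computable_without_last; comp_proj.
  by apply: (computable_comp2 (h := fun x => meet_fset meet x.1 x.2)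
    computable_meet_fset); comp_proj.
rewrite code_pairE.
apply: (computable_comp2 (h := fun x => meet_product code le meet x.1 x.2)
  computable_meet_product); by apply: computable_with_star; comp_proj.
Qed.

Lemma decidable_le_pair : decidable_rel (code_pair code) (le_pair le).
Proof. by have [f fP] := computable_le_pair; exists f => c d; exact: (fP (c, d)). Qed.

Lemma computable_map2_meet_fin_inf :
  computable_map2 (code_pair code) (code_fset (code_pair code)) (meet_fin_inf code le meet).
Proof. by have [f fP] := computable_meet_fin_inf; exists f => c d; exact: (fP (c, d)). Qed.

Lemma decidable_le_pair_inf : decidable_rel (code_pair_inf code) (le_pair_inf le).
Proof. by have [f fP] := decidable_le_pair; exists f => c d; exact: fP. Qed.

Lemma forget_nonempty_inj : injective (@forget_nonempty S).
Proof. by move=> [P u] [Q v] [-> /val_inj ->]. Qed.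

Lemma code_pair_inf_inj : injective (code_pair_inf code).
Proof. exact: (inj_comp (code_pair_inj injc) forget_nonempty_inj). Qed.

Lemma code_fset_imfset (T U : choiceType) (c : U -> nat) (f : T -> U) (A : {fset T}) :
  injective f -> code_fset c (f @` A)%fset = code_fset (c \o f) A.
Proof.
move=> injf; rewrite /code_fset -[RHS](big_map f xpredT (fun y => 2 ^ c y)).
apply: perm_big; apply: uniq_perm; rewrite ?map_inj_uniq // => y.
by apply/imfsetP/mapP => -[x /= xA ->]; exists x.
Qed.

(** The bridge between the two meets: both the computability and the correctness of [meet_inf] are
    transported from [meet_fin_inf] through it. *)
Lemma forget_meet_inf (c d : product S * nonempty_fset S) :
  (@forget_nonempty S @` meet_inf code le meet c d)%fset =
  if meet_fset meet (val c.2) (val d.2) == fset0 then fset0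
  else meet_fin_inf code le meet (forget_nonempty c) (forget_nonempty d).
Proof.
rewrite /meet_inf; case: insubP => [uv nz uvE|]; last first.
  by rewrite negbK => ->; rewrite imfset0.
rewrite (negPf nz); apply/fsetP => x; apply/imfsetP/imfsetP => /=.
  by move=> [y /imfsetP[T /= TP ->] ->]; exists T => //; rewrite /forget_nonempty /= uvE.
move=> [T TP ->]; exists (without_last T, uv); last by rewrite /forget_nonempty /= uvE.
by apply/imfsetP; exists T.
Qed.

Lemma computable_map2_meet_inf :
  computable_map2 (code_pair_inf code) (code_fset (code_pair_inf code))
    (meet_inf code le meet).
Proof.
have [f fP] : computable (code_pair code *c code_pair code) (code_fset (code_pair code))
    (fun x => if meet_fset meet x.1.2 x.2.2 == fset0 then fset0
              else meet_fin_inf code le meet x.1 x.2).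
  apply: computable_if; comp_proj; last exact: computable_meet_fin_inf.
  apply: (computable_eq0 injc); rewrite code_pairE.
  by apply: (computable_comp2 (h := fun x => meet_fset meet x.1 x.2)
    computable_meet_fset); comp_proj.
exists f => c d; have := fP (forget_nonempty c, forget_nonempty d).
by rewrite /= -forget_meet_inf code_fset_imfset //; exact: forget_nonempty_inj.
Qed.

End ProductFunctions.

(** * Recursively enumerable sets *)

(** The inverse may be obtained by choice: the computability of its components comes from the
    programs [Left] and [Right], not from this definition. *)
Definition unpair (x : nat) : nat * nat :=
  xget (0, 0) [set p | x = cpair p.1 p.2].

Lemma unpairK x : cpair (unpair x).1 (unpair x).2 = x.
Proof.
have [m [n ->]] := cpair_surj x; rewrite /unpair.
by case: xgetP => [p _ <-//|/(_ (m, n))]; exact: contra_notP.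
Qed.

Lemma cpairK m n : unpair (cpair m n) = (m, n).
Proof.
have /cpair_inj[] := unpairK (cpair m n).
by case: (unpair _) => /= ? ? -> ->.
Qed.

Lemma computable_lft : computable id id (fun x => (unpair x).1).
Proof. by exists Left => x; exists (unpair x).2; rewrite unpairK. Qed.

Lemma computable_rgt : computable id id (fun x => (unpair x).2).
Proof. by exists Right => x; exists (unpair x).1; rewrite unpairK. Qed.

Section REClosure.
Implicit Types A B : set nat.

Lemma re_preimage A f : computable id id f -> recursively_enumerable A ->
  recursively_enumerable (f @^-1` A).
Proof.
move=> [p fP] [q AP]; exists (Comp q p) => n; rewrite /preimage/= AP.
split=> -[r]; first by exists r, (f n).
by move=> [y py qy]; exists r; rewrite (computes_fun (fP n) py).
Qed.

(** A primitive recursion of length [n x] runs the semi-decision procedure on each index in turn and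
    discards the values; it converges exactly when all the runs do. *)
Lemma re_forall A n : computable id id n -> recursively_enumerable A ->
  recursively_enumerable [set x | forall i, i < n x -> A (cpair x i)].
Proof.
move=> [p nP] [q AP].
exists (Comp (Prec Zero (Comp q (Pair Left (Comp Left Right)))) (Pair prog_id p)) => x.
have precP m : (forall i, i < m -> A (cpair x i)) <->
    exists r, computes (Prec Zero (Comp q (Pair Left (Comp Left Right)))) (cpair x m) r.
  elim: m => [|m IH]; first by split=> // _; exists 0, x, 0.
  split=> [H|[r [a [k [/cpair_inj[<- <-]]]]]].
    have /IH[s [a [k [/cpair_inj[<- <-] Hs]]]] : forall i, i < m -> A (cpair x i).
      by move=> i im; apply: H; exact: ltnW.
    have /AP[r qr] := H m (ltnSn m).
    exists r, x, m.+1; split=> //; exists s => //; exists (cpair x m) => //.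
    exists x, m; split=> //; first by exists (cpair m s).
    by exists (cpair m s); [exists x|exists s].
  move=> [s Hs [y [a' [b' [[n' E] [w [m' E'] [s' wE]] ->]]] qr]] i.
  have [xa _] := cpair_inj E; have [_ wm] := cpair_inj E'.
  have [mb _] : m = b' /\ s = s' by apply: cpair_inj; rewrite wm.
  rewrite ltnS leq_eqVlt => /predU1P[->|im]; first by apply/AP; exists r; rewrite xa mb.
  by move: i im; apply/IH; exists s, x, m.
split=> [/precP[r H]|[r [y [a [b [xa nb ->]]] H]]].
  exists r, (cpair x (n x)) => //; exists x, (n x); split=> //; exact: prog_idP.
apply/precP; exists r.
by rewrite (computes_fun (nP x) nb) (computes_fun (prog_idP x) xa).
Qed.

Lemma re_bounded_forall (D : nat -> nat -> Prop) n : computable id id n ->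
  recursively_enumerable [set x | D (unpair x).1 (unpair x).2] ->
  recursively_enumerable [set x | forall i, i < n x -> D x i].
Proof.
move=> cn /(re_forall cn); congr recursively_enumerable.
by apply/seteqP; split=> x /= H i ix; have := H i ix; rewrite /= cpairK.
Qed.

Lemma re_and A B : recursively_enumerable A -> recursively_enumerable B ->
  recursively_enumerable (A `&` B).
Proof.
move=> [p AP] [q BP]; exists (Pair p q) => x; split.
  by move=> [/AP[r pr] /BP[s qs]]; exists (cpair r s), r, s.
by move=> [r [a [b [pa qb _]]]]; split; [apply/AP; exists a|apply/BP; exists b].
Qed.

(** An implication with a decidable premise is a bounded quantification of length 0 or 1. *)
Lemma re_guard (b : nat -> bool) A : computable id nat_of_bool b ->
  recursively_enumerable A -> recursively_enumerable [set x | b x -> A x].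
Proof.
move=> cb reA; have cb' : computable id id (fun x => nat_of_bool (b x)) by [].
have := re_forall cb' (re_preimage computable_lft reA).
congr recursively_enumerable; apply/seteqP; split=> x /=; rewrite /preimage /=.
  by move=> H bx; have := H 0; rewrite bx cpairK; apply.
by case: (b x) => // H [|//] _; rewrite cpairK; exact: H.
Qed.

(** The condition [b x] amounts to [~~ b x] implying membership in the empty set, which is the
    domain of the never terminating [Find Succ]. *)
Lemma re_dec (b : nat -> bool) : computable id nat_of_bool b ->
  recursively_enumerable [set x | b x].
Proof.
move=> cb; have re0 : recursively_enumerable set0.
  by exists (Find Succ) => n; split=> // -[r []].
have := re_guard (computable_negb cb) re0.
by congr recursively_enumerable; apply/seteqP; split=> x /=; case: (b x) => // /(_ isT).
Qed.

End REClosure.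

Definition unseq (n : nat) : seq nat := xget [::] [set s | code_seq id s = n].

Lemma unseqK n : code_seq id (unseq n) = n.
Proof.
rewrite /unseq; case: xgetP => // H; exfalso.
have [s sn] : exists s, code_seq id s = n; last exact: H sn.
elim/ltn_ind: n {H} => -[|n] IH; first by exists [::].
have [a [b E]] := cpair_surj n.
have [|s sb] := IH b; first by rewrite E ltnS leq_cpairr.
by exists (a :: s); rewrite /= sb E.
Qed.

(** The code of [unseq n] is [n] itself, so on codes the decoding is the identity. *)
Lemma computable_unseq : computable id (code_seq id) unseq.
Proof. by exists prog_id => n; rewrite unseqK; exact: prog_idP. Qed.

Lemma bit_ext m n : bit m =1 bit n -> m = n.
Proof.
have [k] := ubnP (m + n); elim: k m n => // k IH m n lt E.
have [/eqP|mn0] := posnP (m + n); first by rewrite addn_eq0 => /andP[/eqP-> /eqP->].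
have E2 : m./2 = n./2 by apply: IH => [|i]; rewrite -?bitS //; lia.
by rewrite -(odd_double_half m) -(odd_double_half n) E2; have := E 0; rewrite /bit /= => ->.
Qed.

(** A number codes a finite set precisely when each of its set bits is the code of an element, a
    bounded quantification over a recursively enumerable condition. *)
Lemma re_code_fset (T : choiceType) (c : T -> nat) : injective c ->
  recursively_enumerable (range c) -> recursively_enumerable (range (code_fset c)).
Proof.
move=> injc rec; have -> : range (code_fset c) =
    [set x | forall i, i < x -> bit x i -> range c i].
  apply/seteqP; split=> [_ [A _ <-] i _|n H].
    by rewrite bit_code_fset // => /mapP[a _ ->]; exists a.
  have [s sn] : exists s, map c s = bits n.
    have : forall i, i \in bits n -> range c i.
      by move=> i; rewrite mem_bits => b; apply: H => //; exact: bit_ltn.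
    elim: (bits n) => [|i t IH] R; first by exists [::].
    have [a _ ai] := R i (mem_head _ _); have [|s st] := IH.
      by move=> j jt; apply: R; rewrite in_cons jt orbT.
    by exists (a :: s); rewrite /= ai st.
  exists [fset x in s]%fset => //; apply: bit_ext => i.
  rewrite bit_code_fset // -mem_bits -sn.
  by apply/mapP/mapP => -[a aA ->]; exists a; rewrite // ?inE // in aA *.
apply: (re_bounded_forall (D := fun x i => bit x i -> range c i) (computable_id id)).
apply: re_guard; last exact: re_preimage computable_rgt rec.
by apply: (computable_comp2 (h := fun x => bit x.1 x.2) computable_bit);
  [exact: computable_lft|exact: computable_rgt].
Qed.

Lemma re_code_seq (T : Type) (c : T -> nat) :
  recursively_enumerable (range c) -> recursively_enumerable (range (code_seq c)).
Proof.
move=> rec; have -> : range (code_seq c) =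
    [set x | forall i, i < size (unseq x) -> range c (nth 0 (unseq x) i)].
  apply/seteqP; split=> [_ [s _ <-] i|n H].
    have -> : unseq (code_seq c s) = map c s.
      by apply: (@code_seq_inj _ id) => //; rewrite unseqK code_seq_map.
    rewrite size_map; case: s => // x s lt.
    by rewrite (nth_map x) //; exists (nth x (x :: s) i).
  have [s sn] : exists s, map c s = unseq n.
    move: H => /=; elim: (unseq n) => [|i t IH] R; first by exists [::].
    have [a _ ai] := R 0 isT; have [|s st] := IH; first by move=> j /(R j.+1).
    by exists (a :: s); rewrite /= ai st.
  by exists s => //; rewrite -(unseqK n) -sn code_seq_map.
apply: (re_bounded_forall (D := fun x i => range c (nth 0 (unseq x) i))
  (computable_size (cA := id) computable_unseq)).
apply: (re_preimage (f := fun x => nth 0 (unseq (unpair x).1) (unpair x).2)) rec.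
apply: (computable_nth (cA := id)); last exact: computable_rgt.
exact: (computable_comp computable_unseq computable_lft).
Qed.

Lemma re_code_prod (T U : Type) (c : T -> nat) (d : U -> nat) :
  recursively_enumerable (range c) -> recursively_enumerable (range d) ->
  recursively_enumerable (range (code_prod c d)).
Proof.
move=> rec red; have -> : range (code_prod c d) =
    (fun x => (unpair x).1) @^-1` range c `&` (fun x => (unpair x).2) @^-1` range d.
  apply/seteqP; split=> [_ [[x y] _ <-]|n [[x _ xn] [y _ yn]]].
    by split; rewrite /preimage /= cpairK /=; [exists x|exists y].
  by exists (x, y) => //; rewrite /code_prod xn yn unpairK.
by apply: re_and; apply: re_preimage => //; [exact: computable_lft|exact: computable_rgt].
Qed.

Section REProducts.
Variables (S : choiceType) (code : S -> nat).
Hypotheses (injc : injective code) (rec : recursively_enumerable (range code)).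

Lemma re_code_atom : recursively_enumerable (range (code_atom code)).
Proof.
have -> : range (code_atom code) = [set x | (unpair x).1 <= 1] `&`
   ([set x | (unpair x).1 <= 0 -> range code (unpair x).2] `&`
    [set x | 0 < (unpair x).1 -> range (code_fset code) (unpair x).2]).
  apply/seteqP; split=> [_ [[a|u] _ <-]|n].
  - by do 2?split; rewrite /= cpairK // => _; exists a.
  - by do 2?split; rewrite /= cpairK // => _; exists u.
  - have [k [i ->]] := cpair_surj n; rewrite /= cpairK /=; case: k => [|[|k]] [] // _ [].
      by move=> /(_ isT)[a _ <-] _; exists (Opt a).
    by move=> _ /(_ isT)[u _ <-]; exists (Star u).
apply: re_and.
  by apply/re_dec/computable_leq; [exact: computable_lft|exact: computable_const].
apply: re_and; apply: re_guard.
- by apply/computable_leq; [exact: computable_lft|exact: computable_const].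
- exact: re_preimage computable_rgt rec.
- by apply/computable_leq; [exact: computable_const|exact: computable_lft].
- by apply: re_preimage computable_rgt _; exact: re_code_fset.
Qed.

Lemma re_code_pair : recursively_enumerable (range (code_pair code)).
Proof. by apply: re_code_prod; [exact/re_code_seq/re_code_atom|exact: re_code_fset]. Qed.

(** The empty set is the only one with code 0, so non-emptiness is decided on codes. *)
Lemma re_code_pair_inf : recursively_enumerable (range (code_pair_inf code)).
Proof.
have -> : range (code_pair_inf code) =
    range (code_pair code) `&` [set x | (unpair x).2 != 0].
  have code0 (u : {fset S}) : (code_fset code u == 0) = (u == fset0).
    rewrite -(inj_eq (code_fset_inj injc)); congr (_ == _).
    by rewrite /code_fset big_seq_fset0.
  apply/seteqP; split=> [_ [[P u] _ <-]|_ [[[P u] _ <-]]] /=.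
    by split; [exists (P, val u)|rewrite cpairK /= code0 (valP u)].
  by rewrite cpairK /= code0 => nz; exists (P, exist _ u nz).
apply: re_and re_code_pair _; apply: re_dec; apply: computable_sgn.
exact: computable_rgt.
Qed.

End REProducts.

(** * Noetherian spaces and well-founded closed sets *)

Section Noetherian.
Variable X : topologicalType.
Implicit Types A B C D : set X.

Definition closed_proper C D := closed C /\ C `<` D.

(** Dependent choice turns a non-accessible set into a strictly descending sequence of closed sets.
    Their complements cover an open set, and a finite subcover forces the sequence to stop at its
    largest index. *)
Lemma noetherian_closed_wf : noetherian X -> well_founded closed_proper.
Proof.
move=> nX; apply: contrapT => nwf.
have [C0 nC0] : exists C, ~ Acc closed_proper C by apply/existsNP.
pose T := {C | ~ Acc closed_proper C}.
have [f fP] : {f : T -> T & forall C : T, closed_proper (proj1_sig (f C)) (proj1_sig C)}.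
  apply: (boolp.choice (P := fun C D : T => closed_proper (proj1_sig D) (proj1_sig C))).
  move=> C; apply: contrapT => /forallNP H; apply: (proj2_sig C); constructor => D DC.
  by apply: contrapT => nD; apply: (H (exist _ D nD)).
(* The iteration starts at [n.+1] because [C0] itself is not known to be closed. *)
pose F n := proj1_sig (iter n.+1 f (exist _ C0 nC0)).
have Fc n : closed (F n) by have [] := fP (iter n f (exist _ C0 nC0)).
have FS n : F n.+1 `<` F n by have [] := fP (iter n.+1 f (exist _ C0 nC0)).
have Fle m n : m <= n -> F n `<=` F m.
  elim: n => [|n IH]; first by rewrite leqn0 => /eqP->.
  by rewrite leq_eqVlt => /predU1P[->//|/IH H]; apply: subset_trans H; have [] := FS n.
have oU : open (\bigcup_n ~` F n) by apply: bigcup_open => n _; apply/closed_openC.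
have [D _ cov] := nX _ oU nat setT (fun n => ~` F n)
  (fun n _ => closed_openC (Fc n)) (@subset_refl _ _).
pose M := \max_(n <- D) n.
have [_] := FS M; apply => x Mx; apply: contrapT => Sx.
have [|n nD] := cov x; first by exists M.+1.
by apply; apply: (Fle n M) Mx; exact: (@leq_bigmax_seq _ _ xpredT id n nD isT).
Qed.

(** Well-founded induction on the complement of the union of a finite subfamily: adding a member
    that is not yet covered makes this closed set strictly smaller. *)
Lemma closed_wf_noetherian : well_founded closed_proper -> noetherian X.
Proof.
move=> wf U oU I D f fo cov; pose V (F : {fset I}) := \bigcup_(i in [set` F]) f i.
suff H : forall C, (exists2 F : {fset I}, {subset F <= D} & C = ~` V F) ->
    finite_subset_cover D f U.
  by apply: (H (~` V fset0)); exists fset0.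
move=> C; elim: {C}(wf C) => C _ IH [F FD CE].
have [[i Di nfi]|H] := pselect (exists2 i, D i & ~ f i `<=` V F); last first.
  exists F => // x /cov [i Di fx]; apply: contrapT => nVx.
  by apply: H; exists i => // /(_ x fx).
have VF' : V (i |` F)%fset = f i `|` V F.
  apply/seteqP; split=> [x [j /= /fset1UP[->|jF] fx]|x [fx|[j /= jF fx]]].
  - by left.
  - by right; exists j.
  - by exists i => //=; rewrite fset1U1.
  - by exists j => //=; rewrite fset1Ur.
have FD' : {subset (i |` F)%fset <= D}.
  by move=> j /fset1UP[->|/FD //]; rewrite inE.
apply: (IH (~` V (i |` F)%fset)); last by exists (i |` F)%fset.
split; first apply/open_closedC/bigcup_open => j /FD'.
  by rewrite inE => /fo.
rewrite CE VF'; split; first by move=> x /= H Vx; apply: H; right.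
by move=> H; apply: nfi => x fx; apply: contrapT => /H; apply; left.
Qed.

(** A closed [C] strictly inside the union is the union of its traces on [A] and [B], at least one
    of which is proper. If the trace on [A] is proper, the one on [B] may be anything accessible,
    whence the nesting of the inductions. *)
Lemma Acc_closedU A B : closed A -> closed B ->
  Acc closed_proper A -> Acc closed_proper B -> Acc closed_proper (A `|` B).
Proof.
move=> cA cB accA; elim: accA cA B cB => {}A accA IHA cA B cB accB.
elim: accB cB => {}B accB IHB cB; constructor => C [cC [CAB nABC]].
have -> : C = (C `&` A) `|` (C `&` B) by rewrite -setIUr; apply/esym/setIidPl.
have cCA : closed (C `&` A) by exact: closedI.
have cCB : closed (C `&` B) by exact: closedI.
have accCB : Acc closed_proper (C `&` B).
  have [BC|nBC] := pselect (B `<=` C); first by rewrite (setIidr BC).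
  by apply: accB; split=> //; split=> // H; apply: nBC => x /H[].
have [AC|nAC] := pselect (A `<=` C); last first.
  by apply: IHA => //; split=> //; split=> // H; apply: nAC => x /H[].
rewrite (setIidr AC); apply: IHB => //; split=> //; split=> // BC.
by apply: nABC => x [/AC //|/BC[]].
Qed.

End Noetherian.

Definition finite_union (T : Type) (I : eqType) (K : I -> set T) (s : seq I) : set T :=
  [set x | exists2 i, i \in s & K i x].

Section FiniteUnion.
Variables (T : Type) (I : eqType) (K : I -> set T).

Lemma finite_union_nil : finite_union K [::] = set0.
Proof. by apply/seteqP; split=> // x []. Qed.

Lemma finite_union_cons i s : finite_union K (i :: s) = K i `|` finite_union K s.
Proof.
apply/seteqP; split=> [x [j]|x [Kx|[j js Kx]]].
- by rewrite inE => /predU1P[->|js] Kx; [left|right; exists j].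
- by exists i; rewrite ?mem_head.
- by exists j; rewrite // in_cons js orbT.
Qed.

Lemma finite_union_cat s t : finite_union K (s ++ t) = finite_union K s `|` finite_union K t.
Proof.
elim: s => [|i s IH]; first by rewrite finite_union_nil set0U.
by rewrite cat_cons !finite_union_cons IH setUA.
Qed.

Lemma finite_union_bigcup (J : eqType) (F : J -> set T) (s : seq J) :
  (forall j, j \in s -> exists t, F j = finite_union K t) ->
  exists t, finite_union F s = finite_union K t.
Proof.
elim: s => [|j s IH] H; first by exists [::]; apply/seteqP; split=> x [].
have [t tE] := H j (mem_head _ _).
have [|u uE] := IH; first by move=> k ks; apply: H; rewrite in_cons ks orbT.
exists (t ++ u); rewrite finite_union_cat -tE -uE.
apply/seteqP; split=> [x [k]|x [Fx|[k ks Fx]]].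
- by rewrite inE => /predU1P[->|ks] Fx; [left|right; exists k].
- by exists j; rewrite ?mem_head.
- by exists k; rewrite // in_cons ks orbT.
Qed.

End FiniteUnion.

Lemma closed_finite_union (X : topologicalType) (I : eqType) (K : I -> set X) s :
  (forall i, closed (K i)) -> closed (finite_union K s).
Proof.
move=> cK; elim: s => [|i s IH]; first by rewrite finite_union_nil; exact: closed0.
by rewrite finite_union_cons; apply: closedU.
Qed.

Lemma irreducible_finite_union (X : topologicalType) (I : eqType) (K : I -> set X) s A :
  (forall i, closed (K i)) -> irreducible A -> A `<=` finite_union K s ->
  exists2 i, i \in s & A `<=` K i.
Proof.
move=> cK [[x Ax] irrA]; elim: s => [|i s IH]; first by move=> /(_ _ Ax)[].
rewrite finite_union_cons => /(irrA _ _ (cK i) (closed_finite_union cK)) [AK|/IH[j js Aj]].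
  by exists i; rewrite ?mem_head.
by exists j; rewrite // in_cons js orbT.
Qed.

(** Noetherian induction: a closed set that is neither empty nor irreducible is the union of two
    strictly smaller closed sets. *)
Lemma noetherian_finite_union (X : topologicalType) (I : eqType) (K : I -> set X) :
  noetherian X -> (forall C, irreducible_closed C -> exists i, K i = C) ->
  forall C, closed C -> exists s, C = finite_union K s.
Proof.
move=> nX surj C; elim: {C}(noetherian_closed_wf nX C) => C _ IH cC.
have [[x Cx]|nC] := pselect (C !=set0); last first.
  exists [::]; rewrite finite_union_nil; apply/seteqP; split=> // x Cx.
  by apply: nC; exists x.
have [irrC|nirr] := pselect (irreducible C).
  have [i iC] := surj _ (conj cC irrC).
  by exists [:: i]; rewrite finite_union_cons finite_union_nil setU0.
have [C1 [C2 [cC1 cC2 CU [n1 n2]]]] : exists C1 C2, [/\ closed C1, closed C2,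
    C `<=` C1 `|` C2 & ~ C `<=` C1 /\ ~ C `<=` C2].
  apply: contrapT => H; apply: nirr; split; first by exists x.
  move=> C1 C2 cC1 cC2 CU; apply: contrapT => /not_orP n12.
  by apply: H; exists C1, C2.
have sub D : closed D -> ~ C `<=` D -> exists s, C `&` D = finite_union K s.
  move=> cD nCD; apply: IH; last exact: closedI.
  split; first exact: closedI.
  by split=> // H; apply: nCD => y /H[].
have [s1 E1] := sub _ cC1 n1; have [s2 E2] := sub _ cC2 n2.
exists (s1 ++ s2); rewrite finite_union_cat -E1 -E2 -setIUr.
exact/esym/setIidPl.
Qed.

(* A descending chain condition on the family [K] makes the finite unions of
   its members closed under arbitrary intersections, hence all closed sets are
   such finite unions. *)
Section ClosedFamily.
Variables (Y : topologicalType) (I : eqType) (K : I -> set Y).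
Hypotheses (cK : forall i, closed (K i)).
Hypothesis KT : exists s, [set: Y] = finite_union K s.
Hypothesis KI : forall i j, exists s, K i `&` K j = finite_union K s.
Hypothesis Ksep : forall C y, closed C -> ~ C y ->
  exists s, C `<=` finite_union K s /\ ~ finite_union K s y.
Hypothesis Kwf : well_founded (fun i j => K i `<` K j).

Lemma closed_family C : closed C -> exists s, C = finite_union K s.
Proof.
move=> cC; suff KC : forall i, exists s, K i `&` C = finite_union K s.
  have [s sE] := KT.
  have [t tE] := finite_union_bigcup (F := fun i => K i `&` C) (s := s) (fun i _ => KC i).
  exists t; rewrite -tE; apply/seteqP; split=> [x Cx|x [i _ []]//].
  by have : [set: Y] x by []; rewrite sE => -[i si Kx]; exists i.
elim/(well_founded_ind Kwf) => i IH.
have [KiC|/nonsubset[y [Ky nCy]]] := pselect (K i `<=` C).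
  exists [:: i]; rewrite finite_union_cons finite_union_nil setU0.
  exact/setIidPl.
have [s [Cs nsy]] := Ksep cC nCy.
(* Each [K i] meet [K j] splits into members [K k] that omit [y]. As [y] lies in [K i], these are
   strictly smaller than [K i] and fall under the induction hypothesis. *)
have [t tE] : exists t, finite_union (fun j => K i `&` K j `&` C) s = finite_union K t.
  apply: finite_union_bigcup => j js; have [t tE] := KI i j.
  have [u uE] : exists u, finite_union (fun k => K k `&` C) t = finite_union K u.
    apply: finite_union_bigcup => k kt; apply: IH; split.
      by move=> x Kx; have : finite_union K t x by [exists k]; rewrite -tE => -[].
    move=> /(_ _ Ky) Kky; have : finite_union K t y by exists k.
    by rewrite -tE => -[_ Kjy]; apply: nsy; exists j.
  exists u; rewrite -uE tE; apply/seteqP; split=> x.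
    by move=> [[k kt Kx] Cx]; exists k.
  by move=> [k kt [Kx Cx]]; split=> //; exists k.
exists t; rewrite -tE; apply/seteqP; split=> x; last by move=> [j _ [[]]].
by move=> [Kx Cx]; have [j js Kjx] := Cs x Cx; exists j.
Qed.

(** A closed set strictly inside [K i] is a finite union of members strictly smaller than [K i];
    their accessibility passes to the union by [Acc_closedU]. *)
Lemma closed_family_noetherian : noetherian Y.
Proof.
apply: closed_wf_noetherian => C.
have accK i : Acc (@closed_proper Y) (K i).
  elim/(well_founded_ind Kwf): i => i IH; constructor => D [cD [DK nKD]].
  have [s sE] := closed_family cD.
  have: forall j, j \in s -> Acc (@closed_proper Y) (K j).
    move=> j js; have KD : K j `<=` D by rewrite sE => x Kx; exists j.
    apply: IH; split; first exact: subset_trans DK.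
    by move=> KK; apply: nKD; exact: subset_trans KD.
  rewrite {}sE; elim: s {DK nKD cD} => [|j s IHs] H.
    rewrite finite_union_nil; constructor => B [_ [_]]; case.
    exact: sub0set.
  rewrite finite_union_cons; apply: Acc_closedU.
  - exact: cK.
  - exact: closed_finite_union.
  - by apply: H; rewrite mem_head.
  - by apply: IHs => k ks; apply: H; rewrite in_cons ks orbT.
suff accC : forall D, closed D -> Acc (@closed_proper Y) D.
  by constructor => D [/accC].
move=> D /closed_family[s ->]; elim: s => [|j s IHs].
  by rewrite finite_union_nil; constructor => B [_ [_]]; case; exact: sub0set.
by rewrite finite_union_cons; apply: Acc_closedU;
  [exact: cK|exact: closed_finite_union|exact: accK|exact: IHs].
Qed.

Lemma closed_family_irreducible C : irreducible_closed C -> exists i, K i = C.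
Proof.
move=> [cC irrC]; have [s sE] := closed_family cC.
have [|i si CK] := irreducible_finite_union (s := s) cK irrC; first by rewrite sE.
by exists i; apply/seteqP; split=> //; rewrite sE => x Kx; exists i.
Qed.

End ClosedFamily.

(** * Word products *)

Section Languages.
Variables (X S : choiceType) (sem : S -> set X).
Implicit Types (P Q : product S) (s t : seq X).

Lemma sem_product_nil P : sem_product sem P [::].
Proof.
elim: P => [|A P IH] //=; exists [::], [::]; split=> //.
by case: A => [a|u]; [left|].
Qed.

Lemma sem_product_Opt a P s : sem_product sem (Opt a :: P) s <->
  sem_product sem P s \/ exists x s', [/\ s = x :: s', sem a x & sem_product sem P s'].
Proof.
split=> [[s1 [s2 [[->|[x ax ->]] Ps2 ->]]]|[Ps|[x [s' [-> ax Ps']]]]].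
- by left.
- by right; exists x, s2.
- by exists [::], s; split=> //; left.
- by exists [:: x], s'; split=> //; right; exists x.
Qed.

Lemma sem_product_Star u P s : sem_product sem (Star u :: P) s <->
  sem_product sem P s \/ exists x s', [/\ s = x :: s', sem_fset sem u x &
    sem_product sem (Star u :: P) s'].
Proof.
split=> [[[|x s1] [s2 [us1 Ps2 ->]]]|[Ps|[x [_ [-> ux [s1 [s2 [us1 Ps2 ->]]]]]]]].
- by left.
- right; exists x, (s1 ++ s2); split=> //; first by apply: us1; rewrite mem_head.
  by exists s1, s2; split=> // y ys1; apply: us1; rewrite in_cons ys1 orbT.
- by exists [::], s; split.
- exists (x :: s1), s2; split=> // y; rewrite in_cons => /predU1P[->//|].
  exact: us1.
Qed.

(** Downward closure for the subword order allows the inclusion proofs to put a test letter in front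
    of a word and to delete it afterwards. *)
Lemma sem_product_subseq P s t : subseq s t -> sem_product sem P t -> sem_product sem P s.
Proof.
elim: P s t => [|[a|u] P IH] s t.
- by move=> + tE; rewrite (tE : t = [::]) subseq0 => /eqP->.
- move=> st /sem_product_Opt[Pt|[x [t' [tE ax Pt']]]].
    by apply/sem_product_Opt; left; apply: IH Pt.
  case: s st => [|y s] st; first exact: sem_product_nil.
  apply/sem_product_Opt; move: st; rewrite tE /=; case: eqP => [->|_] st.
    by right; exists x, s; split=> //; apply: IH Pt'.
  by left; apply: IH Pt'.
- elim: t s => [|x t IHt] s st.
    by move: st; rewrite subseq0 => /eqP-> _; exact: sem_product_nil.
  move=> /sem_product_Star[Pt|[_ [_ [[<- <-] ux Pt]]]].
    by apply/sem_product_Star; left; apply: IH Pt.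
  case: s st => [|y s]; first by move=> _; exact: sem_product_nil.
  rewrite /=; case: eqP => [->|_] st; last exact: IHt.
  by apply/sem_product_Star; right; exists x, s; split=> //; exact: IHt.
Qed.

Lemma sem_product_suffix P s t : sem_product sem P (s ++ t) -> sem_product sem P t.
Proof. by apply: sem_product_subseq; exact: suffix_subseq. Qed.

Lemma sem_product_prefix P s t : sem_product sem P (s ++ t) -> sem_product sem P s.
Proof. by apply: sem_product_subseq; exact: prefix_subseq. Qed.

Lemma sem_product_behead P x s : sem_product sem P (x :: s) -> sem_product sem P s.
Proof. exact: (@sem_product_suffix P [:: x]). Qed.

Lemma sem_product_cat P Q s : sem_product sem (P ++ Q) s <->
  exists s1 s2, [/\ sem_product sem P s1, sem_product sem Q s2 & s = s1 ++ s2].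
Proof.
elim: P s => [|A P IH] s /=.
  split=> [Qs|[s1 [s2 [s1E Qs2 ->]]]]; first by exists [::], s.
  by rewrite (s1E : s1 = [::]).
split=> [[s1 [s2 [As1 /IH[s3 [s4 [Ps3 Qs4 ->]]] ->]]]|].
  by exists (s1 ++ s3), s4; split; rewrite ?catA //; exists s1, s3.
move=> [_ [s2 [[s1 [s3 [As1 Ps3 ->]]] Qs2 ->]]].
by exists s1, (s3 ++ s2); split; rewrite ?catA //; apply/IH; exists s3, s2.
Qed.

Lemma sem_product_with_star P u s : sem_product sem (with_star P u) s <->
  exists s1 s2, [/\ sem_product sem P s1, {in s2, forall x, sem_fset sem u x} &
    s = s1 ++ s2].
Proof.
rewrite /with_star -cats1 sem_product_cat; split=> -[s1 [s2 [Ps1 us2 ->]]].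
  by move: us2 => [s3 [_ [us3 -> ->]]]; exists s1, s3; rewrite cats0.
by exists s1, s2; split=> //; exists s2, [::]; rewrite cats0.
Qed.

Lemma sem_product_subl P P' Q : sem_product sem P `<=` sem_product sem P' ->
  sem_product sem (P ++ Q) `<=` sem_product sem (P' ++ Q).
Proof.
move=> PP' s /sem_product_cat[s1 [s2 [/PP' Ps1 Qs2 ->]]].
by apply/sem_product_cat; exists s1, s2.
Qed.

Lemma sem_product_subr P Q Q' : sem_product sem Q `<=` sem_product sem Q' ->
  sem_product sem (P ++ Q) `<=` sem_product sem (P ++ Q').
Proof.
move=> QQ' s /sem_product_cat[s1 [s2 [Ps1 /QQ' Qs2 ->]]].
by apply/sem_product_cat; exists s1, s2.
Qed.

Lemma sem_fset0 : sem_fset sem fset0 = set0.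
Proof. by rewrite /sem_fset; apply/seteqP; split=> // x []. Qed.

End Languages.

(** * Inclusion of products *)

Section Representation.
Variables (X : topologicalType) (S : choiceType) (code : S -> nat).
Variables (sem : S -> set X) (le : rel S) (tau : {fset S}).
Variable meet : S -> S -> {fset S}.
Hypothesis HS : S_representation code sem le tau meet.
Implicit Types (P Q R : product S) (s t : seq X) (u v w : {fset S}).
Local Notation semP := (sem_product sem).
Local Notation semF := (sem_fset sem).

Lemma closed_sem a : closed (sem a).
Proof. by have [] := srep_irreducible HS a. Qed.

Lemma sem_nonempty a : sem a !=set0.
Proof. by have [_ []] := srep_irreducible HS a. Qed.

Lemma sem_fset_finite_union u : semF u = finite_union sem u.
Proof. by apply/seteqP; split=> x [a au ax]; exists a. Qed.

Lemma closed_sem_fset u : closed (semF u).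
Proof. by rewrite sem_fset_finite_union; apply: closed_finite_union; exact: closed_sem. Qed.

Lemma closed_is_sem_fset C : closed C -> exists u, C = semF u.
Proof.
move=> cC; have [s ->] := noetherian_finite_union (srep_noetherian HS)
  (srep_surjective HS) cC.
exists [fset a in s]%fset; apply/seteqP; split=> x [a].
  by move=> sa ax; exists a => //=; rewrite inE.
by rewrite /= inE => sa ax; exists a.
Qed.

(** Irreducibility of [sem a] puts it inside a single member of the union, so the test on codes in
    [le_product] is exact. *)
Lemma sem_sub_fset a v : sem a `<=` semF v <-> has (fun b => le a b) v.
Proof.
rewrite sem_fset_finite_union; split=> [|/hasP[b bv /(srep_leP HS) ab] x /ab bx]; last by exists b.
have [_ irr] := srep_irreducible HS a.
move=> /(irreducible_finite_union closed_sem irr)[b bv ab].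
by apply/hasP; exists b => //; apply/(srep_leP HS).
Qed.

Lemma dominatedP u v : dominated le u v <-> semF u `<=` semF v.
Proof.
split=> [/allP H x [a /H /sem_sub_fset av ax]|uv]; first exact: av.
by apply/allP => a au; apply/sem_sub_fset => x ax; apply: uv; exists a.
Qed.

Lemma sem_meet_fset u v : semF (meet_fset meet u v) = semF u `&` semF v.
Proof.
apply/seteqP; split=> [x [c /= /bigfcupP[a /andP[au _] /bigfcupP[b /andP[bv _] cab]] cx]|].
  have : (\bigcup_(c in [set` meet a b]) sem c) x by exists c.
  by rewrite -(srep_meetP HS) => -[ax bx]; split; [exists a|exists b].
move=> x [[a /= au ax] [b /= bv bx]].
have : (sem a `&` sem b) x by [].
rewrite (srep_meetP HS) => -[c /= cab cx]; exists c => //=.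
apply/bigfcupP; exists a; rewrite ?au //.
by apply/bigfcupP; exists b; rewrite ?bv.
Qed.

(** Unrolling [P] presents the set as a finite union of closed sets, one for each atom able to
    absorb [x]. It makes density arguments on the first letter possible. *)
Lemma closed_section P s : closed [set x | semP P (x :: s)].
Proof.
elim: P s => [|[a|u] P IH] s.
- by rewrite (_ : mkset _ = set0); [exact: closed0|apply/seteqP; split].
- rewrite (_ : mkset _ = [set x | semP P (x :: s)] `|`
     (if pselect (semP P s) then sem a else set0)).
    apply: closedU => //; case: pselect => ?; [exact: closed_sem|exact: closed0].
  apply/seteqP; split=> x /=.
    move=> /sem_product_Opt[|[y [t [[xy st] ay Pt]]]]; first by left.
    by right; case: pselect => [?|[]]; rewrite ?xy ?st.
  case=> [Px|]; first by apply/sem_product_Opt; left.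
  by case: pselect => // Ps ax; apply/sem_product_Opt; right; exists x, s.
- rewrite (_ : mkset _ = [set x | semP P (x :: s)] `|`
     (if pselect (semP (Star u :: P) s) then semF u else set0)).
    by apply: closedU => //; case: pselect => ?; [exact: closed_sem_fset|exact: closed0].
  apply/seteqP; split=> x.
    move=> /sem_product_Star[|[y [t [[xy st] uy Pt]]]]; first by left.
    by right; case: pselect => [?|[]]; rewrite ?xy ?st.
  case=> [Px|]; first by apply/sem_product_Star; left.
  by case: pselect => // Ps ux; apply/sem_product_Star; right; exists x, s.
Qed.

(* [sem a `\` C] is dense in the irreducible set [sem a]. *)
Lemma sem_dense a C D : closed C -> closed D -> ~ sem a `<=` C ->
  sem a `\` C `<=` D -> sem a `<=` D.
Proof.
move=> cC cD nC CD; have [_ [_ irr]] := srep_irreducible HS a.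
have [|//|//] := irr C D cC cD.
by move=> x ax; have [Cx|nCx] := pselect (C x); [left|right; exact: CD].
Qed.

(** The letters of [sem a] outside [C] are dense in [sem a] and the section of [Q] is closed, so the
    assumption extends to every letter of [sem a]. Words without that letter follow by deletion. *)
Lemma sem_Opt_sub a P Q C : closed C -> ~ sem a `<=` C ->
  (forall x s, sem a x -> ~ C x -> semP P s -> semP Q (x :: s)) ->
  semP (Opt a :: P) `<=` semP Q.
Proof.
move=> cC nC H.
have H' x s : sem a x -> semP P s -> semP Q (x :: s).
  move=> ax Ps; suff: sem a `<=` [set y | semP Q (y :: s)] by apply.
  apply: (sem_dense cC (@closed_section Q s) nC) => y [ay nCy].
  exact: H.
move=> s /sem_product_Opt[Ps|[x [t [-> ax Pt]]]]; last exact: H'.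
by have [x ax] := sem_nonempty a; exact: sem_product_behead (H' x s ax Ps).
Qed.

(** This and the following equivalences read the clauses of [le_product] on languages. Soundness,
    completeness and the splitting of products all run on them. *)
Lemma sem_Opt_Opt_le a b P Q : le a b ->
  semP (Opt a :: P) `<=` semP (Opt b :: Q) <-> semP P `<=` semP Q.
Proof.
move=> /(srep_leP HS) ab; split=> PQ s.
  have [x ax] := sem_nonempty a => Ps.
  have /PQ/sem_product_Opt[] : semP (Opt a :: P) (x :: s).
    by apply/sem_product_Opt; right; exists x, s.
  - exact: sem_product_behead.
  - by move=> [y [t [[_ ->]]]].
by move=> /sem_product_Opt[/PQ ?|[x [t [-> /ab bx /PQ Qt]]]];
  apply/sem_product_Opt; [left|right; exists x, t].
Qed.

(** A first letter in [sem a] but not in [sem b] cannot be absorbed by [b^?], and such letters are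
    enough by [sem_Opt_sub]. *)
Lemma sem_Opt_Opt_nle a b P Q : ~~ le a b ->
  semP (Opt a :: P) `<=` semP (Opt b :: Q) <-> semP (Opt a :: P) `<=` semP Q.
Proof.
move=> nab; split=> PQ; last by move=> s /PQ Qs; apply/sem_product_Opt; left.
apply: (sem_Opt_sub (@closed_sem b)); first by move=> /(srep_leP HS); exact/negP.
move=> x s ax nbx Ps; have /PQ/sem_product_Opt[//|] : semP (Opt a :: P) (x :: s).
  by apply/sem_product_Opt; right; exists x, s.
by move=> [y [t [[xy _]]]]; rewrite -xy => /nbx.
Qed.

Lemma sem_Opt_Star_le a v P Q : has (fun b => le a b) v ->
  semP (Opt a :: P) `<=` semP (Star v :: Q) <-> semP P `<=` semP (Star v :: Q).
Proof.
move=> /sem_sub_fset av; split=> PQ s.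
  have [x ax] := sem_nonempty a => Ps.
  have /PQ : semP (Opt a :: P) (x :: s).
    by apply/sem_product_Opt; right; exists x, s.
  exact: sem_product_behead.
by move=> /sem_product_Opt[/PQ //|[x [t [-> /av vx /PQ Qt]]]];
  apply/sem_product_Star; right; exists x, t.
Qed.

Lemma sem_Opt_Star_nle a v P Q : ~~ has (fun b => le a b) v ->
  semP (Opt a :: P) `<=` semP (Star v :: Q) <-> semP (Opt a :: P) `<=` semP Q.
Proof.
move=> nav; split=> PQ; last by move=> s /PQ Qs; apply/sem_product_Star; left.
apply: (sem_Opt_sub (@closed_sem_fset v)); first by move=> /sem_sub_fset; exact/negP.
move=> x s ax nbx Ps; have /PQ/sem_product_Star[//|] : semP (Opt a :: P) (x :: s).
  by apply/sem_product_Opt; right; exists x, s.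
by move=> [y [t [[xy _]]]]; rewrite -xy => /nbx.
Qed.

Lemma sem_Star0 P : semP (Star fset0 :: P) = semP P.
Proof.
apply/seteqP; split=> s; last by move=> Ps; apply/sem_product_Star; left.
by move=> /sem_product_Star[//|[x [t [_]]]]; rewrite sem_fset0.
Qed.

Lemma sem_fset_nonempty u : u != fset0 -> exists x, semF u x.
Proof. by case/fset0Pn=> a au; have [x ax] := sem_nonempty a; exists x, a. Qed.

(** A word of [u^* P] remains one when a letter of [u] is put in front. The option [b^?] absorbs at
    most that letter, so the original word is left to [Q]. *)
Lemma sem_Star_Opt u b P Q : u != fset0 ->
  semP (Star u :: P) `<=` semP (Opt b :: Q) <-> semP (Star u :: P) `<=` semP Q.
Proof.
move=> /sem_fset_nonempty[x ux]; split=> PQ s; last first.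
  by move=> /PQ Qs; apply/sem_product_Opt; left.
move=> Ps; have /PQ/sem_product_Opt[] : semP (Star u :: P) (x :: s).
  by apply/sem_product_Star; right; exists x, s.
- exact: sem_product_behead.
- by move=> [y [t [[_ ->]]]].
Qed.

Lemma sem_Star_Star_le u v P Q : dominated le u v ->
  semP (Star u :: P) `<=` semP (Star v :: Q) <-> semP P `<=` semP (Star v :: Q).
Proof.
move=> /dominatedP uv; split=> PQ s.
  by move=> Ps; apply: PQ; apply/sem_product_Star; left.
elim: s => [|x s IH]; first by move=> _; exact: sem_product_nil.
move=> /sem_product_Star[/PQ //|[y [t [[-> <-] /uv vy /IH Qs]]]].
by apply/sem_product_Star; right; exists y, s.
Qed.

Lemma sem_Star_Star_nle u v P Q : ~~ dominated le u v ->
  semP (Star u :: P) `<=` semP (Star v :: Q) <-> semP (Star u :: P) `<=` semP Q.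
Proof.
move=> nuv; split=> PQ; last by move=> s /PQ Qs; apply/sem_product_Star; left.
have /nonsubset[x [ux nvx]] : ~ semF u `<=` semF v by move/dominatedP; exact/negP.
move=> s Ps; have /PQ/sem_product_Star[] : semP (Star u :: P) (x :: s).
  by apply/sem_product_Star; right; exists x, s.
- exact: sem_product_behead.
- by move=> [y [t [[xy _]]]]; rewrite -xy => /nvx.
Qed.

Lemma le_product_sound P Q : le_product le P Q -> semP P `<=` semP Q.
Proof.
elim: P Q => [|[a|u] P IHP].
- by move=> Q _ s sE; rewrite (sE : s = [::]); exact: sem_product_nil.
- elim=> [|[b|v] Q IHQ] //; rewrite [le_product _ _ _]/=; case: ifPn => ab.
  + by move=> /IHP ?; apply/sem_Opt_Opt_le.
  + by move=> /IHQ ?; apply/sem_Opt_Opt_nle.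
  + by move=> /IHP ?; apply/sem_Opt_Star_le.
  + by move=> /IHQ ?; apply/sem_Opt_Star_nle.
- elim=> [|[b|v] Q IHQ] //; rewrite [le_product _ _ _]/=; case: ifPn => uv.
  + by move/eqP: uv => -> /IHP; rewrite sem_Star0.
  + by move=> /IHQ ?; apply/sem_Star_Opt.
  + by move=> /IHP ?; apply/sem_Star_Star_le.
  + by move=> /IHQ ?; apply/sem_Star_Star_nle.
Qed.

(* [le_product] is not complete in general: [fset0^*] denotes the language of
   the empty product but is not below it.  Products ending with a star, the
   only ones the theorem compares, do not raise this problem. *)
Fixpoint starred P : bool :=
  if P is A :: P' then
    if P' is [::] then (if A is Star _ then true else false) else starred P'
  else false.

Lemma starred_cons A P : starred P -> starred (A :: P).
Proof. by case: P. Qed.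

Lemma starred_with_star P u : starred (with_star P u).
Proof.
elim: P => [|A P IH] //; rewrite /with_star rcons_cons; exact: starred_cons.
Qed.

(** Excludes the step of the comparison that would discard the last star of the right-hand
    product. *)
Lemma nonempty_atom_sub A P : A != Star fset0 -> ~ semP (A :: P) `<=` semP [::].
Proof.
case: A => [a|u] nA H.
  have [x ax] := sem_nonempty a.
  have /H : semP (Opt a :: P) [:: x] by apply/sem_product_Opt; right; exists x, [::];
    split=> //; exact: sem_product_nil.
  by [].
have [|x ux] := @sem_fset_nonempty u; first by apply: contraNneq nA => ->.
have /H : semP (Star u :: P) [:: x] by apply/sem_product_Star; right; exists x, [::];
  split=> //; exact: sem_product_nil.
by [].
Qed.

Lemma le_product_complete P Q : starred Q -> semP P `<=` semP Q -> le_product le P Q.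
Proof.
elim: P Q => [|[a|u] P IHP]; first by case.
- elim=> [|[b|v] Q IHQ] // sQ; rewrite [le_product _ _ _]/=; case: ifPn => ab.
  + by move=> /(sem_Opt_Opt_le _ _ ab); apply: IHP; case: Q sQ {IHQ}.
  + by move=> /(sem_Opt_Opt_nle _ _ ab); apply: IHQ; case: Q sQ.
  + by move=> /(sem_Opt_Star_le _ _ ab); apply: IHP.
  + move=> /(sem_Opt_Star_nle _ _ ab); case: Q sQ IHQ => [_ _|B Q sQ IHQ].
      by move/nonempty_atom_sub; case.
    exact: IHQ.
- elim=> [|[b|v] Q IHQ] // sQ; rewrite [le_product _ _ _]/=; case: ifPn => uv.
  + by move/eqP: uv => ->; rewrite sem_Star0; apply: IHP.
  + by move=> /(sem_Star_Opt _ _ _ uv); apply: IHQ; case: Q sQ.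
  + by move=> /(sem_Star_Star_le _ _ uv); apply: IHP.
  + move=> /(sem_Star_Star_nle _ _ uv); case: Q sQ IHQ => [_ _|B Q sQ IHQ].
      by move/nonempty_atom_sub; case; apply: contraNneq uv => -[->].
    exact: IHQ.
Qed.

End Representation.

(** * The meet of two products *)

Section Meet.
Variables (X : topologicalType) (S : choiceType) (code : S -> nat).
Variables (sem : S -> set X) (le : rel S) (tau : {fset S}).
Variable meet : S -> S -> {fset S}.
Hypothesis HS : S_representation code sem le tau meet.
Implicit Types (P Q R T : product S) (s t : seq X) (u v w : {fset S}).
Implicit Types (A B : {fset product S}).
Local Notation semP := (sem_product sem).
Local Notation semF := (sem_fset sem).
Local Notation codeP := (code_product code).
Local Notation rs := (remove_subsumed code le).

Definition sem_products A : set (seq X) := finite_union semP A.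

Lemma subsumed_order P Q : (P == [::]) || starred P -> subsumed code le P Q ->
  semP P `<=` semP Q /\ (~ semP Q `<=` semP P \/ codeP P < codeP Q).
Proof.
move=> gP /and3P[QP PQ nQP]; split; first exact: (le_product_sound HS).
case/orP: nQP => [nQP|]; last by right.
case/orP: gP => [/eqP PE|sP]; last by left => /(le_product_complete HS sP); exact/negP.
by right; move: QP; rewrite PE; case: (Q).
Qed.

Lemma remove_subsumed_sub A : {subset rs A <= A}.
Proof. by move=> P; rewrite !inE => /andP[]. Qed.

(** From [P] one climbs along [subsumed], strictly for the transitive and irreflexive [lt]; the
    number of members of [A] above the current product decreases. On empty or starred products
    [subsumed] implies [lt], by completeness of [le_product]. *)
Lemma remove_subsumed_above A P :
  (forall Q, Q \in A -> (Q == [::]) || starred Q) -> P \in A ->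
  exists2 Q, Q \in rs A & semP P `<=` semP Q.
Proof.
move=> gA; pose lt P Q := `[< semP P `<=` semP Q /\
  (~ semP Q `<=` semP P \/ codeP P < codeP Q) >].
have [n] := ubnP #|` [fset Q in A | lt P Q]%fset|; elim: n P => // n IH P up PA.
have [/hasP[Q QA PQ]|nsub] := boolP (has (fun Q => subsumed code le P Q) A); last first.
  by exists P => //; rewrite !inE PA.
have ltPQ : lt P Q by apply/asboolP/subsumed_order => //; exact: gA.
have [PQs ltPQ'] := asboolW ltPQ.
have [|//|R RA QR] := IH Q; last by exists R => //; exact: subset_trans QR.
rewrite -ltnS (leq_trans _ up) // ltnS; apply: fproper_ltn_card.
rewrite fproperE; apply/andP; split; first (apply/fsubsetP => R).
  rewrite !inE => /andP[-> /asboolP[QR QR']] /=; apply/asboolP.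
  split; first exact: subset_trans QR.
  case: QR' => [nRQ|QR']; first by left => RP; apply: nRQ; exact: subset_trans PQs.
  case: ltPQ' => [nQP|PQ']; last by right; exact: ltn_trans QR'.
  by left => RP; apply: nQP; exact: subset_trans RP.
apply/fsubsetPn; exists Q; first by rewrite !inE QA.
by rewrite !inE QA /=; apply/asboolP => -[_ [|]]; rewrite ?ltnn //; apply.
Qed.

Lemma sem_remove_subsumed A :
  (forall Q, Q \in A -> (Q == [::]) || starred Q) ->
  sem_products (rs A) = sem_products A.
Proof.
move=> gA; apply/seteqP; split=> s [P PA Ps].
  by exists P => //; exact: remove_subsumed_sub.
by have [Q QA PQ] := remove_subsumed_above gA PA; exists Q => //; exact: PQ.
Qed.

Lemma remove_subsumed_nil A R : R \in A -> R != [::] -> [::] \notin rs A.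
Proof.
move=> RA nR; rewrite !inE negb_and negbK; apply/orP; right; apply/hasP; exists R => //.
by rewrite /subsumed nR /=; case: R {RA} nR => //= ? ? _; rewrite orbT.
Qed.

(** The larger code settles the case where both products denote the same language. Thus a lone star,
    which need not be the expected final one, disappears as soon as a longer product with the same
    first atom is present. *)
Lemma remove_subsumed_star A w R : Star w :: R \in A -> R != [::] ->
  ([:: Star w] : product S) \notin rs A.
Proof.
move=> RA nR; rewrite !inE negb_and negbK; apply/orP; right; apply/hasP.
exists (Star w :: R) => //; apply/and3P; split.
- by case: R nR {RA} => // A0 R _; apply/eqP.
- rewrite /=; have -> : dominated le w w by apply/(dominatedP HS).
  by case: (R) nR.
- apply/orP; right; rewrite /code_product /= ltnS; apply: ltn_cpair2.
  by case: (R) nR.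
Qed.

Lemma sem_productsU A B : sem_products (A `|` B)%fset = sem_products A `|` sem_products B.
Proof.
apply/seteqP; split=> s.
  by move=> [P /fsetUP[PA|PB] Ps]; [left|right]; exists P.
by case=> -[P PA Ps]; exists P => //; apply/fsetUP; [left|right].
Qed.

Lemma sem_products1 P : sem_products [fset P]%fset = semP P.
Proof.
apply/seteqP; split=> s; first by move=> [Q /fset1P->].
by exists P => //; rewrite inE.
Qed.

Lemma sem_star_products w B s : sem_products (star_products w B) s <->
  exists2 R, R \in B & semP (Star w :: R) s.
Proof.
split=> [[P /imfsetP[R /= RB ->] Ps]|[R RB Rs]]; first by exists R.
by exists (Star w :: R) => //; apply/imfsetP; exists R.
Qed.

(** For empty [C] no product is formed and even the words of [B] are lost; the emptiness tests in
    the clauses pairing [Opt] with [Star] guard against this. *)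
Lemma sem_opt_products C B s : C != fset0 -> sem_products (opt_products C B) s <->
  sem_products B s \/ exists x s', [/\ s = x :: s', semF C x & sem_products B s'].
Proof.
move=> /fset0Pn[c cC]; split.
  move=> [P /imfset2P[d /= dC [R RB ->]] /sem_product_Opt[Rs|[x [s' [sE dx Rs']]]]].
    by left; exists R.
  by right; exists x, s'; split=> //; [exists d|exists R].
case=> [[R RB Rs]|[x [s' [-> [d dC dx] [R RB Rs']]]]].
  exists (Opt c :: R); last by apply/sem_product_Opt; left.
  by apply/imfset2P; exists c => //; exists R.
exists (Opt d :: R); last by apply/sem_product_Opt; right; exists x, s'.
by apply/imfset2P; exists d => //; exists R.
Qed.

Lemma sem_opt_products_sub C B : sem_products (opt_products C B) `<=`
  [set s | sem_products B s \/
    exists x s', [/\ s = x :: s', semF C x & sem_products B s']].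
Proof.
move=> s [P /imfset2P[d /= dC [R RB ->]] /sem_product_Opt[Rs|[x [s' [sE dx Rs']]]]].
  by left; exists R.
by right; exists x, s'; split=> //; [exists d|exists R].
Qed.

Lemma sem_meetr a v : semF (\bigcup_(b <- v) meet a b)%fset = sem a `&` semF v.
Proof.
have -> : (\bigcup_(b <- v) meet a b)%fset = meet_fset meet [fset a]%fset v.
  by rewrite /meet_fset big_seq_fset1.
rewrite (sem_meet_fset HS); congr (_ `&` _).
by rewrite sem_fset_finite_union; apply/seteqP; split=> x;
  [move=> [c /fset1P->]|exists a; rewrite ?inE].
Qed.

Lemma sem_meetl u b : semF (\bigcup_(a <- u) meet a b)%fset = semF u `&` sem b.
Proof.
have -> : (\bigcup_(a <- u) meet a b)%fset = meet_fset meet u [fset b]%fset.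
  by rewrite /meet_fset; apply: eq_bigr => a _; rewrite big_seq_fset1.
rewrite (sem_meet_fset HS); congr (_ `&` _).
by rewrite (sem_fset_finite_union sem [fset b]%fset); apply/seteqP; split=> x;
  [move=> [c /fset1P->]|exists b; rewrite ?inE].
Qed.

Lemma bigfcup_neq0 (F : S -> {fset S}) v :
  has (fun b => F b != fset0) v = ((\bigcup_(b <- v) F b)%fset != fset0).
Proof.
apply/hasP/fset0Pn => [[b bv /fset0Pn[c cb]]|[c /bigfcupP[b /andP[bv _] cb]]].
  by exists c; apply/bigfcupP; exists b; rewrite ?bv.
by exists b => //; apply/fset0Pn; exists c.
Qed.

Definition ends_with w T : Prop := exists R, T = with_star R w.

Lemma ends_with_cons w (D : atom S) T : ends_with w T -> ends_with w (D :: T).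
Proof. by move=> [R ->]; exists (D :: R). Qed.

Lemma ends_with_consE w (D : atom S) T : ends_with w (D :: T) ->
  (T = [::] /\ D = Star w) \/ (T != [::] /\ ends_with w T).
Proof.
move=> [[|C R] [-> ->]]; first by left.
by right; split; [case: R|exists R].
Qed.

Lemma ends_with_good w T : ends_with w T -> (T == [::]) || starred T.
Proof. by move=> [R ->]; rewrite starred_with_star orbT. Qed.

Lemma ends_with_neq w T : ends_with w T -> T != [::].
Proof. by move=> [[|? ?] ->]. Qed.

(** The form of the products and their common language are specified together, since the language of
    a pruned set is controlled through the form of its members. *)
Definition meet_spec w (L : set (seq X)) A : Prop :=
  (forall T, T \in A -> ends_with w T) /\ sem_products A = L.

(* [[::]] is the meet of a product with the empty one, to which the recursion
   comes down once it has consumed a final star. *)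
Definition weak_spec w (L : set (seq X)) A : Prop :=
  (forall T, T \in A -> T = [::] \/ ends_with w T) /\ sem_products A = L.

Lemma meet_spec_weak w L A : meet_spec w L A -> weak_spec w L A.
Proof. by move=> [H E]; split=> // T /H; right. Qed.

Lemma weak_spec_good w L A : weak_spec w L A ->
  forall T, T \in A -> (T == [::]) || starred T.
Proof. by move=> [H _] T /H[->|/ends_with_good]. Qed.

Lemma meet_spec_nonempty w L A : meet_spec w L A -> L [::] -> exists2 T, T \in A & ends_with w T.
Proof. by move=> [H <-] [T TA _]; exists T => //; exact: H. Qed.

(** A single non-empty member is enough for the pruning to expel the empty product, which is all
    that separates the weak specification from the full one. *)
Lemma remove_subsumed_spec w L A R : weak_spec w L A -> R \in A -> R != [::] ->
  meet_spec w L (rs A).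
Proof.
move=> wA RA nR; split=> [T TA|]; last first.
  by rewrite sem_remove_subsumed; [case: wA|exact: weak_spec_good wA].
case: wA => /(_ T (remove_subsumed_sub TA))[TE|//] _.
by have := remove_subsumed_nil RA nR; rewrite -TE TA.
Qed.

Lemma meet_product_nil P Q : P = [::] \/ Q = [::] ->
  meet_product code le meet P Q = [fset ([::] : product S)]%fset.
Proof. by case: P => [|[a|u] P]; case: Q => [|[b|v] Q] // []. Qed.

Lemma weak_spec_nil w P Q : P = [::] \/ Q = [::] ->
  weak_spec w (semP P `&` semP Q) (meet_product code le meet P Q).
Proof.
move=> PQ; rewrite meet_product_nil //; split=> [T /fset1P->|]; first by left.
rewrite sem_products1; apply/seteqP; split=> [s sE|s []].
  by rewrite (sE : s = [::]); split; exact: sem_product_nil.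
by case: PQ => ->.
Qed.

Lemma mem_opt_products c C B R : c \in C -> R \in B ->
  (Opt c :: R : product S) \in opt_products C B.
Proof. by move=> cC RB; apply/imfset2P; exists c => //; exists R. Qed.

Lemma opt_products_in C B x s : semF C x -> sem_products B s ->
  sem_products (opt_products C B) (x :: s).
Proof.
move=> [c cC cx] [R RB Rs]; exists (Opt c :: R); first exact: mem_opt_products.
by apply/sem_product_Opt; right; exists x, s.
Qed.

Lemma opt_products_ends w L C B T : meet_spec w L B -> T \in opt_products C B ->
  ends_with w T.
Proof. by move=> [H _] /imfset2P[c _ [R /= /H RB ->]]; exact: ends_with_cons. Qed.

Lemma meet_product_spec P Q u v : ends_with u P -> ends_with v Q ->
  meet_spec (meet_fset meet u v) (semP P `&` semP Q) (meet_product code le meet P Q).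
Proof.
set w := meet_fset meet u v.
pose mp := meet_product code le meet.
have nilPQ P' Q' : (semP P' `&` semP Q') [::] by split; exact: sem_product_nil.
elim: P Q => [|D P IHP] Q; first by move/ends_with_neq.
elim: Q => [|D' Q IHQ]; first by move=> _ /ends_with_neq.
move=> eP eQ.
have nonemptyM L A : meet_spec w L A -> L [::] -> exists2 T, T \in A & T != [::].
  by move=> mA /(meet_spec_nonempty mA)[T TA /ends_with_neq]; exists T.
(* While [P] is non-empty it still ends in [u^*] and the induction hypothesis applies; once it is
   exhausted only the weak specification remains. *)
have spec1 : P != [::] -> meet_spec w (semP P `&` semP (D' :: Q)) (mp P (D' :: Q)).
  by case: (ends_with_consE eP) => [[-> _]|[_ eP'] _] //; exact: IHP.
have spec2 : Q != [::] -> meet_spec w (semP (D :: P) `&` semP Q) (mp (D :: P) Q).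
  by case: (ends_with_consE eQ) => [[-> _]|[_ eQ'] _] //; exact: IHQ.
have spec3 : P != [::] -> Q != [::] -> meet_spec w (semP P `&` semP Q) (mp P Q).
  case: (ends_with_consE eP) => [[-> _]|[_ eP'] _] //.
  by case: (ends_with_consE eQ) => [[-> _]|[_ eQ'] _] //; exact: IHP.
have weak1 : weak_spec w (semP P `&` semP (D' :: Q)) (mp P (D' :: Q)).
  case: (eqVneq P [::]) => [->|/spec1/meet_spec_weak //].
  by apply: weak_spec_nil; left.
have weak2 : weak_spec w (semP (D :: P) `&` semP Q) (mp (D :: P) Q).
  case: (eqVneq Q [::]) => [->|/spec2/meet_spec_weak //].
  by apply: weak_spec_nil; right.
case: D D' eP eQ spec1 spec2 spec3 weak1 weak2 {IHP IHQ}
  => [a|u'] [b|v'] eP eQ spec1 spec2 spec3 weak1 weak2.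
(* An [Opt] is never the last atom of a product that ends in a star, so both remainders are
   non-empty. *)
- have nP : P != [::] by case: (ends_with_consE eP) => -[].
  have nQ : Q != [::] by case: (ends_with_consE eQ) => -[].
  have [R RM nR] := nonemptyM _ _ (spec1 nP) (nilPQ _ _).
  have := spec3 nP nQ => spec3'.
  apply: (@remove_subsumed_spec _ _ _ R); last by [].
    split=> [T /fsetUP[/fsetUP[]|/(opt_products_ends spec3')]|]; last 1 first.
    + rewrite !sem_productsU; have -> := proj2 weak1; have -> := proj2 weak2.
      apply/seteqP; split=> s.
        case=> [[] [Ps Qs]|/sem_opt_products_sub].
        * by split=> //; apply/sem_product_Opt; left.
        * by split=> //; apply/sem_product_Opt; left.
        rewrite /= (proj2 spec3') => -[[Ps Qs]|[x [s' [-> ]]]].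
          by split; apply/sem_product_Opt; left.
        rewrite /sem_fset -(srep_meetP HS) => -[ax bx] [Ps Qs].
        by split; apply/sem_product_Opt; right; exists x, s'.
      move=> [/sem_product_Opt[Ps|[x [s' [-> ax Ps]]]] Qs]; first by left; right.
      case/sem_product_Opt: (Qs) => [Qs'|[y [t' [[<- <-] bx Qs']]]].
        by left; left; split=> //; apply/sem_product_Opt; right; exists x, s'.
      right; apply: opt_products_in; last by rewrite (proj2 spec3').
      by rewrite /sem_fset -(srep_meetP HS).
    + by move/(proj1 weak2).
    + by move/(proj1 weak1).
    + by right.
  by apply/fsetUP; left; apply/fsetUP; right.
- have nP : P != [::] by case: (ends_with_consE eP) => -[].
  have := spec1 nP => spec1'.
  have [R RM nR] := nonemptyM _ _ spec1' (nilPQ _ _).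
  rewrite [meet_product _ _ _ _ _]/= bigfcup_neq0.
  set C := (\bigcup_(b <- v') meet a b)%fset.
  have CE : semF C = sem a `&` semF v' by exact: sem_meetr.
  have sub2 : semP (Opt a :: P) `&` semP Q `<=` semP (Opt a :: P) `&` semP (Star v' :: Q).
    by move=> s [? ?]; split=> //; apply/sem_product_Star; left.
  case: ifPn => nC.
    have [c cC] := fset0Pn _ nC.
    apply: (@remove_subsumed_spec _ _ _ (Opt c :: R)); last by [].
      split=> [T /fsetUP[/(opt_products_ends spec1')|/(proj1 weak2) //]|]; first by right.
      rewrite sem_productsU; have -> := proj2 weak2.
      apply/seteqP; split=> s.
        case=> [/(sem_opt_products _ _ nC)|/sub2 //].
        rewrite (proj2 spec1') CE => -[[Ps Qs]|[x [s' [-> [ax vx] [Ps Qs]]]]].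
          by split=> //; apply/sem_product_Opt; left.
        by split; [apply/sem_product_Opt|apply/sem_product_Star]; right; exists x, s'.
      move=> [/sem_product_Opt[Ps|[x [s' [-> ax Ps]]]] Qs].
        by left; apply/(sem_opt_products _ _ nC); left; rewrite (proj2 spec1').
      case/sem_product_Star: (Qs) => [Qs'|[y [t' [[<- <-] bx Qs']]]].
        by right; split=> //; apply/sem_product_Opt; right; exists x, s'.
      by left; apply: opt_products_in; rewrite ?CE ?(proj2 spec1').
    by apply/fsetUP; left; exact: mem_opt_products.
  apply: (@remove_subsumed_spec _ _ _ R); last by [].
    split=> [T /fsetUP[/(proj1 weak1)|/(proj1 weak2)] //|].
    rewrite sem_productsU; have -> := proj2 weak1; have -> := proj2 weak2.
    apply/seteqP; split=> s.
      by case=> [[Ps Qs]|/sub2 //]; split=> //; apply/sem_product_Opt; left.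
    move=> [/sem_product_Opt[Ps|[x [s' [-> ax Ps]]]] Qs]; first by left.
    case/sem_product_Star: (Qs) => [Qs'|[y [t' [[<- <-] bx Qs']]]].
      by right; split=> //; apply/sem_product_Opt; right; exists x, s'.
    have : semF C x by rewrite CE.
    by move: nC; rewrite negbK => /eqP ->; rewrite sem_fset0.
  by apply/fsetUP; left.
- have nQ : Q != [::] by case: (ends_with_consE eQ) => -[].
  have := spec2 nQ => spec2'.
  have [R RM nR] := nonemptyM _ _ spec2' (nilPQ _ _).
  rewrite [meet_product _ _ _ _ _]/= (bigfcup_neq0 (fun a => meet a b)).
  set C := (\bigcup_(a <- u') meet a b)%fset.
  have CE : semF C = semF u' `&` sem b by exact: sem_meetl.
  have sub1 : semP P `&` semP (Opt b :: Q) `<=` semP (Star u' :: P) `&` semP (Opt b :: Q).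
    by move=> s [? ?]; split=> //; apply/sem_product_Star; left.
  case: ifPn => nC.
    have [c cC] := fset0Pn _ nC.
    apply: (@remove_subsumed_spec _ _ _ (Opt c :: R)); last by [].
      split=> [T /fsetUP[/(opt_products_ends spec2')|/(proj1 weak1) //]|]; first by right.
      rewrite sem_productsU; have -> := proj2 weak1.
      apply/seteqP; split=> s.
        case=> [/(sem_opt_products _ _ nC)|/sub1 //].
        rewrite (proj2 spec2') CE => -[[Ps Qs]|[x [s' [-> [ux bx] [Ps Qs]]]]].
          by split=> //; apply/sem_product_Opt; left.
        by split; [apply/sem_product_Star|apply/sem_product_Opt]; right; exists x, s'.
      move=> [Ps /sem_product_Opt[Qs|[x [s' [sE bx Qs]]]]].
        by left; apply/(sem_opt_products _ _ nC); left; rewrite (proj2 spec2').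
      rewrite {s}sE in Ps *.
      case/sem_product_Star: (Ps) => [Ps'|[y [t' [[<- <-] ux Ps']]]].
        by right; split=> //; apply/sem_product_Opt; right; exists x, s'.
      by left; apply: opt_products_in; rewrite ?CE ?(proj2 spec2').
    by apply/fsetUP; left; exact: mem_opt_products.
  apply: (@remove_subsumed_spec _ _ _ R); last by [].
    split=> [T /fsetUP[/(proj1 weak2)|/(proj1 weak1)] //|].
    rewrite sem_productsU; have -> := proj2 weak1; have -> := proj2 weak2.
    apply/seteqP; split=> s.
      by case=> [[Ps Qs]|/sub1 //]; split=> //; apply/sem_product_Opt; left.
    move=> [Ps /sem_product_Opt[Qs|[x [s' [sE bx Qs]]]]]; first by left.
    rewrite {s}sE in Ps *.
    case/sem_product_Star: (Ps) => [Ps'|[y [t' [[<- <-] ux Ps']]]].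
      by right; split=> //; apply/sem_product_Opt; right; exists x, s'.
    have : semF C x by rewrite CE.
    by move: nC; rewrite negbK => /eqP ->; rewrite sem_fset0.
  by apply/fsetUP; left.
- rewrite [meet_product _ _ _ _ _]/= -/(mp P (Star v' :: Q))
    -[X in (_ `|` X)%fset]/(mp (Star u' :: P) Q).
  set w' := meet_fset meet u' v'; set B := (_ `|` _)%fset.
  have wB T : T \in B -> T = [::] \/ ends_with w T.
    by move=> /fsetUP[/(proj1 weak1)|/(proj1 weak2)].
  have raw : sem_products (star_products w' B) =
      semP (Star u' :: P) `&` semP (Star v' :: Q).
    have BE : sem_products B = (semP P `&` semP (Star v' :: Q)) `|`
        (semP (Star u' :: P) `&` semP Q).
      by rewrite sem_productsU (proj2 weak1) (proj2 weak2).
    apply/seteqP; split=> s.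
      move=> /sem_star_products[R RB].
      elim: s => [|x s IHs]; first by move=> _; exact: nilPQ.
      move=> /sem_product_Star[Rs|[_ [_ [[<- <-]]]]].
        have : sem_products B (x :: s) by exists R.
        rewrite BE => -[[Ps Qs]|[Ps Qs]]; split=> //; apply/sem_product_Star; left=> //.
      rewrite (sem_meet_fset HS) => -[ux vx] /IHs[Ps Qs].
      by split; apply/sem_product_Star; right; exists x, s.
    move=> PQs; apply/sem_star_products.
    have baseR t : sem_products B t -> exists2 R, R \in B & semP (Star w' :: R) t.
      by move=> [R RB Rt]; exists R => //; apply/sem_product_Star; left.
    (* Letters go to the common star as long as both stars absorb them; the first letter refused by
       one of the stars leaves the rest of the word in the language of [B]. *)
    elim: s PQs => [|x s IHs] [Ps Qs].
      by apply: baseR; rewrite BE; left; split=> //; exact: sem_product_nil.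
    case/sem_product_Star: (Ps) => [Ps'|[_ [_ [[<- <-] ux Ps']]]].
      by apply: baseR; rewrite BE; left.
    case/sem_product_Star: (Qs) => [Qs'|[_ [_ [[<- <-] vx Qs']]]].
      by apply: baseR; rewrite BE; right.
    have [R RB Rs] := IHs (conj Ps' Qs'); exists R => //.
    by apply/sem_product_Star; right; exists x, s; split=> //; rewrite (sem_meet_fset HS).
  (* Prefixing the star to the empty member of [B] yields [w'^*] alone. This is the expected star if
     both stars were last; otherwise a non-empty [R] makes it subsumed. *)
  have [[PE QE]|[R RB nR]] : (P = [::] /\ Q = [::]) \/ (exists2 R, R \in B & R != [::]).
    case: (eqVneq P [::]) => [PE|/spec1 s1]; last first.
      have [R RM nR] := nonemptyM _ _ s1 (nilPQ _ _).
      by right; exists R => //; apply/fsetUP; left.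
    case: (eqVneq Q [::]) => [QE|/spec2 s2]; first by left.
    have [R RM nR] := nonemptyM _ _ s2 (nilPQ _ _).
    by right; exists R => //; apply/fsetUP; right.
  + have good T : T \in star_products w' B -> ends_with w T.
      move=> /imfsetP[R /= /wB[->|eR] ->]; last exact: ends_with_cons.
      exists [::]; case: (ends_with_consE eP) => -[]; last by rewrite PE.
      move=> _ [uE]; case: (ends_with_consE eQ) => -[]; last by rewrite QE.
      by move=> _ [vE]; rewrite /w -uE -vE.
    split=> [T /remove_subsumed_sub /good //|].
    by rewrite sem_remove_subsumed // => T /good/ends_with_good.
  + have good T : T \in star_products w' B -> (T == [::]) || starred T.
      move=> /imfsetP[R' /= /wB[->|eR] ->] //.
      by apply: (@ends_with_good w); exact: ends_with_cons.
    split; last by rewrite sem_remove_subsumed.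
    move=> T TA; have := remove_subsumed_sub TA => /imfsetP[R' /= /wB[R'E|eR] TE].
      have SA : Star w' :: R \in star_products w' B by apply/imfsetP; exists R.
      by have := remove_subsumed_star SA nR; rewrite -R'E -TE TA.
    by rewrite TE; exact: ends_with_cons.
Qed.

End Meet.

(** * Well-foundedness of inclusion between products and pairs *)

Section WellFounded.
Variables (X : topologicalType) (S : choiceType) (code : S -> nat).
Variables (sem : S -> set X) (le : rel S) (tau : {fset S}).
Variable meet : S -> S -> {fset S}.
Hypothesis HS : S_representation code sem le tau meet.
Implicit Types (P Q R T : product S) (u v w : {fset S}).
Local Notation semP := (sem_product sem).
Local Notation semF := (sem_fset sem).

Definition product_proper P Q : Prop := semP P `<` semP Q.

Lemma sem_product_cons_sub A P P' : semP P `<=` semP P' ->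
  semP (A :: P) `<=` semP (A :: P').
Proof. exact: (@sem_product_subr _ _ sem [:: A]). Qed.

(** The comparison of [R] with [P ++ Q] is followed until [P] is used up; the atoms of [R] consumed
    by then form [R1]. *)
Lemma sem_product_split R P Q : semP R `<=` semP (P ++ Q) ->
  exists R1 R2, [/\ R = R1 ++ R2, semP R1 `<=` semP P & semP R2 `<=` semP Q].
Proof.
elim: R P => [|A R IHR] P.
  move=> _; exists [::], [::]; split=> // s sE; rewrite (sE : s = [::]);
    exact: sem_product_nil.
elim: P => [|B P IHP] H; first by exists [::], (A :: R); split.
have skip : semP (A :: R) `<=` semP (P ++ Q) -> exists R1 R2,
    [/\ A :: R = R1 ++ R2, semP R1 `<=` semP (B :: P) & semP R2 `<=` semP Q].
  move=> /IHP[R1 [R2 [-> R1P R2Q]]]; exists R1, R2; split=> // s /R1P.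
  by case: B {H} => [b|v] Ps; [apply/sem_product_Opt|apply/sem_product_Star]; left.
case: A IHR IHP H skip => [a|u] IHR _; case: B => [b|v] H skip.
- have [ab|nab] := boolP (le a b); last exact: skip (proj1 (sem_Opt_Opt_nle HS _ _ nab) H).
  have [R1 [R2 [-> R1P R2Q]]] := IHR _ (proj1 (sem_Opt_Opt_le HS _ _ ab) H).
  by exists (Opt a :: R1), R2; split=> //; apply/(sem_Opt_Opt_le HS _ _ ab).
- have [ab|nab] := boolP (has (fun b => le a b) v);
    last exact: skip (proj1 (sem_Opt_Star_nle HS _ _ nab) H).
  have [R1 [R2 [-> R1P R2Q]]] := IHR (Star v :: P) (proj1 (sem_Opt_Star_le HS _ _ ab) H).
  by exists (Opt a :: R1), R2; split=> //; apply/(sem_Opt_Star_le HS _ _ ab).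
- have [u0|nu] := eqVneq u fset0; last exact: skip (proj1 (sem_Star_Opt HS _ _ _ nu) H).
  rewrite u0 sem_Star0 in H; have [R1 [R2 [-> R1P R2Q]]] := IHR (Opt b :: P) H.
  by exists (Star u :: R1), R2; split=> //; rewrite u0 sem_Star0.
- have [uv|nuv] := boolP (dominated le u v);
    last exact: skip (proj1 (sem_Star_Star_nle HS _ _ nuv) H).
  have [R1 [R2 [-> R1P R2Q]]] := IHR (Star v :: P) (proj1 (sem_Star_Star_le HS _ _ uv) H).
  by exists (Star u :: R1), R2; split=> //; apply/(sem_Star_Star_le HS _ _ uv).
Qed.

Lemma Acc_product_sub P Q : semP P `<=` semP Q ->
  Acc product_proper Q -> Acc product_proper P.
Proof.
move=> PQ [accQ]; constructor => R [RP nPR]; apply: accQ; split.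
  exact: subset_trans PQ.
by move=> QR; apply: nPR; exact: subset_trans QR.
Qed.

(** A product strictly below [P ++ Q] splits as [R1 ++ R2]. Either [R1] is strictly below [P], or
    [R1] and [P] have the same language and [R2] is strictly below [Q]. *)
Lemma Acc_product_cat P Q :
  Acc product_proper P -> Acc product_proper Q -> Acc product_proper (P ++ Q).
Proof.
move=> accP; elim: accP Q => {}P _ IHP Q accQ; elim: accQ => {}Q accQ IHQ.
constructor => R [/sem_product_split[R1 [R2 [-> R1P R2Q]]] nPQR].
have accR2 : Acc product_proper R2 by apply: Acc_product_sub R2Q _; constructor.
have [PR1|nPR1] := pselect (semP P `<=` semP R1); last exact: IHP.
apply: (@Acc_product_sub _ (P ++ R2)); first exact: sem_product_subl.
apply: IHQ; split=> // QR2; apply: nPQR.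
by apply: (subset_trans (sem_product_subl PR1)); exact: sem_product_subr.
Qed.

Lemma Acc_product_nil : Acc product_proper [::].
Proof.
constructor => R [_ H]; exfalso; apply: H => s sE.
by rewrite (sE : s = [::]); exact: sem_product_nil.
Qed.

Lemma Acc_product_atoms R : (forall A, A \in R -> Acc product_proper [:: A]) ->
  Acc product_proper R.
Proof.
elim: R => [|A R IH] H; first exact: Acc_product_nil.
apply: (@Acc_product_cat [:: A]); first by apply: H; rewrite mem_head.
by apply: IH => B BR; apply: H; rewrite in_cons BR orbT.
Qed.

Lemma sem_atom_mem A R : A \in R -> semP [:: A] `<=` semP R.
Proof.
case/splitPr => R1 R2 s As; apply: (@sem_product_subl _ _ sem [::] R1).
  by move=> t tE; rewrite (tE : t = [::]); exact: sem_product_nil.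
apply: (@sem_product_cons_sub A [::]) As => t tE.
by rewrite (tE : t = [::]); exact: sem_product_nil.
Qed.

Lemma closed_proper_wf : well_founded (@closed_proper X).
Proof. exact: noetherian_closed_wf (srep_noetherian HS). Qed.

(** Up to atoms [fset0^*], a product strictly below [a^?] is either empty or equivalent to some
    [b^?] with [sem b] strictly inside [sem a]. *)
Lemma Acc_product_Opt a : Acc product_proper [:: Opt a].
Proof.
suff H C : Acc (@closed_proper X) C -> forall b, sem b = C -> Acc product_proper [:: Opt b].
  exact: (H _ (closed_proper_wf (sem a))).
elim=> {a}{}C _ IH a aE; constructor.
have empty R : semP R `<=` semP [::] -> Acc product_proper R.
  by move=> /Acc_product_sub; apply; exact: Acc_product_nil.
elim=> [|[b|u] R IHR] [RO nOR]; first exact: Acc_product_nil.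
- have [ba|nba] := boolP (le b a); last first.
    by apply: empty; apply/(sem_Opt_Opt_nle HS _ _ nba).
  have R0 : semP R `<=` semP [::] by apply/(sem_Opt_Opt_le HS _ _ ba).
  apply: (@Acc_product_sub _ [:: Opt b]); first exact: sem_product_cons_sub.
  apply: (IH (sem b)) => //; rewrite -aE; split; first exact: closed_sem HS b.
  split; first exact/(srep_leP HS).
  move=> /(srep_leP HS) ab; apply: nOR; apply/(sem_Opt_Opt_le HS _ _ ab) => s sE.
  by rewrite (sE : s = [::]); exact: sem_product_nil.
- have [u0|nu] := eqVneq u fset0; last exact: empty (proj1 (sem_Star_Opt HS _ _ _ nu) RO).
  apply: (@Acc_product_sub _ R); first by rewrite u0 sem_Star0.
  by apply: IHR; split; move: RO nOR; rewrite u0 sem_Star0.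
Qed.

(** If [v^*] occurs in a product [R] strictly below [u^*], then [v] denotes a strictly smaller set,
    for otherwise [u^*] would be included in [v^*] and hence in [R]. All the atoms of [R] are thus
    accessible. *)
Lemma Acc_product_Star u : Acc product_proper [:: Star u].
Proof.
suff H C : Acc (@closed_proper X) C -> forall v, semF v = C -> Acc product_proper [:: Star v].
  exact: (H _ (closed_proper_wf (semF u))).
elim=> {u}{}C _ IH u uE; constructor => R [RS nSR].
apply: Acc_product_atoms => -[a|v] AR; first exact: Acc_product_Opt.
apply: (IH (semF v)) => //; rewrite -uE; split; first exact: closed_sem_fset HS v.
have star1 (x : X) w : semP [:: Star w] [:: x] <-> semF w x.
  split=> [/sem_product_Star[//|[y [t [[-> _]]]]]//|wx].
  by apply/sem_product_Star; right; exists x, [::]; split=> //; exact: sem_product_nil.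
split=> [x vx|uv].
  by apply/star1/RS/(sem_atom_mem AR)/star1.
apply: nSR; apply: subset_trans (sem_atom_mem AR).
apply/(sem_Star_Star_le HS); first exact/(dominatedP HS).
by move=> s sE; rewrite (sE : s = [::]); exact: sem_product_nil.
Qed.

Lemma product_proper_wf : well_founded product_proper.
Proof.
move=> R; apply: Acc_product_atoms => -[a|u] _; first exact: Acc_product_Opt.
exact: Acc_product_Star.
Qed.

(** A lexicographic induction: [C] bounds the letters of the tail and [T] bounds the product with
    its star. The relation [lt] is left abstract so that the lemma covers both kinds of words. *)
Lemma pair_wf (lt : product S * {fset S} -> product S * {fset S} -> Prop) :
  (forall c d, lt c d -> [/\ semF c.2 `<=` semF d.2,
     semP (with_star c.1 c.2) `<=` semP (with_star d.1 d.2) &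
     ~ (semF d.2 `<=` semF c.2 /\
        semP (with_star d.1 d.2) `<=` semP (with_star c.1 c.2))]) ->
  well_founded lt.
Proof.
move=> ltP c0.
suff H C : Acc (@closed_proper X) C -> forall T, Acc product_proper T -> forall c,
    semF c.2 `<=` C -> semP (with_star c.1 c.2) `<=` semP T -> Acc lt c.
  exact: (H _ (closed_proper_wf (semF c0.2)) _
    (product_proper_wf (with_star c0.1 c0.2)) c0).
elim=> {}C _ IHC T; elim=> {}T _ IHT c cC cT; constructor => d /ltP[dcF dcP nd].
(* If the tail shrinks strictly, the bound on the product may start afresh; otherwise the tails
   agree and the product must shrink. *)
have [cdF|ncdF] := pselect (semF c.2 `<=` semF d.2); last first.
  suff dC : closed_proper (semF d.2) C.
    exact: (IHC _ dC _ (product_proper_wf (with_star d.1 d.2)) d).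
  split; first exact: closed_sem_fset HS d.2.
  split; first exact: subset_trans cC.
  by move=> Cd; apply: ncdF; exact: subset_trans Cd.
suff dT : product_proper (with_star d.1 d.2) T.
  by apply: (IHT _ dT d) => //; exact: subset_trans cC.
split; first exact: subset_trans cT.
by move=> Td; apply: nd; split=> //; exact: subset_trans Td.
Qed.

End WellFounded.

(** * The asymptotic subword topology *)

Section Letters.
Variable X : Type.
Implicit Types (w : word X) (s : seq X) (U V : set X) (Us : seq (set X)).

Lemma letter_prepend_l s w i : i < size s -> letter (prepend s w) i = onth s i.
Proof.
case: w => [t|f] lt /=.
  by elim: s i lt => [|x s IH] [|i] //= lt; exact: IH.
rewrite /prepend_inf; elim: s i f lt => [|x s IH] [|i] f //= lt.
by rewrite subSS; exact: IH.
Qed.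

Lemma letter_prepend_r s w i : letter (prepend s w) (size s + i) = letter w i.
Proof.
case: w => [t|f] /=; first by elim: s => //= x s IH; rewrite -IH.
by rewrite /prepend_inf nth_default ?leq_addr // addKn.
Qed.

Lemma prepend_cat s t w : prepend (s ++ t) w = prepend s (prepend t w).
Proof.
case: w => [u|f] /=; first by rewrite catA.
congr Inf; apply/funext => i; rewrite /prepend_inf nth_cat size_cat subnDA.
by case: ltnP => [lt|le]; [exact: set_nth_default|rewrite [RHS]nth_default].
Qed.

Lemma prepend_nil w : prepend [::] w = w.
Proof. by case: w => //= f; congr Inf; apply/funext => i; rewrite /prepend_inf subn0 nth_nil. Qed.

(** The map [phi] is increasing on all of [nat], including beyond the end of a finite word, which
    spares partial maps. *)
Definition embeds (phi : nat -> nat) w w' : Prop :=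
  (forall i j, i < j -> phi i < phi j) /\
  forall i x, letter w i = Some x -> letter w' (phi i) = Some x.

Lemma subword_from_le Us w k k' : k' <= k -> subword_from Us w k -> subword_from Us w k'.
Proof.
by case: Us => // U Us kk' [i [ki Ui H]]; exists i; split=> //; exact: leq_trans ki.
Qed.

Lemma subword_tail V Us w : subword_set (V :: Us) w -> subword_set Us w.
Proof. by move=> [i [_ _ /subword_from_le]]; apply. Qed.

Lemma embeds_letter_in phi w w' U i : embeds phi w w' -> letter_in U w i ->
  letter_in U w' (phi i).
Proof. by move=> [_ H] [x /H wx Ux]; exists x. Qed.

Lemma embeds_subword phi w w' Us k : embeds phi w w' ->
  subword_from Us w k -> subword_from Us w' (phi k).
Proof.
move=> ww'; elim: Us k => // U Us IH k [i [ki Ui /IH H]].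
have [mono _] := ww'; exists (phi i); split.
- by move: ki; rewrite leq_eqVlt => /predU1P[->//|/mono/ltnW].
- exact: embeds_letter_in Ui.
- by apply: subword_from_le H; exact: mono.
Qed.

Lemma embeds_prepend s w : embeds (addn (size s)) w (prepend s w).
Proof. by split=> [i j|i x]; [rewrite ltn_add2l|rewrite letter_prepend_r]. Qed.

Lemma embeds_prefix s w : embeds id (Fin s) (prepend s w).
Proof.
split=> // i x /= six; rewrite letter_prepend_l //.
by rewrite ltnNge; apply/negP => le; move: six; rewrite onth_default.
Qed.

Lemma embeds_prependl s w w' phi : embeds phi w w' ->
  exists psi, embeds psi (prepend s w) (prepend s w').
Proof.
move=> [mono H]; exists (fun i => if i < size s then i else size s + phi (i - size s)).
split=> [i j ij|i x].
  case: (ltnP j (size s)) => js; first by rewrite (ltn_trans ij js).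
  case: (ltnP i (size s)) => si; first exact: leq_trans (leq_addr _ _).
  by rewrite ltn_add2l; apply: mono; lia.
case: (ltnP i (size s)) => si; first by rewrite !letter_prepend_l.
by rewrite -{1}(subnKC si) !letter_prepend_r; exact: H.
Qed.

Lemma subword_prepend s w Us k :
  subword_from Us (prepend s w) (size s + k) -> subword_from Us w k.
Proof.
elim: Us k => // U Us IH k [i [ki [x wx Ux] H]].
have iE : i = size s + (i - size s) by lia.
exists (i - size s); split; first by lia.
  by exists x => //; move: wx; rewrite iE letter_prepend_r; congr (letter _ _ = _); lia.
by apply: IH; rewrite addnS -iE.
Qed.

(** Removes the factorisation from the definition: in an infinite word, some finite prefix already
    contains the pattern [Us], and a finite word has no letter at arbitrarily late positions. *)
Lemma subword_inf_setE Us U w : subword_inf_set Us U w <->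
  subword_set Us w /\ forall n, exists2 i, n <= i & letter_in U w i.
Proof.
split=> [[u [w' [uUs -> wU]]]|[wUs wU]].
  split; first exact: (embeds_subword (embeds_prefix u w') uUs).
  move=> n; have [i ni Ui] := wU n; exists (size u + i); first exact: leq_trans (leq_addl _ _).
  exact: embeds_letter_in (embeds_prepend u w') Ui.
case: w wUs wU => [s _ sU|f fUs fU].
  by have [i si [x]] := sU (size s); rewrite /= onth_default.
(* All sufficiently long prefixes are required to contain the pattern, so that the induction may
   take a maximum of two bounds. *)
have [N fin] : exists N, forall M, N <= M -> subword_from Us (Fin (mkseq f M)) 0.
  move: fUs; rewrite /subword_set /=; elim: Us 0 => [|V Us IH] k; first by exists 0.
  move=> [i [ki [x [<-] Vx] /IH[N H]]]; exists (maxn i.+1 N) => M.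
  rewrite geq_max => /andP[iM NM]; exists i; split=> //; last exact: H.
  by exists (f i) => //=; rewrite onthE (nth_map (f i)) ?size_mkseq // nth_mkseq.
exists (mkseq f N), (Inf (fun i => f (N + i))); split.
- exact: fin.
- rewrite /= /prepend_inf; congr Inf; apply/funext => i; rewrite size_mkseq.
  case: (ltnP i N) => iN; first by rewrite nth_mkseq.
  by rewrite nth_default ?size_mkseq // subnKC.
- move=> n; have [i ni [_ [<-] Ux]] := fU (N + n); exists (i - N); first by lia.
  by exists (f i) => //=; rewrite subnKC //; lia.
Qed.

End Letters.

Section Topology.
Variable X : topologicalType.
Local Notation Y := (fin_inf_words X).
Implicit Types (w : word X) (s : seq X) (U V : set X) (Us : seq (set X)).
Implicit Types (A B : set Y).

Lemma open_wordsP A : open A <-> forall w, A w ->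
  exists F : {fset (set (word X))}, [/\ {subset F <= @asymptotic_subbase X},
    (forall W, W \in F -> W w) &
    forall w', (forall W, W \in F -> W w') -> A w'].
Proof.
split=> [[D DF <-] w [B DB Bw]|H].
  have [F FD BE] := DF _ DB; exists F; split=> //.
    by move=> W WF; move: Bw; rewrite -BE; apply.
  by move=> w' Fw'; exists B => //; rewrite -BE.
have -> : A = \bigcup_(B in [set B | open B /\ B `<=` A]) B.
  apply/seteqP; split=> [w /H[F [FD Fw FA]]|w [B [_ BA] /BA]//].
  exists (\bigcap_(W in [set` F]) W); last by move=> W WF; exact: Fw.
  split; last by move=> w' Fw'; apply: FA => W WF; exact: Fw'.
  exists [set \bigcap_(W in [set` F]) W]; first by move=> _ ->; exists F.
  by rewrite bigcup_set1.
by apply: bigcup_open => B [].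
Qed.

Lemma subbase_open A : @asymptotic_subbase X A -> open A.
Proof.
move=> AS; apply/open_wordsP => w Aw; exists [fset A]%fset; split.
- by move=> W /fset1P->; rewrite inE.
- by move=> W /fset1P->.
- by move=> w'; apply; rewrite inE.
Qed.

(** Subbasic sets only demand letters in a given order or infinitely many letters of a kind, and
    both demands survive the insertion of further letters. *)
Lemma open_embeds phi w w' A : open A -> embeds phi w w' -> A w -> A w'.
Proof.
move=> /open_wordsP oA ww' /oA[F [FD Fw FA]]; apply: FA => W WF.
have /FD := WF; rewrite inE => -[Us _ [WE|[U _ WE]]]; have := Fw W WF; rewrite WE.
  by move=> /(embeds_subword ww'); exact: subword_from_le.
move=> /subword_inf_setE[wUs wU]; apply/subword_inf_setE; split.
  by apply: subword_from_le (embeds_subword ww' wUs).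
move=> n; have [i ni Ui] := wU n; exists (phi i); last exact: embeds_letter_in Ui.
(* An increasing [phi] satisfies [i <= phi i], so images of late positions are late. *)
have [mono _] := ww'; apply: (leq_trans ni).
by elim: i {ni Ui} => // i IH; exact: leq_ltn_trans IH (mono _ _ _).
Qed.

Lemma open_nil A w : open A -> A (Fin [::]) -> A w.
Proof. by move=> oA; apply: (@open_embeds id) => //; split=> // i x; case: i. Qed.

Lemma open_prepend A s w : open A -> A w -> A (prepend s w).
Proof. by move=> oA; apply: open_embeds oA (embeds_prepend s w). Qed.

Lemma subword_cons x w U Us : subword_set (U :: Us) (prepend [:: x] w) <->
  (U x /\ subword_set Us w) \/ subword_set (U :: Us) w.
Proof.
split=> [[[|i] [_ [y xy Uy] H]]|[[Ux wUs]|wUs]].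
- left; move: xy; rewrite letter_prepend_l //= => -[->]; split=> //.
  by apply: (@subword_prepend _ [:: x]); rewrite addn0.
- right; exists i; split=> //; first by exists y => //; rewrite -(letter_prepend_r [:: x]).
  by apply: (@subword_prepend _ [:: x]).
- exists 0; split=> //; first by exists x; rewrite // letter_prepend_l.
  by have := embeds_subword (embeds_prepend [:: x] w) wUs; rewrite addn0.
- by have := embeds_subword (embeds_prepend [:: x] w) wUs; exact: subword_from_le.
Qed.

Lemma infinitely_prepend s w U :
  (forall n, exists2 i, n <= i & letter_in U (prepend s w) i) <->
  (forall n, exists2 i, n <= i & letter_in U w i).
Proof.
split=> H n.
  have [i ni [x wx Ux]] := H (size s + n); exists (i - size s); first by lia.
  by exists x => //; rewrite -(letter_prepend_r s) subnKC //; lia.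
have [i ni Ui] := H n; exists (size s + i); first exact: leq_trans (leq_addl _ _).
exact: embeds_letter_in (embeds_prepend s w) Ui.
Qed.

Lemma open_local (Z : topologicalType) (C : set Z) :
  (forall z, C z -> exists D, [/\ open D, D z & D `<=` C]) -> open C.
Proof.
move=> H; have -> : C = \bigcup_(D in [set D | open D /\ D `<=` C]) D.
  apply/seteqP; split=> [z /H[D [oD Dz DC]]|z [D [_ DC] /DC]//]; by exists D.
by apply: bigcup_open => D [].
Qed.

Lemma open_words_preimage (Z : topologicalType) (g : Z -> word X) A :
  (forall W, @asymptotic_subbase X W -> open (g @^-1` W)) ->
  open A -> open (g @^-1` A).
Proof.
move=> og /open_wordsP oA; apply: open_local => z /oA[F [FD Fz FA]].
exists [set z | forall W, W \in F -> W (g z)]; split=> //; last by move=> ? /FA.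
have : forall W, W \in (F : seq _) -> open (g @^-1` W).
  by move=> W /FD; rewrite inE => /og.
have -> : [set z | forall W, W \in F -> W (g z)] =
  [set z | forall W, W \in (F : seq _) -> W (g z)] by [].
elim: (F : seq _) => [|W t IH] ot.
  by rewrite (_ : mkset _ = setT); [exact: openT|apply/seteqP; split].
rewrite (_ : mkset _ = (g @^-1` W) `&` [set z | forall W, W \in t -> W (g z)]).
  apply: openI; first by apply: ot; rewrite mem_head.
  by apply: IH => V Vt; apply: ot; rewrite in_cons Vt orbT.
apply/seteqP; split=> [y Hy|y [gW Hy] V].
  by split=> [|V Vt]; apply: Hy; rewrite in_cons ?eqxx // Vt orbT.
by rewrite in_cons => /predU1P[->//|/Hy].
Qed.

(** One letter [x] at a time: it either matches the first set of the pattern, which is then dropped,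
    or it does not, and the pattern is unchanged. The preimage of a subbasic set is again
    subbasic. *)
Lemma open_prepend_preimage s A : open A -> open (prepend s @^-1` A : set Y).
Proof.
elim: s A => [|x s IH] A oA.
  rewrite (_ : _ @^-1` _ = A) //; apply/seteqP.
  by split=> w; rewrite /preimage /= prepend_nil.
rewrite (_ : _ @^-1` _ = prepend s @^-1` (prepend [:: x] @^-1` A)); last first.
  by apply/seteqP; split=> w; rewrite /preimage /= -prepend_cat.
apply: IH; apply: open_words_preimage oA => W [Us oUs].
have tl V Us' : {in V :: Us', forall U, open U} -> {in Us', forall U, open U}.
  by move=> H U UUs'; apply: H; rewrite in_cons UUs' orbT.
case: Us oUs => [|V Us] oUs [->|[U oU ->]].
- by rewrite (_ : _ @^-1` _ = setT); [exact: openT|apply/seteqP; split].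
- rewrite (_ : _ @^-1` _ = subword_inf_set [::] U).
    by apply: subbase_open; exists [::] => //; right; exists U.
  by apply/seteqP; split=> w /subword_inf_setE[_ H]; apply/subword_inf_setE; split=> //;
    apply/(infinitely_prepend [:: x]).
- have [Vx|nVx] := pselect (V x).
    rewrite (_ : _ @^-1` _ = subword_set Us).
      by apply: subbase_open; exists Us; [exact: tl oUs|left].
    apply/seteqP; split=> w; last by move=> wUs; apply/subword_cons; left.
    by move=> /subword_cons[[]//|/subword_tail].
  rewrite (_ : _ @^-1` _ = subword_set (V :: Us)).
    by apply: subbase_open; exists (V :: Us) => //; left.
  apply/seteqP; split=> w; last by move=> wUs; apply/subword_cons; right.
  by move=> /subword_cons[[]//|].
- have [Vx|nVx] := pselect (V x).
    rewrite (_ : _ @^-1` _ = subword_inf_set Us U).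
      by apply: subbase_open; exists Us; [exact: tl oUs|right; exists U].
    apply/seteqP; split=> w /subword_inf_setE[wUs H]; apply/subword_inf_setE.
      by split; [case/subword_cons: wUs => [[]//|/subword_tail]|
        exact: (proj1 (infinitely_prepend [:: x] w U) H)].
    by split; [apply/subword_cons; left|exact: (proj2 (infinitely_prepend [:: x] w U) H)].
  rewrite (_ : _ @^-1` _ = subword_inf_set (V :: Us) U).
    by apply: subbase_open; exists (V :: Us) => //; right; exists U.
  apply/seteqP; split=> w /subword_inf_setE[wUs H]; apply/subword_inf_setE.
    by split; [case/subword_cons: wUs => [[]//|]|exact: (proj1 (infinitely_prepend [:: x] w U) H)].
  by split; [apply/subword_cons; right|exact: (proj2 (infinitely_prepend [:: x] w U) H)].
Qed.

(** With the tail [w] fixed, the preimage of a pattern [V :: Us] is the whole space, [V] or the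
    empty set, according to how much of the pattern [w] contains. *)
Lemma open_head_preimage w A : open A -> open ((fun x => prepend [:: x] w) @^-1` A).
Proof.
apply: open_words_preimage => W [Us oUs].
have headP V Us' : open V -> open [set x | subword_set (V :: Us') (prepend [:: x] w)].
  move=> oV; have [wV|nwV] := pselect (subword_set (V :: Us') w).
    rewrite (_ : mkset _ = setT); first exact: openT.
    by apply/seteqP; split=> // x _; apply/subword_cons; right.
  have [wUs|nwUs] := pselect (subword_set Us' w).
    rewrite (_ : mkset _ = V) //; apply/seteqP; split=> x.
      by move=> /subword_cons[[]|].
    by move=> Vx; apply/subword_cons; left.
  rewrite (_ : mkset _ = set0); first exact: open0.
  by apply/seteqP; split=> x // /subword_cons[[]|].
have headP' : open [set x | subword_set Us (prepend [:: x] w)].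
  case: Us oUs => [|V Us] oUs; last by apply: headP; apply: oUs; rewrite mem_head.
  by rewrite (_ : mkset _ = setT); [exact: openT|apply/seteqP; split].
case=> [->//|[U oU ->]].
have [infU|ninfU] := pselect (forall n, exists2 i, n <= i & letter_in U w i).
  rewrite (_ : _ @^-1` _ = [set x | subword_set Us (prepend [:: x] w)]) //.
  apply/seteqP; split=> x; first by move=> /subword_inf_setE[].
  by move=> xUs; apply/subword_inf_setE; split=> //; apply/infinitely_prepend.
rewrite (_ : _ @^-1` _ = set0); first exact: open0.
by apply/seteqP; split=> x // /subword_inf_setE[_ /infinitely_prepend].
Qed.

(** * Irreducible languages *)

(** Irreducibility expressed by open sets. Non-emptiness is kept apart, so that [inf_words_over F]
    qualifies for every [F]. *)
Definition hyperconnected (Z : topologicalType) (L : set Z) : Prop :=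
  forall A B : set Z, open A -> open B -> L `&` A !=set0 -> L `&` B !=set0 ->
    L `&` (A `&` B) !=set0.

Lemma hyperconnectedP (Z : topologicalType) (L : set Z) :
  irreducible L <-> L !=set0 /\ hyperconnected L.
Proof.
split=> [[L0 irr]|[L0 hyp]]; split=> //.
  move=> A B oA oB [x [Lx Ax]] [y [Ly By]]; apply: contrapT => /forallNP H.
  have sub : L `<=` ~` A `|` ~` B by rewrite -setCI => z Lz AB; apply: (H z).
  have [H'|H'] := irr _ _ (open_closedC oA) (open_closedC oB) sub.
    exact: H' Lx Ax.
  exact: H' Ly By.
move=> C1 C2 cC1 cC2 LC; apply: contrapT => /not_orP[/nonsubset n1 /nonsubset n2].
have [z [Lz []]] := hyp _ _ (closed_openC cC1) (closed_openC cC2) n1 n2.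
by have [] := LC z Lz.
Qed.

Definition prefixed (D : set (seq X)) (L : set Y) : set Y :=
  [set w | exists s w', [/\ D s, w = prepend s w' & L w']].

Variables (S : choiceType) (sem : S -> set X).
Hypothesis irr_sem : forall a, irreducible (sem a).

(** For [a^?], a missing letter can be inserted, so both open sets are met by words starting in
    [sem a]; irreducibility gives a common first letter, then [L] a common tail. For [u^*], the two
    prefixes are concatenated, and each open set tolerates the insertion of the other's prefix. *)
Lemma hyperconnected_atom (D : atom S) (L : set Y) : hyperconnected L ->
  hyperconnected (prefixed (sem_atom sem D) L).
Proof.
case: D => [a|u] hypL A B oA oB.
  have one A0 : open A0 -> prefixed (sem_atom sem (Opt a)) L `&` A0 !=set0 ->
      exists x w', [/\ sem a x, L w' & A0 (prepend [:: x] w')].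
    move=> oA0 [_ [[s [w' [Ds -> Lw']]]]].
    case: Ds => [->|[x ax ->]]; last by exists x, w'.
    rewrite prepend_nil => A0w; have [_ ] := irr_sem a; have [[x ax] _ _] := irr_sem a.
    by exists x, w'; split=> //; exact: open_prepend.
  move=> /(one _ oA)[x [v [ax Lv Ax]]] /(one _ oB)[y [w [ay Lw By]]].
  have [_ hypa] := proj1 (hyperconnectedP _) (irr_sem a).
  have [z [az [Az Bz]]] := hypa _ _ (open_head_preimage v oA) (open_head_preimage w oB)
    (ex_intro _ x (conj ax Ax)) (ex_intro _ y (conj ay By)).
  have [t [Lt [At Bt]]] := hypL _ _ (open_prepend_preimage [:: z] oA)
    (open_prepend_preimage [:: z] oB) (ex_intro _ v (conj Lv Az)) (ex_intro _ w (conj Lw Bz)).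
  exists (prepend [:: z] t); split=> //; exists [:: z], t; split=> //.
  by right; exists z.
move=> [_ [[s1 [v [us1 -> Lv]] Av]]] [_ [[s2 [w [us2 -> Lw]] Bw]]].
have Av' : (prepend (s1 ++ s2) @^-1` A) v.
  rewrite /preimage /= prepend_cat.
  by have [psi] := embeds_prependl s1 (embeds_prepend s2 v); move/(open_embeds oA); exact.
have Bw' : (prepend (s1 ++ s2) @^-1` B) w.
  by rewrite /preimage /= prepend_cat; exact: open_prepend.
have [t [Lt [At Bt]]] := hypL _ _ (open_prepend_preimage (s1 ++ s2) oA)
  (open_prepend_preimage (s1 ++ s2) oB) (ex_intro _ v (conj Lv Av')) (ex_intro _ w (conj Lw Bw')).
exists (prepend (s1 ++ s2) t); split=> //; exists (s1 ++ s2), t; split=> //.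
by move=> x; rewrite mem_cat => /orP[/us1|/us2].
Qed.

Lemma prefixed_cons (D : atom S) P (L : set Y) :
  prefixed (sem_product sem (D :: P)) L =
  prefixed (sem_atom sem D) (prefixed (sem_product sem P) L).
Proof.
apply/seteqP; split=> w.
  move=> [_ [w' [[s1 [s2 [Ds1 Ps2 ->]]] -> Lw']]].
  by exists s1, (prepend s2 w'); rewrite -prepend_cat; split=> //; exists s2, w'.
move=> [s1 [_ [Ds1 -> [s2 [w' [Ps2 -> Lw']]]]]].
by exists (s1 ++ s2), w'; rewrite prepend_cat; split=> //; exists s1, s2.
Qed.

Lemma hyperconnected_prefixed P (L : set Y) : hyperconnected L ->
  hyperconnected (prefixed (sem_product sem P) L).
Proof.
move=> hypL; elim: P => [|D P IH]; last by rewrite prefixed_cons; exact: hyperconnected_atom.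
rewrite (_ : prefixed _ _ = L) //; apply/seteqP; split=> w.
  by move=> [s [w' [sE -> Lw]]]; rewrite (sE : s = [::]) prepend_nil.
by exists [::], w; rewrite prepend_nil.
Qed.

Definition words_over (F : set X) : set Y := [set w | forall i x, letter w i = Some x -> F x].

Definition inf_words_over (F : set X) : set Y :=
  [set w | exists2 g, w = Inf g & forall i, F (g i)].

(** The two infinite words are interleaved, [f] on even and [g] on odd positions; both embed into
    the result. *)
Lemma hyperconnected_inf_words_over F : hyperconnected (inf_words_over F).
Proof.
move=> A B oA oB [_ [[f -> Ff] Af]] [_ [[g -> Fg] Bg]].
pose h n := if odd n then g n./2 else f n./2.
exists (Inf h); split; first by exists h => // i; rewrite /h; case: odd.
split.
  apply: (open_embeds (phi := fun i => i.*2)) oA _ Af.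
  split=> [i j|i x /= [<-]]; first by rewrite ltn_double.
  by rewrite /h odd_double doubleK.
apply: (open_embeds (phi := fun i => i.*2.+1)) oB _ Bg.
split=> [i j|i x /= [<-]]; first by rewrite ltnS ltn_double.
by rewrite /h /= odd_double /= uphalf_double.
Qed.

Lemma hyperconnected_words_over F : hyperconnected (words_over F).
Proof.
have fin (A B : set Y) s w : open A -> open B -> words_over F (Fin s) -> words_over F w ->
    A (Fin s) -> B w -> words_over F `&` (A `&` B) !=set0.
  move=> oA oB Fs Fw As Bw; exists (prepend s w); split; last split.
  - move=> i x; case: (ltnP i (size s)) => si; first by rewrite letter_prepend_l //; exact: Fs.
    by rewrite -(subnKC si) letter_prepend_r; exact: Fw.
  (* The words that continue [s] into [A] form an open set containing the empty word, hence all
     words. *)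
  - have := @open_nil _ w (open_prepend_preimage s oA).
    by rewrite /preimage /= cats0; apply.
  - exact: open_prepend.
move=> A B oA oB [[s|f] [Ff Af]] [w [Fw Bw]]; first exact: fin Ff Fw Af Bw.
case: w Fw Bw => [s|g] Fw Bw.
  by have [v [Fv [Bv Av]]] := fin _ _ _ _ oB oA Fw Ff Bw Af; exists v.
have [v [[h -> Fh] ABv]] := @hyperconnected_inf_words_over F A B oA oB
  (ex_intro _ (Inf f) (conj (ex_intro2 _ _ f erefl (fun i => Ff i _ erefl)) Af))
  (ex_intro _ (Inf g) (conj (ex_intro2 _ _ g erefl (fun i => Fw i _ erefl)) Bw)).
by exists (Inf h); split=> // i x [<-].
Qed.

End Topology.

(** * Factorisations of words *)

Section WordSplit.
Variable X : topologicalType.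
Implicit Types (w : word X) (s : seq X) (U F : set X) (Us : seq (set X)).

Lemma letter_split w i x : letter w i = Some x ->
  exists s w', w = prepend s (prepend [:: x] w') /\ size s = i.
Proof.
case: w => [t|f] /= tx.
  have it : i < size t by rewrite ltnNge; apply/negP => le; rewrite onth_default in tx.
  exists (take i t), (Fin (drop i.+1 t)); split; last by rewrite size_takel // ltnW.
  rewrite /= -{1}(cat_take_drop i t) (drop_nth x it); congr (Fin (_ ++ _ :: _)).
  by move: tx; rewrite onthE (nth_map x) // => -[].
exists (mkseq f i), (Inf (fun j => f (i.+1 + j))); split; last by rewrite size_mkseq.
rewrite /= /prepend_inf /=; congr Inf; apply/funext => j; rewrite size_mkseq.
case: (ltnP j i) => ji; first by rewrite nth_mkseq.
rewrite nth_default ?size_mkseq //; case: tx => <-.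
by case E : (j - i) => [|k] /=; rewrite ?nth_nil; congr f; lia.
Qed.

Lemma words_overP F s w : words_over F (prepend s w) <->
  {in s, forall x, F x} /\ words_over F w.
Proof.
split=> [H|[Fs Fw] i x].
  split=> [x xs|i x wx]; last by apply: (H (size s + i)); rewrite letter_prepend_r.
  apply: (H (index x s)); rewrite letter_prepend_l ?index_mem //.
  by rewrite onthE (nth_map x) ?index_mem // nth_index.
case: (ltnP i (size s)) => si.
  rewrite letter_prepend_l // onthE (nth_map x) // => -[<-].
  by apply: Fs; exact: mem_nth.
by rewrite -(subnKC si) letter_prepend_r; exact: Fw.
Qed.

Lemma word_split U w : (forall n, exists2 i, n <= i & letter_in U w i) \/
  exists s w', w = prepend s w' /\ words_over (~` U) w'.
Proof.
have [H|/existsNP[n H]] := pselect (forall n, exists2 i, n <= i & letter_in U w i).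
  by left.
right; have Hn i x : n <= i -> letter w i = Some x -> ~ U x.
  by move=> ni wx Ux; apply: H; exists i => //; exists x.
case: w {H} Hn => [s|f] Hn; first by exists s, (Fin [::]); rewrite /= cats0; split=> // -[].
exists (mkseq f n), (Inf (fun i => f (n + i))); split.
  rewrite /= /prepend_inf; congr Inf; apply/funext => i; rewrite size_mkseq.
  case: (ltnP i n) => iN; first by rewrite nth_mkseq.
  by rewrite nth_default ?size_mkseq // subnKC.
by move=> i x [<-]; apply: (Hn (n + i)) => //; exact: leq_addr.
Qed.

Lemma subword_avoid F U Us s w : {in s, forall x, ~ U x} ->
  subword_set (U :: Us) (prepend s w) -> subword_set (U :: Us) w.
Proof.
elim: s => [|x s IH] Fs; first by rewrite prepend_nil.
rewrite (prepend_cat [:: x] s) => /subword_cons[[]|].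
  by move=> /(Fs _ (mem_head _ _)).
by apply: IH => y ys; apply: Fs; rewrite in_cons ys orbT.
Qed.

(* The first letter of the pattern is made to avoid [C]. *)
Lemma subword_sharpen C Us x s : closed C -> ~ C x -> {in Us, forall U, open U} ->
  subword_set Us (Fin (x :: s)) -> exists Vs, [/\ {in Vs, forall U, open U},
    subword_set Vs (Fin (x :: s)),
    subword_set Vs `<=` subword_set Us &
    forall t w, {in t, forall y, C y} -> subword_set Vs (prepend t w) -> subword_set Vs w].
Proof.
move=> cC nCx; case: Us => [|U Us] oUs; first by exists [::].
have oU : open U by apply: oUs; rewrite mem_head.
have oUs' : {in Us, forall V, open V} by move=> V VUs; apply: oUs; rewrite in_cons VUs orbT.
move=> /(@subword_cons _ x (Fin s))[[Ux sUs]|sUs].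
  exists ((U `&` ~` C) :: Us); split.
  - move=> V; rewrite in_cons => /predU1P[->|/oUs' //].
    by apply: openI => //; exact: closed_openC.
  - by apply/(@subword_cons _ x (Fin s)); left.
  - by move=> w [i [_ [y wy [Uy _]] H]]; exists i; split=> //; exists y.
  - by move=> t w Ct; apply: (@subword_avoid C) => y /Ct Cy [].
exists (~` C :: U :: Us); split.
- by move=> V; rewrite in_cons => /predU1P[->|/oUs //]; exact: closed_openC.
- by apply/(@subword_cons _ x (Fin s)); left.
- by move=> w; exact: subword_tail.
- by move=> t w Ct; apply: (@subword_avoid C) => y /Ct Cy.
Qed.

End WordSplit.

(** * Closedness of the languages and complements of subbasic sets *)

Section Pairs.
Variables (X : topologicalType) (S : choiceType) (code : S -> nat).
Variables (sem : S -> set X) (le : rel S) (tau : {fset S}).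
Variable meet : S -> S -> {fset S}.
Hypothesis HS : S_representation code sem le tau meet.
Implicit Types (P Q R T : product S) (u v : {fset S}) (s : seq X) (w : word X).
Implicit Types (Us : seq (set X)) (U : set X).
Implicit Types (c d : product S * {fset S}).
Local Notation semP := (sem_product sem).
Local Notation semF := (sem_fset sem).
Local Notation K := (sem_fin_inf sem).

Lemma sem_fin_infE c : K c = prefixed (semP c.1) (words_over (semF c.2)).
Proof. by []. Qed.

Lemma sem_fin_inf_separation P u s : ~ semP (with_star P u) s ->
  exists Us, [/\ {in Us, forall U, open U}, subword_set Us (Fin s) &
    forall w, subword_set Us w -> ~ K (P, u) w].
Proof.
elim: P s => [|[a|v] P IH] s ns.
- have [x xs nux] : exists2 x, x \in s & ~ semF u x.
    apply: contrapT => H; apply: ns; apply/sem_product_with_star; exists [::], s; split=> //.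
    by move=> x xs; apply: contrapT => nux; apply: H; exists x.
  exists [:: ~` semF u]; split.
  + by move=> U; rewrite inE => /eqP->; exact/closed_openC/(closed_sem_fset HS).
  + exists (index x s); split=> //; exists x => //=.
    by rewrite onthE (nth_map x) ?index_mem // nth_index.
  + move=> w [i [_ [y wy nuy] _]] [t [w' [tE wE uw']]].
    by apply: nuy; apply: (uw' i); move: wy; rewrite wE (tE : t = [::]) prepend_nil.
- case: s ns => [[]|x s ns]; first exact: sem_product_nil.
  have ns1 : ~ semP (with_star P u) (x :: s).
    by move=> H; apply: ns; apply/sem_product_Opt; left.
  have [ax|nax] := pselect (sem a x).
    have [Us [oUs sUs H]] := IH s (fun H => ns (proj2 (sem_product_Opt sem a _ _)
      (or_intror (ex_intro _ x (ex_intro _ s (And3 erefl ax H)))))).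
    (* The entry [setT] uses up the only letter that [a^?] can provide; the rest of the word must
       then contain [Us]. *)
    exists (setT :: Us); split.
    + by move=> U; rewrite in_cons => /predU1P[->|/oUs //]; exact: openT.
    + by apply/(@subword_cons _ x (Fin s)); left.
    + move=> w wUs; rewrite sem_fin_infE prefixed_cons => -[t [w' [Dt wE Kw']]].
      move: wUs; rewrite {}wE => wUs; apply: (H w') => //.
      case: Dt wUs => [->|[y _ ->]]; first by rewrite prepend_nil => /subword_tail.
      by move=> /subword_cons[[]|/subword_tail].
  have [Us [oUs sUs H]] := IH _ ns1.
  have [Vs [oVs sVs VU avoid]] := subword_sharpen (@closed_sem _ _ _ _ _ _ _ HS a) nax oUs sUs.
  exists Vs; split=> // w wVs; rewrite sem_fin_infE prefixed_cons => -[t [w' [Dt wE Kw']]].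
  apply: (H w') => //; apply: VU; apply: (avoid t); last by rewrite -wE.
  by case: Dt => [-> //|[y ay ->] z]; rewrite inE => /eqP->.
- elim: s ns => [[]|x s IHs ns]; first exact: sem_product_nil.
  have ns1 : ~ semP (with_star P u) (x :: s).
    by move=> H; apply: ns; apply/sem_product_Star; left.
  have [vx|nvx] := pselect (semF v x).
    have [|Us [oUs sUs H]] := IHs.
      by move=> H; apply: ns; apply/sem_product_Star; right; exists x, s.
    exists Us; split=> //.
    have := embeds_subword (embeds_prepend [:: x] (Fin s)) sUs.
    exact: subword_from_le.
  have [Us [oUs sUs H]] := IH _ ns1.
  have [Vs [oVs sVs VU avoid]] := subword_sharpen (@closed_sem_fset _ _ _ _ _ _ _ HS v) nvx oUs sUs.
  exists Vs; split=> // w wVs; rewrite sem_fin_infE prefixed_cons => -[t [w' [Dt wE Kw']]].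
  by apply: (H w') => //; apply: VU; apply: (avoid t) => //; rewrite -wE.
Qed.

Lemma sem_fin_inf_with_star c s w : semP (with_star c.1 c.2) s ->
  words_over (semF c.2) w -> K c (prepend s w).
Proof.
move=> /sem_product_with_star[s1 [s2 [Ps1 us2 ->]]] uw.
exists s1, (prepend s2 w); rewrite prepend_cat; split=> //.
exact/words_overP.
Qed.

Lemma closed_sem_fin_inf c : closed (K c : set (fin_inf_words X)).
Proof.
case: c => P u; rewrite -[X in closed X]setCK; apply: open_closedC; apply: open_local => w nKw.
have oFu : open (~` semF u) by exact/closed_openC/(closed_sem_fset HS).
have [inf|[s [w' [wE uw']]]] := word_split (~` semF u) w.
  exists (subword_inf_set [::] (~` semF u)); split.
  - by apply: subbase_open; exists [::] => //; right; exists (~` semF u).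
  - exact/subword_inf_setE.
  - move=> v /subword_inf_setE[_ infv] [s [w' [_ vE uw']]].
    move: infv; rewrite vE => /infinitely_prepend /(_ 0)[i _ [x wx]]; apply.
    exact: uw' wx.
have [|Us [oUs sUs H]] := @sem_fin_inf_separation P u s.
  move=> Ps; apply: nKw; rewrite wE; apply: sem_fin_inf_with_star => //.
  by move: uw'; rewrite setCK.
exists (subword_set Us); split.
- by apply: subbase_open; exists Us => //; left.
- by rewrite wE; exact: (embeds_subword (embeds_prefix s w')).
- exact: H.
Qed.

Lemma tau_setT x : semF tau x.
Proof. by have : [set: X] x by []; rewrite (srep_tauP HS). Qed.

(** A word misses [U :: Us] if it has no letter in [U], or if the part after its first such letter
    misses [Us]. With [u] denoting the complement of [U], this gives the products [u^* a^? c], where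
    [a] runs over the cover [tau]. *)
Lemma subword_set_complement Us : {in Us, forall U, open U} ->
  exists t, ~` subword_set Us = finite_union K t.
Proof.
elim: Us => [|U Us IH] oUs.
  by exists [::]; rewrite finite_union_nil; apply/seteqP; split=> // w; apply.
have [t tE] : exists t, ~` subword_set Us = finite_union K t.
  by apply: IH => V VUs; apply: oUs; rewrite in_cons VUs orbT.
have cU : closed (~` U) by apply: open_closedC; apply: oUs; rewrite mem_head.
have [u uE] := closed_is_sem_fset HS cU.
exists (([::], u) :: [seq (Star u :: Opt a :: c.1, c.2) | c <- t, a <- tau]).
rewrite finite_union_cons; apply/seteqP; split=> w.
  move=> nw; have [Uw|nUw] := pselect (exists i, `[< letter_in U w i >]); last first.
    left; exists [::], w; rewrite prepend_nil; split=> // i x wx; rewrite -uE => Ux.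
    by apply: nUw; exists i; apply/asboolP; exists x.
  right; have [i /asboolP[x wx Ux] imin] := ex_minnP Uw.
  have [s [w' [wE si]]] := letter_split wx.
  have nw' : (~` subword_set Us) w'.
    move=> w'Us; apply: nw; rewrite wE.
    have xw' : subword_set (U :: Us) (prepend [:: x] w') by apply/subword_cons; left.
    exact: subword_from_le (embeds_subword (embeds_prepend s _) xw').
  move: nw'; rewrite tE => -[c ct Kw'].
  have [a atau ax] := tau_setT x.
  exists (Star u :: Opt a :: c.1, c.2); first by apply/allpairsP; exists (c, a).
  rewrite sem_fin_infE !prefixed_cons; exists s, (prepend [:: x] w'); split=> //.
    move=> y ys; rewrite -uE => Uy.
    have : index y s < i by rewrite -si index_mem.
    rewrite ltnNge => /negP; apply; apply: imin; apply/asboolP; exists y => //.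
    by rewrite wE letter_prepend_l ?index_mem // onthE (nth_map y) ?index_mem // nth_index.
  by exists [:: x], w'; split=> //; right; exists x.
case=> [[s [w' [sE -> uw']]]|[_ /allpairsP[[c a] [/= ct atau ->]]]].
  rewrite (sE : s = [::]) prepend_nil => -[i [_ [x wx Ux] _]].
  by have := uw' i x wx; rewrite -uE; apply.
rewrite sem_fin_infE !prefixed_cons.
move=> [s [_ [us -> [s' [w' [as' -> Kw']]]]]] /(@subword_avoid _ setT) H.
have nw' : (~` subword_set Us) w' by rewrite tE; exists c.
apply: nw'; have {}H : subword_set (U :: Us) (prepend s' w').
  by apply: H => y /us; rewrite -uE.
case: as' H => [->|[x _ ->]]; first by rewrite prepend_nil => /subword_tail.
by move=> /subword_cons[[]|/subword_tail].
Qed.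

(** Beyond the words that miss [Us], these are the words that eventually avoid [U]: an arbitrary
    prefix, expressed by [tau^*], followed by letters outside [U]. *)
Lemma subword_inf_set_complement Us U : {in Us, forall V, open V} -> open U ->
  exists t, ~` subword_inf_set Us U = finite_union K t.
Proof.
move=> oUs oU; have [t tE] := subword_set_complement oUs.
have [u uE] := closed_is_sem_fset HS (open_closedC oU).
exists (([:: Star tau], u) :: t); rewrite finite_union_cons -tE.
apply/seteqP; split=> w.
  move=> nw; have [inf|[s [w' [-> Uw']]]] := word_split U w.
    by right => wUs; apply: nw; apply/subword_inf_setE.
  left; exists s, w'; rewrite -uE; split=> //.
  apply/(@sem_product_with_star _ _ sem [::] tau).
  by exists [::], s; split=> // x _; exact: tau_setT.
move=> H /subword_inf_setE[wUs inf]; case: H => [[s [w' [_ wE uw']]]|//].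
move: inf; rewrite wE => /infinitely_prepend/(_ 0)[i _ [x /uw']].
by rewrite -uE.
Qed.

Lemma closed_words_separation (C : set (fin_inf_words X)) w : closed C -> ~ C w ->
  exists t, C `<=` finite_union K t /\ ~ finite_union K t w.
Proof.
move=> /closed_openC/open_wordsP oC /oC[F [FD Fw FC]].
have [t tE] : exists t, finite_union (fun W : set (word X) => ~` W) F = finite_union K t.
  apply: finite_union_bigcup => W /FD; rewrite inE => -[Us oUs [->|[U oU ->]]].
    exact: subword_set_complement.
  exact: subword_inf_set_complement.
exists t; rewrite -tE; split=> [v Cv|[W /Fw Ww]]; last exact.
by apply: contrapT => H; apply: (FC v) Cv => W WF; apply: contrapT => nWv; apply: H; exists W.
Qed.

End Pairs.

(** * Inclusions and intersections of the languages of pairs *)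

Section Prepend.
Variable X : Type.
Implicit Types (s t : seq X) (w v : word X) (f g : nat -> X).

Lemma prepend1_inj x y v w : prepend [:: x] v = prepend [:: y] w -> x = y /\ v = w.
Proof.
case: v w => [s|f] [t|g] //= [] // E; first by move=> ->.
split; first exact: (congr1 (@^~ 0) E).
congr Inf; apply/funext => i; have := congr1 (@^~ i.+1) E.
by rewrite /prepend_inf /= !nth_nil !subn1.
Qed.

Lemma prepend_eq s t v w : size s <= size t -> prepend s v = prepend t w ->
  exists r, t = s ++ r /\ v = prepend r w.
Proof.
elim: s t => [|x s IH] [|y t] // st; rewrite ?prepend_nil; try by exists (y :: t).
  by exists [::]; rewrite prepend_nil.
rewrite (prepend_cat [:: x]) (prepend_cat [:: y]) => /prepend1_inj[-> /IH[//|r [-> ->]]].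
by exists r.
Qed.

Lemma mkseq_prepend_inf s g n : mkseq (prepend_inf s g) (size s + n) = s ++ mkseq g n.
Proof.
apply: (@eq_from_nth _ (g 0)); first by rewrite size_cat !size_mkseq.
move=> i; rewrite size_mkseq => i_lt; rewrite nth_mkseq // nth_cat /prepend_inf.
case: ltnP => si; first exact: set_nth_default.
by rewrite nth_default // nth_mkseq //; lia.
Qed.

End Prepend.

Section Pairs.
Variables (X : topologicalType) (S : choiceType) (code : S -> nat).
Variables (sem : S -> set X) (le : rel S) (tau : {fset S}).
Variable meet : S -> S -> {fset S}.
Hypothesis HS : S_representation code sem le tau meet.
Implicit Types (P Q R T : product S) (u v : {fset S}) (s : seq X) (w : word X).
Implicit Types (c d : product S * {fset S}) (a b : product S * nonempty_fset S).
Local Notation semP := (sem_product sem).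
Local Notation semF := (sem_fset sem).
Local Notation K := (sem_fin_inf sem).
Local Notation Kinf := (sem_inf sem).
Local Notation ws c := (with_star c.1 c.2).

(** This is why the order and the meet of pairs are computed on products completed by
    [with_star]. *)
Lemma sem_fin_inf_Fin c s : K c (Fin s) <-> semP (ws c) s.
Proof.
split=> [[s1 [[s2|f] [Ps1 E us2]]]|Ps]; [case: E => ->|by []|]; last first.
  by rewrite -[s]cats0; apply: (@sem_fin_inf_with_star _ _ _ _ s (Fin [::])) => // -[].
apply/sem_product_with_star; exists s1, s2; split=> // x xs2; apply: (us2 (index x s2)).
by rewrite /= onthE (nth_map x) ?index_mem // nth_index.
Qed.

Lemma sem_fin_inf_Inf c f : K c (Inf f) <->
  exists s g, [/\ semP c.1 s, f = prepend_inf s g & forall i, semF c.2 (g i)].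
Proof.
split=> [[s [[t|g] [Ps E ug]]]|[s [g [Ps -> ug]]]]; first by [].
  by case: E => ->; exists s, g; split=> // i; exact: (ug i).
by exists s, (Inf g); split=> // i x [<-].
Qed.

(** Constant words isolate the second component: past its prefix, such a word still consists of
    [x]. *)
Lemma sem_fin_inf_const c x : K c (Inf (fun=> x)) <-> semF c.2 x.
Proof.
rewrite sem_fin_inf_Inf; split=> [[s [g [_ E ug]]]|ux].
  have := congr1 (@^~ (size s)) E; rewrite /prepend_inf nth_default // => ->.
  exact: ug.
exists [::], (fun=> x); split=> //; first exact: sem_product_nil.
by apply/funext => i; rewrite /prepend_inf nth_nil.
Qed.

Lemma sem_fin_inf_sub c d : K c `<=` K d <->
  semP (ws c) `<=` semP (ws d) /\ semF c.2 `<=` semF d.2.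
Proof.
split=> [cd|[PQ uv] w [s [w' [Ps -> uw']]]].
  split=> [s /sem_fin_inf_Fin/cd/sem_fin_inf_Fin//|x].
  by move=> /sem_fin_inf_const/cd/sem_fin_inf_const.
apply: sem_fin_inf_with_star; last by move=> i x /uw'; exact: uv.
apply/PQ/sem_product_with_star; exists s, [::]; rewrite cats0; split=> //.
Qed.

Lemma le_pairE c d : le_pair le c d <->
  semP (ws c) `<=` semP (ws d) /\ semF c.2 `<=` semF d.2.
Proof.
split=> [/andP[cd /(dominatedP HS)]|[cd uv]]; first by split=> //; exact: (le_product_sound HS).
apply/andP; split; last exact/(dominatedP HS).
by apply: (le_product_complete HS) => //; exact: starred_with_star.
Qed.

Lemma sem_infE a : Kinf a = @Inf X @^-1` K (forget_nonempty a).
Proof.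
apply/seteqP; split=> f; first by move=> H; apply/sem_fin_inf_Inf.
by move/sem_fin_inf_Inf.
Qed.

Lemma sem_fin_inf_mkseq c f n : K c (Inf f) -> semP (ws c) (mkseq f n).
Proof.
move=> /sem_fin_inf_Inf[s [g [Ps -> ug]]].
(* The prefix is lengthened by [size s], so as to contain [s] entirely, and cut back by downward
   closure. *)
apply: (@sem_product_prefix _ _ _ _ _ [seq prepend_inf s g i | i <- iota (0 + n) (size s)]).
rewrite -map_cat -iotaD addnC -/(mkseq _ _) mkseq_prepend_inf.
apply/sem_product_with_star; exists s, (mkseq g n); split=> // x /mapP[i _ ->]; exact: ug.
Qed.

(** Finite words being absent, [s] is tested through [s] followed by a letter [x] of the non-empty
    [a.2] repeated forever, whose prefix of length [size s] is [s]. *)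
Lemma sem_inf_sub a b : Kinf a `<=` Kinf b <->
  semP (ws (forget_nonempty a)) `<=` semP (ws (forget_nonempty b)) /\
  semF (val a.2) `<=` semF (val b.2).
Proof.
rewrite !sem_infE; split=> [ab|/sem_fin_inf_sub ab f]; last exact: ab.
have [x ux] := sem_fset_nonempty HS (valP a.2).
split=> [s Ps|y]; last first.
  move=> /(proj2 (sem_fin_inf_const (forget_nonempty a) y))/(ab (fun=> y)).
  by move/sem_fin_inf_const.
have : K (forget_nonempty a) (prepend s (Inf (fun=> x))).
  by apply: sem_fin_inf_with_star => // i y [<-].
move=> /(ab (prepend_inf s (fun=> x)))/(@sem_fin_inf_mkseq _ _ (size s + 0)).
by rewrite mkseq_prepend_inf /= cats0.
Qed.

(** The longer of the two prefixes serves both pairs: the letters it takes from the other tail are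
    absorbed by the star added to the other product. *)
Lemma sem_fin_infI c d w : K c w -> K d w -> exists s w',
  [/\ w = prepend s w', semP (ws c) s, semP (ws d) s &
    words_over (semF c.2) w' /\ words_over (semF d.2) w'].
Proof.
have star e s : semP e.1 s -> semP (ws e) s.
  by move=> Ps; apply/sem_product_with_star; exists s, [::]; rewrite cats0.
have main e1 e2 s1 s2 w1 w2 : size s1 <= size s2 -> prepend s1 w1 = prepend s2 w2 ->
    semP e1.1 s1 -> semP e2.1 s2 -> words_over (semF e1.2) w1 ->
    [/\ semP (ws e1) s2, semP (ws e2) s2 & words_over (semF e1.2) w2].
  move=> s12 /(prepend_eq s12)[r [-> ->]] Ps1 Ps2 /words_overP[ur uw2]; split=> //.
    by apply/sem_product_with_star; exists s1, r.
  exact: star.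
move=> [s1 [w1 [Ps1 wE1 uw1]]] [s2 [w2 [Ps2 wE2 uw2]]].
have E : prepend s1 w1 = prepend s2 w2 by rewrite -wE1.
have [le12|/ltnW le21] := leqP (size s1) (size s2).
  by have [H1 H2 H3] := main c d _ _ _ _ le12 E Ps1 Ps2 uw1; exists s2, w2.
by have [H1 H2 H3] := main d c _ _ _ _ le21 (esym E) Ps2 Ps1 uw2; exists s1, w1.
Qed.

Lemma without_lastK P u : without_last (with_star P u) = P.
Proof. by rewrite /without_last /with_star size_rcons -cats1 take_size_cat. Qed.

Lemma meet_pair_spec c d : meet_spec sem (meet_fset meet c.2 d.2)
  (semP (ws c) `&` semP (ws d)) (meet_product code le meet (ws c) (ws d)).
Proof. by apply: (meet_product_spec HS); [exists c.1|exists d.1]. Qed.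

(** A common factorisation reduces the intersection to that of the products for the prefix and that
    of the letter sets for the tail. *)
Lemma sem_meet_fin_inf c d : K c `&` K d =
  finite_union K (meet_fin_inf code le meet c d).
Proof.
have [form semM] := meet_pair_spec c d.
apply/seteqP; split=> [w [cw dw]|w [e /imfsetP[T /= TM ->]]].
  have [s [w' [-> cs ds [cw' dw']]]] := sem_fin_infI cw dw.
  have : (semP (ws c) `&` semP (ws d)) s by [].
  rewrite -semM => -[T TM Ts]; have [R TE] := form T TM.
  exists (without_last T, meet_fset meet c.2 d.2); first by apply/imfsetP; exists T.
  apply: sem_fin_inf_with_star; rewrite TE ?without_lastK -?TE //.
  by move=> i x wx; rewrite (sem_meet_fset HS); split; [exact: cw' wx|exact: dw' wx].
have [R TE] := form T TM; rewrite TE without_lastK => -[s [w' [Rs -> uw']]].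
have : sem_products sem (meet_product code le meet (ws c) (ws d)) s.
  by exists T => //; rewrite TE; apply/sem_product_with_star; exists s, [::]; rewrite cats0.
rewrite semM => -[cs ds]; split; apply: sem_fin_inf_with_star => // i x /uw';
  by rewrite (sem_meet_fset HS) => -[].
Qed.

Lemma sem_meet_inf a b : Kinf a `&` Kinf b =
  finite_union Kinf (meet_inf code le meet a b).
Proof.
have fE := forget_meet_inf code le meet a b.
apply/seteqP; split=> f.
  rewrite !sem_infE => -[af bf].
  have : (K (forget_nonempty a) `&` K (forget_nonempty b)) (Inf f) by [].
  rewrite sem_meet_fin_inf => -[e eM ef].
  have : e \in (@forget_nonempty S @` meet_inf code le meet a b)%fset.
    (* If the meet of the letter sets is empty, the pairs of [meet_fin_inf] contain no infinite
       word, in agreement with the empty value of [meet_inf]. *)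
    rewrite fE; case: ifPn => // /eqP M0.
    move: eM ef => /imfsetP[T _ ->] /sem_fin_inf_Inf[s [g [_ _ /(_ 0)]]].
    by rewrite /= M0 sem_fset0.
  by move=> /imfsetP[a' /= a'M eE]; exists a' => //; rewrite sem_infE /preimage /= -eE.
move=> [e eM]; rewrite !sem_infE => ef.
have : forget_nonempty e \in (@forget_nonempty S @` meet_inf code le meet a b)%fset.
  by apply/imfsetP; exists e.
rewrite fE; case: ifPn => // _ eM'.
suff : (K (forget_nonempty a) `&` K (forget_nonempty b)) (Inf f) by [].
by rewrite sem_meet_fin_inf; exists (forget_nonempty e).
Qed.

Lemma setT_fin_inf : [set: fin_inf_words X] = finite_union K (tau_fin_inf tau).
Proof.
apply/seteqP; split=> // w _; exists ([::], tau); first by rewrite inE.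
by exists [::], w; rewrite prepend_nil; split=> // i x _; exact: (tau_setT HS).
Qed.

Lemma setT_inf : [set: inf_words X] = finite_union Kinf (tau_inf tau).
Proof.
apply/seteqP; split=> // f _; rewrite /tau_inf; case: insubP => [t _ tE|].
  exists ([::], t); first by rewrite inE.
  rewrite sem_infE; exists [::], (Inf f); rewrite prepend_nil; split=> // i x _ /=.
  by rewrite tE; exact: (tau_setT HS).
rewrite negbK => /eqP t0; have := tau_setT HS (f 0).
by rewrite t0 sem_fset0.
Qed.

Lemma sem_fin_inf_wf : well_founded (fun c d => K c `<` K d).
Proof.
apply: (pair_wf HS) => c d [/sem_fin_inf_sub[PQ uv] ndc]; split=> // -[vu QP].
by apply: ndc; apply/sem_fin_inf_sub.
Qed.

Lemma sem_inf_wf : well_founded (fun a b => Kinf a `<` Kinf b).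
Proof.
(* The order is carried along [forget_nonempty] to all pairs, where [pair_wf] applies. *)
pose lt c d := exists a b, [/\ c = forget_nonempty a, d = forget_nonempty b & Kinf a `<` Kinf b].
have wf_lt : well_founded lt.
  apply: (pair_wf HS) => _ _ [a [b [-> -> [/sem_inf_sub[PQ uv] nba]]]].
  by split=> // -[vu QP]; apply: nba; apply/sem_inf_sub.
suff H c : Acc lt c -> forall a, c = forget_nonempty a ->
    Acc (fun a b => Kinf a `<` Kinf b) a.
  by move=> a; exact: (H _ (wf_lt (forget_nonempty a))).
elim=> {}c _ IH a cE; constructor => b ba.
have bc : lt (forget_nonempty b) c by exists b, a.
exact: (IH _ bc b erefl).
Qed.

Lemma irr_sem (i : S) : irreducible (sem i).
Proof. by have [] := srep_irreducible HS i. Qed.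

Lemma irreducible_closed_fin_inf c :
  irreducible_closed (K c : set (fin_inf_words X)).
Proof.
split; first exact: closed_sem_fin_inf HS c.
apply/hyperconnectedP; split.
  exists (Fin [::]); apply/sem_fin_inf_Fin; exact: sem_product_nil.
apply: (@hyperconnected_prefixed X S sem irr_sem c.1 (words_over (semF c.2))).
exact: hyperconnected_words_over.
Qed.

Lemma closed_sem_inf a : closed (Kinf a : set (inf_words X)).
Proof.
rewrite sem_infE -[X in closed X]setCK; apply: open_closedC.
exists (~` K (forget_nonempty a)) => //.
exact/closed_openC/(closed_sem_fin_inf HS).
Qed.

(** Open sets of infinite words are traces of open sets of all words, so the argument takes place in
    the larger space; the common word it yields is infinite because its tail is taken in
    [inf_words_over]. *)
Lemma irreducible_closed_inf a : irreducible_closed (Kinf a : set (inf_words X)).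
Proof.
split; first exact: closed_sem_inf.
apply/hyperconnectedP; split.
  have [x ux] := sem_fset_nonempty HS (valP a.2).
  by exists (fun=> x); rewrite sem_infE; exact/sem_fin_inf_const.
have hyp := @hyperconnected_prefixed X S sem irr_sem a.1 _
  (@hyperconnected_inf_words_over X (semF (val a.2))).
have KE f : Kinf a f <-> prefixed (semP a.1) (inf_words_over (semF (val a.2))) (Inf f).
  split=> [[s [g [Ps -> ug]]]|[s [w [Ps E [g wE ug]]]]].
    by exists s, (Inf g); split=> //; exists g.
  by move: E; rewrite wE => -[->]; exists s, g.
move=> _ _ [A oA <-] [B oB <-] [f [/KE Kf Af]] [g [/KE Kg Bg]].
have [w [Kw [Aw Bw]]] := hyp _ _ oA oB (ex_intro _ _ (conj Kf Af)) (ex_intro _ _ (conj Kg Bg)).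
case: (Kw) => s [v [_ wE [h vE _]]]; rewrite vE /= in wE; rewrite wE in Kw Aw Bw.
by exists (prepend_inf s h); split=> //; exact/KE.
Qed.

Lemma closed_inf_words_separation (C : set (inf_words X)) (f : inf_words X) :
  closed C -> ~ C f -> exists t, C `<=` finite_union Kinf t /\ ~ finite_union Kinf t f.
Proof.
move=> /closed_openC[A oA AC] nCf.
have Af : A (Inf f) by have : (~` C) f by []; rewrite -AC.
have [t [At nt]] : exists t, ~` A `<=` finite_union K t /\ ~ finite_union K t (Inf f).
  by apply: (closed_words_separation HS); [exact: open_closedC|].
(* Pairs with an empty second component contain only finite words and are dropped from the
   family. *)
exists (pmap (fun c => omap (pair c.1) (insub c.2)) t); split=> [g Cg|[a]].
  have [c ct cg] : finite_union K t (Inf g).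
    by apply: At => Ag; have : (~` C) g by rewrite -AC.
  have nu : c.2 != fset0.
    apply/eqP => u0; case/sem_fin_inf_Inf: cg => s [h [_ _ /(_ 0)]].
    by rewrite u0 sem_fset0.
  exists (c.1, Sub c.2 nu).
    rewrite mem_pmap; apply/mapP; exists c => //.
    by rewrite (insubT (fun u : {fset S} => u != fset0) nu).
  by rewrite sem_infE; case: c {ct} cg nu.
rewrite mem_pmap => /mapP[c ct]; case: insubP => //= u _ uE [aE] af.
apply: nt; exists c => //; move: af; rewrite aE sem_infE /preimage /forget_nonempty /= uE.
by case: (c).
Qed.

End Pairs.

(** * The two representations *)

Section Main.
Variables (X : topologicalType) (S : choiceType) (code : S -> nat).
Variables (sem : S -> set X) (le : rel S) (tau : {fset S}).
Variable meet : S -> S -> {fset S}.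
Hypothesis HS : S_representation code sem le tau meet.

Lemma representation_fin_inf : S_representation (X := fin_inf_words X)
  (code_pair code) (sem_fin_inf sem) (le_pair le)
  (tau_fin_inf tau) (meet_fin_inf code le meet).
Proof.
have injc := srep_code_inj HS.
have cK c : closed (sem_fin_inf sem c : set (fin_inf_words X)) by exact: (closed_sem_fin_inf HS).
have KT : exists s, [set: fin_inf_words X] = finite_union (sem_fin_inf sem) s.
  by eexists; exact: (setT_fin_inf HS).
have KI c d : exists s, (sem_fin_inf sem c `&` sem_fin_inf sem d) =
    finite_union (sem_fin_inf sem) s.
  by eexists; exact: (sem_meet_fin_inf HS).
have Ksep := closed_words_separation HS.
have Kwf := sem_fin_inf_wf HS.
split.
- exact: (closed_family_noetherian cK KT KI Ksep Kwf).
- exact: code_pair_inj.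
- exact: re_code_pair injc (srep_re HS).
- exact: irreducible_closed_fin_inf HS.
- by move=> C; exact: (closed_family_irreducible cK KT KI Ksep Kwf).
- exact: decidable_le_pair injc (srep_le_decidable HS).
- by move=> c d; rewrite (le_pairE HS) sem_fin_inf_sub.
- rewrite (setT_fin_inf HS); apply/seteqP; split=> w [c cin cw]; exists c => //.
- exact: computable_map2_meet_fin_inf injc (srep_le_decidable HS) (srep_meet_computable HS).
- move=> c d; rewrite (sem_meet_fin_inf HS).
  by apply/seteqP; split=> w [e ein ew]; exists e.
Qed.

Lemma representation_inf : S_representation (X := inf_words X)
  (code_pair_inf code) (sem_inf sem) (le_pair_inf le)
  (tau_inf tau) (meet_inf code le meet).
Proof.
have injc := srep_code_inj HS.
have cK c : closed (sem_inf sem c : set (inf_words X)) by exact: (closed_sem_inf HS).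
have KT : exists s, [set: inf_words X] = finite_union (sem_inf sem) s.
  by eexists; exact: (setT_inf HS).
have KI c d : exists s, (sem_inf sem c `&` sem_inf sem d) =
    finite_union (sem_inf sem) s.
  by eexists; exact: (sem_meet_inf HS).
have Ksep := closed_inf_words_separation HS.
have Kwf := sem_inf_wf HS.
split.
- exact: (closed_family_noetherian cK KT KI Ksep Kwf).
- exact: code_pair_inf_inj.
- exact: re_code_pair_inf injc (srep_re HS).
- exact: irreducible_closed_inf HS.
- by move=> C; exact: (closed_family_irreducible cK KT KI Ksep Kwf).
- exact: decidable_le_pair_inf injc (srep_le_decidable HS).
- by move=> c d; rewrite (sem_inf_sub HS) /le_pair_inf (le_pairE HS).
- rewrite (setT_inf HS); apply/seteqP; split=> w [c cin cw]; exists c => //.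
- exact: computable_map2_meet_inf injc (srep_le_decidable HS) (srep_meet_computable HS).
- move=> c d; rewrite (sem_meet_inf HS).
  by apply/seteqP; split=> w [e ein ew]; exists e.
Qed.

(** Certifies that the atom removed by [without_last] is the star over [meet_fset u v]. *)
Lemma meet_product_with_star (P Q : product S) (u v : {fset S}) (T : product S) :
  T \in meet_product code le meet (with_star P u) (with_star Q v) ->
  exists R : product S, T = with_star R (meet_fset meet u v).
Proof. by have [form _] := meet_pair_spec HS (P, u) (Q, v); exact: form. Qed.

End Main.

Theorem theorem5p24 (X : topologicalType) (S : choiceType) (code : S -> nat)
    (sem : S -> set X) (le : rel S) (tau : {fset S})
    (meet : S -> S -> {fset S})
    (HS : S_representation code sem le tau meet) :
  [/\ (forall (P Q : product S) (u v : {fset S}) (T : product S),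
         T \in meet_product code le meet (with_star P u) (with_star Q v) ->
         exists R : product S, T = with_star R (meet_fset meet u v)),
      S_representation (X := fin_inf_words X)
        (code_pair code) (sem_fin_inf sem) (le_pair le)
        (tau_fin_inf tau) (meet_fin_inf code le meet)
    & S_representation (X := inf_words X)
        (code_pair_inf code) (sem_inf sem) (le_pair_inf le)
        (tau_inf tau) (meet_inf code le meet)].
Proof.
split; last exact: representation_inf HS.
  by move=> P Q u v T; exact: (meet_product_with_star HS).
exact: representation_fin_inf HS.
Qed.
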